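(* Let $f\in L^2(\Omega)$ and let $u_h^*$ be obtained by the following procedure: (1) find $r_h\in A^3_{h0}$ such that $(\nabla_hr_h,\nabla_hs_h)=(f,s_h)$ for all $s_h\in A^3_{h0}$; (2) find $(\boldsymbol\varphi_h,p_h)\in\mathbf{G}^2_{h0}\times\mathbb{P}^1_{h0}$ such that $$(\nabla_h\boldsymbol\varphi_h,\nabla_h\boldsymbol\psi_h)+(p_h,\mathrm{rot}_h\boldsymbol\psi_h)=(\nabla_hr_h,\boldsymbol\psi_h)\ \ \forall\boldsymbol\psi_h\in\mathbf{G}^2_{h0},\qquad(q_h,\mathrm{rot}_h\boldsymbol\varphi_h)=0\ \ \forall q_h\in\mathbb{P}^1_{h0};$$ (3) find $u_h^*\in A^3_{h0}$ such that $(\nabla_hu_h^*,\nabla_hv_h^* )=(\boldsymbol\varphi_h,\nabla_hv_h^* )$ for all $v_h^*\in A^3_{h0}$. Let $u_h\in B^3_{h0}$ be the solution of $(\nabla_h^2u_h,\nabla_h^2v_h)=(f,v_h)$ for all $v_h\in B^3_{h0}$. Then $u_h^*=u_h$.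
   Context: $\Omega\subset\mathbb{R}^2$ is a simply connected polygonal domain and $\mathcal{T}_h$ is a shape-regular triangulation of $\Omega$. $\mathcal{E}_h^i,\mathcal{E}_h^b$ are the interior and boundary edges; $\mathcal{X}_h,\mathcal{X}_h^b$ all vertices and boundary vertices; $\partial_{\mathbf n}$ is the normal derivative on an edge $e$ and $[\![\cdot]\!]$ the jump across $e$. A subscript $h$ on a differential operator means it is applied cell by cell; $\nabla^2$ is the Hessian; $\mathrm{rot}\,\mathbf{v}=\partial_x v^2-\partial_y v^1$; $(\cdot,\cdot)$ is the $L^2(\Omega)$ inner product. Spaces: $\mathbb{P}^k_h:=\{w\in L^2(\Omega): w|_T\in P_k(T)\ \forall T\}$, $\mathbb{P}^k_{h0}:=\{w\in\mathbb{P}^k_h:\int_\Omega w=0\}$; $A^3_{h0}:=\{w\in\mathbb{P}^3_h: w$ is continuous at every $a\in\mathcal{X}_h$, $w(a)=0\ \forall a\in\mathcal{X}_h^b\}$; $\mathbf{G}_{h0}^2:=\{\mathbf{v}\in(\mathbb{P}^2_h)^2:\int_e p_e[\![v^j]\!]=0\ \forall e\in\mathcal{E}_h^i$ and $\int_e p_e v^j=0\ \forall e\in\mathcal{E}_h^b$, for all $p_e\in P_1(e)$, $j=1,2\}$; $B_h^3:=\{v\in\mathbb{P}^3_h: v$ is continuous at every $a\in\mathcal{X}_h$; $\int_e[\![v]\!]=0$ and $\int_e p_e[\![\partial_{\mathbf n}v]\!]=0$ for all $p_e\in P_1(e)$, $e\in\mathcal{E}_h^i\}$; $B_{h0}^3:=\{v\in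 B_h^3: v(a)=0\ \forall a\in\mathcal{X}_h^b;\ \int_e v=0$ and $\int_e p_e\,\partial_{\mathbf n}v=0\ \forall p_e\in P_1(e),\ \forall e\in\mathcal{E}_h^b\}$. *)

(* Defs.v *)
From HB Require Import structures.
From mathcomp Require Import all_boot all_order all_algebra.
From mathcomp Require Import all_classical all_reals all_analysis.
Import Order.TTheory GRing.Theory Num.Theory.
Import numFieldNormedType.Exports.

Set Implicit Arguments.
Unset Strict Implicit.
Unset Printing Implicit Defensive.

Local Open Scope classical_set_scope.
Local Open Scope ring_scope.

Definition frontier {R : realType} (A : set (R * R)) : set (R * R) :=
  closure A `\` interior A.

Definition segm {R : realType} (a b : R * R) : set (R * R) :=
  [set x | exists2 t : R, 0 <= t <= 1 & x = a + t *: (b - a)].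

(* The norm that the library puts on R * R is the sup norm. *)
Definition enorm {R : realType} (x : R * R) : R :=
  Num.sqrt (x.1 ^+ 2 + x.2 ^+ 2).

(* The condition [interior (closure Omega) = Omega] says that Omega lies on one
   side only of each of its sides: it excludes slits and cracks. *)
Definition polygonal_domain {R : realType} (Omega : set (R * R)) : Prop :=
  [/\ Omega !=set0, open Omega, connected Omega & bounded_set Omega] /\
  interior (closure Omega) = Omega /\
  exists s : seq ((R * R) * (R * R)),
    frontier Omega = \bigcup_(e in [set` s]) segm e.1 e.2.

Definition path_in {R : realType} (A : set (R * R)) (x y : R * R)
    (g : R -> R * R) : Prop :=
  [/\ {within `[0, 1], continuous g}, (forall t : R, 0 <= t <= 1 -> A (g t)),
      g 0 = x & g 1 = y].

Definition simply_connected {R : realType} (A : set (R * R)) : Prop :=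
  (forall x y, A x -> A y -> exists g, path_in A x y g) /\
  (forall x g, path_in A x x g ->
    exists H : R * R -> R * R,
      [/\ {within `[0, 1] `*` `[0, 1], continuous H},
          (forall s t : R, 0 <= s <= 1 -> 0 <= t <= 1 -> A (H (s, t))),
          (forall t : R, 0 <= t <= 1 -> H (0, t) = g t),
          (forall t : R, 0 <= t <= 1 -> H (1, t) = x) &
          (forall s : R, 0 <= s <= 1 -> H (s, 0) = x /\ H (s, 1) = x)]).

(* A triangle is given by its three vertices, a mesh of N triangles by a
   function 'I_N -> triangle R. *)
Definition triangle (R : realType) : Type := 'I_3 -> R * R.

Definition vertex_of {R : realType} (T : triangle R) (a : R * R) : Prop :=
  exists k, T k = a.

Definition edge_of {R : realType} (T : triangle R) (a b : R * R) : Prop :=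
  exists k l, [/\ k != l, T k = a & T l = b].

Definition cell {R : realType} (T : triangle R) : set (R * R) :=
  [set x | exists l : 'I_3 -> R,
    [/\ forall k, 0 <= l k, \sum_k l k = 1 & x = \sum_k l k *: T k]].

Definition nondegenerate {R : realType} (T : triangle R) : Prop :=
  forall l : 'I_3 -> R,
    \sum_k l k = 0 -> \sum_k l k *: T k = 0 -> forall k, l k = 0.

Definition triangulation {R : realType} (Omega : set (R * R)) (N : nat)
    (Th : 'I_N -> triangle R) : Prop :=
  [/\ forall i, nondegenerate (Th i),
      closure Omega = \bigcup_(i in [set: 'I_N]) cell (Th i) &
      forall i j, i != j ->
        [\/ cell (Th i) `&` cell (Th j) = set0,
            exists a, [/\ vertex_of (Th i) a, vertex_of (Th j) a &
              cell (Th i) `&` cell (Th j) = [set a]] |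
            exists a b, [/\ edge_of (Th i) a b, edge_of (Th j) a b &
              cell (Th i) `&` cell (Th j) = segm a b]]].

(* h_T <= sigma * rho_T for every cell T, with h_T the diameter of T and rho_T
   the diameter of its largest inscribed disc. *)
Definition shape_regular {R : realType} (sigma : R) (N : nat)
    (Th : 'I_N -> triangle R) : Prop :=
  forall i, exists (c : R * R) (r : R),
    [/\ 0 < r, [set x | enorm (x - c) <= r] `<=` cell (Th i) &
        forall x y, cell (Th i) x -> cell (Th i) y ->
          enorm (x - y) <= sigma * (2 * r)].

Section Mesh.
Context {R : realType} (Omega : set (R * R)) (N : nat) (Th : 'I_N -> triangle R).

Definition mesh_vertex (a : R * R) : Prop := exists i, vertex_of (Th i) a.

Definition boundary_vertex (a : R * R) : Prop :=
  mesh_vertex a /\ frontier Omega a.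

Definition mesh_edge (a b : R * R) : Prop := exists i, edge_of (Th i) a b.

Definition boundary_edge (a b : R * R) : Prop :=
  mesh_edge a b /\ segm a b `<=` frontier Omega.

Definition interior_edge (a b : R * R) : Prop :=
  mesh_edge a b /\ ~ (segm a b `<=` frontier Omega).

End Mesh.

(* Polynomial functions of total degree at most k. *)
Definition Pk {R : realType} (k : nat) : set (R * R -> R) :=
  [set p | exists c : nat -> nat -> R,
    forall x, p x = \sum_(i < k.+1) \sum_(j < k.+1 | (i + j <= k)%N)
                      c i j * x.1 ^+ i * x.2 ^+ j].

(* A piecewise polynomial w is represented by the family of the polynomials
   w|_T, indexed by the cells, each extended to the whole plane.  Hence [w i x]
   with x on the boundary of cell i is the trace of w from that cell, cellwise
   operators act on each member of the family, and (the interfaces between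
   cells being negligible) equality of families is equality in L^2(Omega). *)
Definition broken (R : realType) (N : nat) : Type := 'I_N -> R * R -> R.
Definition vbroken (R : realType) (N : nat) : Type :=
  (broken R N * broken R N)%type.

(* The function on the plane, defined almost everywhere, that w represents. *)
Definition broken_fun {R : realType} {N : nat} (Th : 'I_N -> triangle R)
    (w : broken R N) (x : R * R) : R :=
  \sum_(i < N) w i x * \1_(interior (cell (Th i))) x.

Local Notation leb2 R :=
  (@lebesgue_measure R \x @lebesgue_measure R)%E (only parsing).

Definition L2 {R : realType} (Omega : set (R * R)) (f : R * R -> R) : Prop :=
  (f \_ Omega) \in Lfun (leb2 R) 2%:E.

Definition ip {R : realType} (Omega : set (R * R)) (f g : R * R -> R) : R :=
  \int[leb2 R]_(x in Omega) (f x * g x).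

Definition edge_integral {R : realType} (a b : R * R) (g : R * R -> R) : R :=
  enorm (b - a) * \int[lebesgue_measure]_(t in `[0%R, 1%R]) g (a + t *: (b - a)).

(* One of the two unit normals of the edge; every condition below in which it
   occurs is insensitive to this choice. *)
Definition unit_normal {R : realType} (a b : R * R) : R * R :=
  (enorm (b - a))^-1 *: ((b.2 - a.2, a.1 - b.1) : R * R).

Section CellwiseOperators.
Context {R : realType} {N : nat}.
Implicit Types (w : broken R N) (v : vbroken R N).

Definition dx_h w : broken R N := fun i x => 'D_((1, 0) : R * R) (w i) x.
Definition dy_h w : broken R N := fun i x => 'D_((0, 1) : R * R) (w i) x.
Definition grad_h w : vbroken R N := (dx_h w, dy_h w).
Definition rot_h v : broken R N := fun i x => dx_h v.2 i x - dy_h v.1 i x.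
Definition dn_h (a b : R * R) w : broken R N :=
  fun i x => 'D_(unit_normal a b) (w i) x.

End CellwiseOperators.

Section Spaces.
Context {R : realType} (Omega : set (R * R)) (N : nat) (Th : 'I_N -> triangle R).
Implicit Types (w : broken R N) (v : vbroken R N).

Definition bip w w' : R := ip Omega (broken_fun Th w) (broken_fun Th w').
Definition vbip v v' : R := bip v.1 v'.1 + bip v.2 v'.2.
Definition grad_bip v v' : R :=
  vbip (grad_h v.1) (grad_h v'.1) + vbip (grad_h v.2) (grad_h v'.2).
(* The cellwise Hessian is the cellwise Jacobian of the cellwise gradient. *)
Definition hess_bip w w' : R := grad_bip (grad_h w) (grad_h w').

Definition Ph (k : nat) : set (broken R N) := [set w | forall i, Pk k (w i)].

Definition Ph0 (k : nat) : set (broken R N) :=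
  [set w | Ph k w /\ \int[leb2 R]_(x in Omega) broken_fun Th w x = 0].

Definition vertex_continuous w : Prop :=
  forall a i j, vertex_of (Th i) a -> vertex_of (Th j) a -> w i a = w j a.

Definition vertex_zero w : Prop :=
  forall a i, boundary_vertex Omega Th a -> vertex_of (Th i) a -> w i a = 0.

(* [int_e p [[w]] = 0] for all p in P_k(e), where e is the edge [a, b]; the
   members of P_k(e) are the restrictions to e of the members of [Pk k]. *)
Definition jump_orthogonal (k : nat) (a b : R * R) w : Prop :=
  forall p i j, Pk k p -> edge_of (Th i) a b -> edge_of (Th j) a b -> i != j ->
    edge_integral a b (fun x => p x * (w i x - w j x)) = 0.

Definition trace_orthogonal (k : nat) (a b : R * R) w : Prop :=
  forall p i, Pk k p -> edge_of (Th i) a b ->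
    edge_integral a b (fun x => p x * w i x) = 0.

Definition A3h0 : set (broken R N) :=
  [set w | [/\ Ph 3 w, vertex_continuous w & vertex_zero w]].

Definition G2h0 : set (vbroken R N) :=
  [set v | [/\ Ph 2 v.1, Ph 2 v.2,
    forall a b, interior_edge Omega Th a b ->
      jump_orthogonal 1 a b v.1 /\ jump_orthogonal 1 a b v.2 &
    forall a b, boundary_edge Omega Th a b ->
      trace_orthogonal 1 a b v.1 /\ trace_orthogonal 1 a b v.2]].

Definition B3h : set (broken R N) :=
  [set w | [/\ Ph 3 w, vertex_continuous w &
    forall a b, interior_edge Omega Th a b ->
      jump_orthogonal 0 a b w /\ jump_orthogonal 1 a b (dn_h a b w)]].

Definition B3h0 : set (broken R N) :=
  [set w | [/\ B3h w, vertex_zero w &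
    forall a b, boundary_edge Omega Th a b ->
      trace_orthogonal 0 a b w /\ trace_orthogonal 1 a b (dn_h a b w)]].

End Spaces.

(* Main.v *)
(** The heart of the proof is the exactness of
      B^3_h0 --grad_h--> G^2_h0 --rot_h--> P^1_h0.
    Since rot_h phi is orthogonal to the piecewise affine functions of mean
    zero, it is a constant kappa, and kappa = 0 because the circulations of phi
    around the cells sum to zero.  Hence phi is cellwise the gradient of a cubic,
    determined up to one constant per cell.  The edge conditions say that the
    difference of the cubic between the ends of an edge does not depend on the
    cell and vanishes on the boundary, so it defines a closed relative cochain,
    which has to be the coboundary of a vertex function vanishing on the
    boundary.  By linear algebra this is equivalent to exactness of the dual
    complex: a function zeta on the interior edges whose sum around each interior
    vertex vanishes is a jump of cell constants.  These constants are values of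
      sum_v rho_v Theta_v(x) + 1/2 sum_(v,w) zeta(v,w) angle_x(v,w),
    where rho_v is the sum of zeta around v and Theta_v is a branch on Omega of
    the angle around the boundary vertex v, which exists since Omega is simply
    connected.  So phi = grad_h w with w in B^3_h0; testing with psi = grad_h v
    shows that w solves the problem of u_h, and the third step recovers w. *)
Require Import Defs.
From mathcomp Require Import all_boot all_order all_algebra.
From mathcomp Require Import all_classical all_reals all_analysis.
From mathcomp Require Import measurable_realfun ring lra.
Import Order.TTheory GRing.Theory Num.Theory.
Import numFieldNormedType.Exports.
Set Implicit Arguments.
Unset Strict Implicit.
Unset Printing Implicit Defensive.
Local Open Scope classical_set_scope.
Local Open Scope ring_scope.

(** * Oriented angles *)

Section Angle.
Context {R : realType}.
Implicit Types (u v w : R * R) (t x y : R).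

(** Simple connectedness is given through homotopies of loops, while exactness is a statement on a
    finite mesh. A direct proof would integrate the cochain along edge paths and need every closed
    edge path to bound cells. Dualising removes paths from the mesh: the unknown becomes a function
    of cells, for which a formula can be written, and homotopy enters only through the branches of
    the angle around points off Omega. The formula is checked along segments from a centroid to a
    point of a side; at that point the angle subtended by the side takes, by the default value of
    [arg], the mean of its two limits, so each of the two cells sees half the jump, pi zeta, and 2
    pi is divided out. On an edge let q be a jump in the parameter t. The moments of q' against 1
    and t are q(1) - q(0) and q(1) minus the mean of q: vertex continuity and zero mean thus control
    the tangential half of the conditions of G, while the normal half is imposed in B. Uniqueness
    needs functions with vanishing cellwise derivatives to be zero. Among the cells where such a
    function is nonzero, one has an edge belonging to no other; beyond this edge lies the boundary
    or a cell where it is zero. *)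

Definition dot u v : R := u.1 * v.1 + u.2 * v.2.
Definition cross u v : R := u.1 * v.2 - u.2 * v.1.

Lemma lagrange_dot_cross u v :
  (enorm u * enorm v) ^+ 2 = dot u v ^+ 2 + cross u v ^+ 2.
Proof.
rewrite exprMn /enorm !sqr_sqrtr ?addr_ge0 ?sqr_ge0// /dot /cross.
by ring.
Qed.

Lemma enorm_ge0 u : 0 <= enorm u.
Proof. exact: sqrtr_ge0. Qed.

Lemma enorm_eq0 u : (enorm u == 0) = (u == 0).
Proof.
rewrite /enorm sqrtr_eq0 le_eqVlt ltNge addr_ge0 ?sqr_ge0//= orbF.
by rewrite paddr_eq0 ?sqr_ge0// !sqrf_eq0; case: u.
Qed.

Lemma enorm_gt0 u : u != 0 -> 0 < enorm u.
Proof. by move=> u0; rewrite lt_neqAle enorm_ge0 eq_sym enorm_eq0 u0. Qed.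

Lemma sqr_enorm u : enorm u ^+ 2 = u.1 ^+ 2 + u.2 ^+ 2.
Proof. by rewrite sqr_sqrtr// addr_ge0 ?sqr_ge0. Qed.

(* At the cut, where the denominator vanishes, the junk value of the division
   makes [arg] equal to 0; [angle_sum_triangle] is used there with y inside the
   segment, for which this is the convenient (mean) value. *)
Definition arg x y : R := 2 * atan (y / (Num.sqrt (x ^+ 2 + y ^+ 2) + x)).

Definition angle u v : R := arg (dot u v) (cross u v).

(** The hypothesis places (x, y) off the half-line y = 0, x <= 0: if x <= 0 then y is nonzero and
    the modulus strictly exceeds - x. *)
Lemma arg_cut x y : (y != 0) || (0 < x) -> 0 < Num.sqrt (x ^+ 2 + y ^+ 2) + x.
Proof.
move=> h; have [x0|x0] := ltP 0 x; first by rewrite ltr_wpDl ?sqrtr_ge0.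
move: h; rewrite ltNge x0 orbF => y0.
rewrite -ltrBlDr sub0r -[- x]ger0_norm ?oppr_ge0// -sqrtr_sqr sqrrN.
have y2 : 0 < y ^+ 2 by rewrite lt0r sqr_ge0 sqrf_eq0 y0.
by rewrite ltr_sqrt ?ltrDl// ltr_wpDl ?sqr_ge0.
Qed.

(** Half-angle formula: with n the modulus, y / (n + x) is the tangent of half the polar angle, so
    the squared cosine of that half is (n + x) / (2 n), and the duplication formulas give the
    rest. *)
Lemma cos_arg x y : (y != 0) || (0 < x) ->
  Num.sqrt (x ^+ 2 + y ^+ 2) * cos (arg x y) = x /\
  Num.sqrt (x ^+ 2 + y ^+ 2) * sin (arg x y) = y.
Proof.
move=> h; have := arg_cut h; have n2 : Num.sqrt (x ^+ 2 + y ^+ 2) ^+ 2 = x ^+ 2 + y ^+ 2.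
  by rewrite sqr_sqrtr// addr_ge0 ?sqr_ge0.
rewrite /arg; move: n2 (sqrtr_ge0 (x ^+ 2 + y ^+ 2)).
set n := Num.sqrt _ => n2 n0 nx.
have n_gt0 : 0 < n.
  rewrite lt0r n0 andbT; apply/eqP => nE; move: h n2 nx; rewrite nE add0r expr0n/=.
  move=> _ /eqP; rewrite eq_sym paddr_eq0 ?sqr_ge0// sqrf_eq0 => /andP[/eqP-> _].
  by rewrite ltxx.
set z := y / (n + x).
have z2 : 1 + z ^+ 2 = 2 * n / (n + x).
  rewrite /z expr_div_n; have -> : y ^+ 2 = n ^+ 2 - x ^+ 2 by rewrite n2; ring.
  by field; rewrite gt_eqF.
have z2_gt0 : 0 < 1 + z ^+ 2 by rewrite ltr_pwDl ?sqr_ge0.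
have cz2 : cos (atan z) ^+ 2 = (n + x) / (2 * n).
  rewrite cos_atan exprVn sqr_sqrtr ?ltW// z2; field.
  by rewrite !gt_eqF.
have cz0 : cos (atan z) != 0.
  by rewrite cos_atan invr_eq0 gt_eqF// sqrtr_gt0.
have sz : sin (atan z) = z * cos (atan z).
  by rewrite -{2}(atanK z) /tan mulfVK.
rewrite mulr_natl cos_mulr2n sin_mulr2n sz.
split.
  by rewrite cz2; field; rewrite gt_eqF.
have -> : cos (atan z) * (z * cos (atan z)) = z * cos (atan z) ^+ 2 by ring.
by rewrite cz2 /z; field; rewrite !gt_eqF.
Qed.

Lemma arg_gt0 x y : 0 < y -> 0 < arg x y < pi.
Proof.
move=> y0; have z0 : 0 < y / (Num.sqrt (x ^+ 2 + y ^+ 2) + x).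
  by rewrite divr_gt0// arg_cut// gt_eqF.
rewrite /arg; apply/andP; split.
  by rewrite mulr_gt0// -atan0 lt_atan.
by have := atan_ltpi2 (y / (Num.sqrt (x ^+ 2 + y ^+ 2) + x)); lra.
Qed.

Lemma arg_opp x y : arg x (- y) = - arg x y.
Proof. by rewrite /arg sqrrN mulNr atanN mulrN. Qed.

Lemma arg0 x : arg x 0 = 0.
Proof. by rewrite /arg mul0r atan0 mulr0. Qed.

(* [t] is an oriented angle, modulo 2 pi, from u to v. *)
Definition is_angle t u v : Prop :=
  enorm u * enorm v * cos t = dot u v /\ enorm u * enorm v * sin t = cross u v.

Lemma sqrt_dot_cross u v :
  Num.sqrt (dot u v ^+ 2 + cross u v ^+ 2) = enorm u * enorm v.
Proof.
by rewrite -lagrange_dot_cross sqrtr_sqr ger0_norm// mulr_ge0 ?enorm_ge0.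
Qed.

Lemma angleP u v : (cross u v != 0) || (0 < dot u v) -> is_angle (angle u v) u v.
Proof. by move=> /cos_arg; rewrite sqrt_dot_cross. Qed.

Lemma is_angle0 u : is_angle 0 u u.
Proof.
rewrite /is_angle sin0 cos0 mulr1 mulr0 -expr2 sqr_enorm /dot /cross.
by split; ring.
Qed.

(** In complex notation conj(u) v = dot u v + i cross u v, and the product of conj(u) v and conj(v)
    w is |v|^2 conj(u) w; the nonzero factor |v|^2 is cancelled. *)
Lemma is_angleD s t u v w : v != 0 ->
  is_angle s u v -> is_angle t v w -> is_angle (s + t) u w.
Proof.
move=> v0 [cs ss] [ct st]; have nv : enorm v ^+ 2 != 0 by rewrite sqrf_eq0 enorm_eq0.
split; apply: (mulfI nv); rewrite ?cosD ?sinD.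
  transitivity (dot u v * dot v w - cross u v * cross v w).
    by rewrite -cs -ct -ss -st; ring.
  by rewrite sqr_enorm /dot /cross; ring.
transitivity (cross u v * dot v w + dot u v * cross v w).
  by rewrite -cs -ct -ss -st; ring.
by rewrite sqr_enorm /dot /cross; ring.
Qed.

Lemma is_angleN t u v : is_angle t u v -> is_angle (- t) v u.
Proof.
by rewrite /is_angle cosN sinN => -[c s]; split;
  rewrite ?mulrN [enorm v * _]mulrC ?c ?s /dot /cross; ring.
Qed.

Lemma is_angle_cos1 t u : u != 0 -> is_angle t u u -> cos t = 1.
Proof.
move=> u0 [+ _]; have [+ _] := is_angle0 u; rewrite cos0 => <-.
by apply: mulfI; rewrite mulf_neq0 ?enorm_eq0.
Qed.

Lemma angle_refl u : angle u u = 0.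
Proof. by rewrite /angle /cross mulrC subrr arg0. Qed.

Lemma angle_opp u v : angle v u = - angle u v.
Proof.
rewrite /angle -arg_opp; congr arg; rewrite /dot /cross; ring.
Qed.

Lemma continuous_angle (T : topologicalType) (f g : T -> R * R) (s : T) :
  {for s, continuous f} -> {for s, continuous g} ->
  (cross (f s) (g s) != 0) || (0 < dot (f s) (g s)) ->
  {for s, continuous (fun s => angle (f s) (g s))}.
Proof.
move=> cf cg h.
have cf1 : (fun s => (f s).1) @ s --> (f s).1 by apply: cvg_comp cf _; exact: cvg_fst.
have cf2 : (fun s => (f s).2) @ s --> (f s).2 by apply: cvg_comp cf _; exact: cvg_snd.
have cg1 : (fun s => (g s).1) @ s --> (g s).1 by apply: cvg_comp cg _; exact: cvg_fst.
have cg2 : (fun s => (g s).2) @ s --> (g s).2 by apply: cvg_comp cg _; exact: cvg_snd.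
have cd : (fun s => dot (f s) (g s)) @ s --> dot (f s) (g s).
  by apply: cvgD; apply: cvgM.
have cc : (fun s => cross (f s) (g s)) @ s --> cross (f s) (g s).
  by apply: cvgB; apply: cvgM.
rewrite /prop_for /continuous_at /angle /arg.
apply: cvgM; first exact: cvg_cst.
apply: continuous_cvg; first exact: continuous_atan.
apply: cvgM => //; apply: cvgV; first by rewrite gt_eqF// arg_cut.
apply: cvgD => //.
apply: continuous_cvg; first exact: sqrt_continuous.
by apply: cvgD; rewrite !expr2; apply: cvgM.
Qed.

(** This translates the cut of [angle] into geometry: seen from a, the vectors to x and y are
    opposite, or one of them is zero, only if a lies on the segment. *)
Lemma is_angle_cut_segm (a x y : R * R) : ~ segm x y a ->
  (cross (x - a) (y - a) != 0) || (0 < dot (x - a) (y - a)).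
Proof.
move=> na; apply/orP; have [c0|c0] := eqVneq (cross (x - a) (y - a)) 0; last by left.
right; rewrite ltNge; apply/negP => d0; apply: na.
have [xy|xy] := eqVneq x y.
  exists 0; first by rewrite lexx ler01.
  move: d0; rewrite scale0r addr0 -xy /dot -!expr2 => d0.
  have : enorm (x - a) == 0.
    rewrite -sqrf_eq0 eq_le sqr_ge0 andbT sqr_enorm.
    exact: d0.
  by rewrite enorm_eq0 subr_eq0 => /eqP.
have n0 : enorm (y - x) ^+ 2 != 0 by rewrite sqrf_eq0 enorm_eq0 subr_eq0 eq_sym.
(* Parameter of the orthogonal projection of a on the line through x and y: the nonpositive dot
   product places it in [0, 1], and the vanishing cross product makes a coincide with the
   projection. *)
exists (dot (a - x) (y - x) / enorm (y - x) ^+ 2).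
  have n_gt0 : 0 < enorm (y - x) ^+ 2 by rewrite lt0r n0 sqr_ge0.
  rewrite ler_pdivrMr// mul1r (pmulr_lge0 _ (_ : 0 < _^-1)) ?invr_gt0//.
  rewrite sqr_enorm; move: d0; rewrite /dot/= => d0.
  have := sqr_ge0 (y.1 - a.1); have := sqr_ge0 (y.2 - a.2).
  have := sqr_ge0 (x.1 - a.1); have := sqr_ge0 (x.2 - a.2).
  by move=> ? ? ? ?; apply/andP; split; nra.
have key (p q r : R) : (p + dot (a - x) (y - x) / enorm (y - x) ^+ 2 * q - r)
    * enorm (y - x) ^+ 2 = (p - r) * enorm (y - x) ^+ 2 + dot (a - x) (y - x) * q.
  by rewrite mulrBl mulrDl -!mulrA [_^-1 * _]mulrCA mulVf// mulr1; ring.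
apply/eqP; rewrite eq_sym -subr_eq0; apply/eqP.
rewrite [LHS]surjective_pairing; congr pair; apply: (mulIf n0);
  rewrite [LHS]key [RHS]mul0r sqr_enorm.
  transitivity (cross (x - a) (y - a) * (y - x).2); last by rewrite c0 mul0r.
  by rewrite /cross /dot/=; ring.
transitivity (- cross (x - a) (y - a) * (y - x).1); last by rewrite c0 oppr0 mul0r.
by rewrite /cross /dot/=; ring.
Qed.

(** The values of f are multiples of 2 pi, a discrete set, so the intermediate value theorem forbids
    any variation. *)
Lemma cos1_const (f : R -> R) : continuous f -> (forall t, cos (f t) = 1) ->
  forall s t, f s = f t.
Proof.
move=> cf f1 s t; apply/eqP; rewrite eq_sym -subr_eq0; apply/negPn/negP => fst0.
pose h (u : R) := f u - f s.
have ch : continuous h by move=> u; apply: cvgB; [exact: cf | exact: cvg_cst].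
have h1 (u : R) : cos (h u) = 1.
  have s0 (v : R) : sin (f v) = 0 by apply: cos1sin0; rewrite f1 normr1.
  by rewrite cosB !f1 !s0; ring.
(* If h t is nonzero, |h| must take the value m; the cap at 1 keeps m in [0, pi], where the cosine
   is injective, so cos m = 1 is impossible. *)
pose m := Num.min `|h t| 1.
have m0 : 0 < m <= 1 by rewrite lt_min normr_gt0 fst0 ltr01 ge_min lexx orbT.
have [u hu] : exists u : R, `|h u| = m.
  have cn : continuous (fun u : R => `|h u|).
    by move=> v; apply: (continuous_comp (ch v)); exact: norm_continuous.
  have mm : m <= `|h t| by rewrite ge_min lexx.
  have h0 : `|h s| = 0 by rewrite /h subrr normr0.
  have [st|/ltW ts] := leP s t.
    have [] := @IVT _ (fun u : R => `|h u|) s t m st; last by move=> c _ <-; exists c.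
      exact: continuous_subspaceT.
    by rewrite h0 min_l ?max_r// mm; lra.
  have [] := @IVT _ (fun u : R => `|h u|) t s m ts; last by move=> c _ <-; exists c.
    exact: continuous_subspaceT.
  by rewrite h0 min_r ?max_l// mm; lra.
have := h1 u; rewrite -cos_norm hu => cm.
have pi2 := @pi_ge2 R.
have : cos m < cos 0 by rewrite ltr_cos// ?in_itv/=; lra.
by rewrite cm cos0 ltxx.
Qed.

(** Retraction of the line onto [0, 1]. Composing with it makes a path given on [0, 1] continuous on
    the whole line, so that subspace topologies disappear from the lifting arguments. *)
Definition clamp (t : R) : R := Num.min 1 (Num.max 0 t).

Lemma clamp_itv t : 0 <= clamp t <= 1.
Proof. by rewrite /clamp le_min ler01 le_max lexx/= ge_min lexx. Qed.

Lemma clamp_id t : 0 <= t <= 1 -> clamp t = t.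
Proof. by move=> /andP[t0 t1]; rewrite /clamp max_r// min_r. Qed.

Lemma clamp_le0 t : t <= 0 -> clamp t = 0.
Proof. by move=> t0; rewrite /clamp max_l// min_r. Qed.

Lemma clamp_ge1 t : 1 <= t -> clamp t = 1.
Proof. by move=> t1; rewrite /clamp max_r ?min_l// (le_trans ler01). Qed.

Lemma continuous_clamp : continuous clamp.
Proof.
move=> t; apply: continuous_min; first exact: cvg_cst.
by apply: continuous_max; [exact: cvg_cst|exact: cvg_id].
Qed.

Lemma segm_convex u v p q r :
  segm u v p -> segm u v q -> segm p q r -> segm u v r.
Proof.
move=> [s1 h1 ->] [s2 h2 ->] [s3 h3 ->]; exists ((1 - s3) * s1 + s3 * s2).
  have {h1 h2 h3} : [/\ 0 <= (1 - s3) * s1, 0 <= s3 * s2, 0 <= (1 - s3) * (1 - s1) &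
    0 <= s3 * (1 - s2)] by split; apply: mulr_ge0; lra.
  by rewrite !(mulrBl, mulrBr) => -[? ? ? ?]; lra.
apply/eqP; rewrite -subr_eq0; apply/eqP.
by rewrite [LHS]surjective_pairing; congr pair; rewrite /=/GRing.scale/=; ring.
Qed.

Lemma segm_sym u v p : segm u v p -> segm v u p.
Proof.
move=> [s1 h1 ->]; exists (1 - s1); first by lra.
apply/eqP; rewrite -subr_eq0; apply/eqP.
by rewrite [LHS]surjective_pairing; congr pair; rewrite /=/GRing.scale/=; ring.
Qed.

Lemma segm_left u v : segm u v u.
Proof. by exists 0; rewrite ?lexx ?ler01 ?scale0r ?addr0. Qed.

Lemma segm_right u v : segm u v v.
Proof. by exists 1; rewrite ?lexx ?ler01 ?scale1r 1?addrC ?subrK. Qed.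

(* Shrinking the segment [x, y] to x, the sum varies continuously and stays a
   multiple of 2 pi. *)
Lemma angle_sum_disjoint (a b x y : R * R) : a != b ->
  segm x y `&` segm a b = set0 ->
  angle (x - a) (y - a) + angle (a - y) (b - y) + angle (y - b) (x - b) +
  angle (b - x) (a - x) = 0.
Proof.
move=> ab /disjoints_subset dis.
pose Y (s : R) := x + clamp s *: (y - x).
have Yin s : segm x y (Y s).
  by exists (clamp s) => //; exact: clamp_itv.
have Yn s : ~ segm a b (Y s) by exact: dis.
have Xn : ~ segm a b x.
  by have := Yn 0; rewrite /Y clamp_le0// scale0r addr0.
have an : ~ segm x y a.
  by move=> /dis; apply; exact: segm_left.
have bn : ~ segm x y b.
  by move=> /dis; apply; exact: segm_right.
have h1 s : (cross (x - a) (Y s - a) != 0) || (0 < dot (x - a) (Y s - a)).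
  by apply: is_angle_cut_segm => /(segm_convex (segm_left _ _) (Yin s)).
have h2 s : (cross (a - Y s) (b - Y s) != 0) || (0 < dot (a - Y s) (b - Y s)).
  exact: is_angle_cut_segm.
have h3 s : (cross (Y s - b) (x - b) != 0) || (0 < dot (Y s - b) (x - b)).
  by apply: is_angle_cut_segm => /(segm_convex (Yin s) (segm_left _ _)).
have h4 : (cross (b - x) (a - x) != 0) || (0 < dot (b - x) (a - x)).
  by apply: is_angle_cut_segm => /segm_sym.
pose F s := angle (x - a) (Y s - a) + angle (a - Y s) (b - Y s) + angle (Y s - b) (x - b) +
  angle (b - x) (a - x).
have cY : continuous Y.
  move=> s; apply: cvgD; first exact: cvg_cst.
  by apply: cvgZl; exact: continuous_clamp.
have cF : continuous F.
  move=> s; apply: cvgD; last exact: cvg_cst.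
  have cYB c : {for s, continuous (fun s => Y s - c)} by apply: cvgB; [exact: cY|exact: cvg_cst].
  have cBY c : {for s, continuous (fun s => c - Y s)} by apply: cvgB; [exact: cvg_cst|exact: cY].
  apply: cvgD.
    apply: cvgD.
      by apply: (@continuous_angle _ (fun=> x - a) (fun s => Y s - a)) => //; exact: cvg_cst.
    by apply: (@continuous_angle _ (fun s => a - Y s) (fun s => b - Y s)).
  by apply: (@continuous_angle _ (fun s => Y s - b) (fun=> x - b)) => //; exact: cvg_cst.
(* The four angles turn x - a into Y - a, Y - b, x - b and back into x - a; two of them are written
   with both vectors reversed, which [neg] undoes. *)
have F1 s : cos (F s) = 1.
  have nz u v : ~ segm x y v -> segm x y u -> u != v.
    by move=> nv uu; apply/eqP => uv; rewrite -uv in nv.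
  have Ya : Y s - a != 0 by rewrite subr_eq0 nz.
  have Yb : Y s - b != 0 by rewrite subr_eq0 nz.
  apply: (@is_angle_cos1 _ (x - a)); first by rewrite subr_eq0 nz//; exact: segm_left.
  have neg t u v : is_angle t (- u) (- v) -> is_angle t u v.
    by rewrite /is_angle /enorm /dot /cross/= !sqrrN !mulrNN.
  apply: (@is_angleD _ _ _ (x - b)); first by rewrite subr_eq0 nz//; exact: segm_left.
    apply: (is_angleD Yb) (angleP (h3 s)).
    apply: (is_angleD Ya (angleP (h1 s))).
    by apply: neg; rewrite !opprB; exact: angleP (h2 s).
  by apply: neg; rewrite !opprB; exact: angleP h4.
have -> : y = Y 1 by rewrite /Y clamp_ge1// scale1r addrC subrK.
rewrite -/(F 1) (cos1_const cF F1 1 0) /F /Y clamp_le0// scale0r addr0.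
by rewrite !angle_refl add0r addr0 [angle (b - x) _]angle_opp subrr.
Qed.

(** The bound 3 pi is the one satisfied by a sum of three angles of ]0, pi[; the next odd multiple
    of pi is just excluded. *)
Lemma cosN1_eq_pi t : 0 < t < 3 * pi -> cos t = - 1 -> t = pi.
Proof.
move=> t03 ct; have p0 := @pi_gt0 R.
have cos1_gt0 (s : R) : 0 < s <= pi -> cos s = 1 -> False.
  move=> s0 cs; have : cos s < cos 0 by rewrite ltr_cos// ?in_itv/=; lra.
  by rewrite cos0 cs ltxx.
have cU : cos `|t - pi| = 1.
  by rewrite cos_norm cosB cospi sinpi ct mulr0 addr0 mulrNN mulr1.
apply/eqP; rewrite -subr_eq0 -normr_eq0; apply/negPn/negP => U0.
have U2 : 0 < `|t - pi| < 2 * pi.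
  by rewrite lt0r U0 normr_ge0/= ltr_norml; apply/andP; split; lra.
have [Up|Up] := leP `|t - pi| pi; first by apply: (cos1_gt0 `|t - pi|) => //; lra.
apply: (cos1_gt0 (2 * pi - `|t - pi|)); first by lra.
by rewrite mulr_natl cosB cos2pi sin2pi cU mul0r addr0 mulr1.
Qed.

Lemma arg_scale t x y : 0 < t -> arg (t * x) (t * y) = arg x y.
Proof.
move=> t0; rewrite /arg !exprMn -mulrDr sqrtrM ?sqr_ge0// sqrtr_sqr gtr0_norm//.
by rewrite -mulrDr -mulf_div divff ?mul1r// gt_eqF.
Qed.

(** The angle at y sits on the cut and counts as 0; the other three are the angles of the triangle a
    b x, of sum pi up to orientation. This is the mean of the value 0 taken before y crosses [a, b]
    and of the full turn taken after. *)
Lemma angle_sum_triangle (a b x y : R * R) (t : R) :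
  0 < t < 1 -> y = a + t *: (b - a) -> cross (b - a) (x - a) != 0 ->
  angle (x - a) (y - a) + angle (a - y) (b - y) + angle (y - b) (x - b) +
  angle (b - x) (a - x) = - pi * Num.sg (cross (b - a) (x - a)).
Proof.
move=> t01 ->.
have -> : angle (x - a) (a + t *: (b - a) - a) = angle (x - a) (b - a).
  rewrite /angle -[RHS](@arg_scale t); last by lra.
  by congr arg; rewrite /dot /cross /=/GRing.scale/=; ring.
have -> : angle (a - (a + t *: (b - a))) (b - (a + t *: (b - a))) = 0.
  rewrite /angle (_ : cross _ _ = 0) ?arg0//.
  by rewrite /cross /=/GRing.scale/=; ring.
have -> : angle (a + t *: (b - a) - b) (x - b) = angle (a - b) (x - b).
  rewrite /angle -[RHS](@arg_scale (1 - t)); last by lra.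
  by congr arg; rewrite /dot /cross /=/GRing.scale/=; ring.
rewrite addr0; set c := cross _ _.
(* Exchanging a and b negates every angle as well as the orientation c. *)
wlog c0 : a b @c / c < 0.
  move=> hw c0; have [/hw-/(_ c0)//|c_ge0] := ltP c 0.
  have cE : cross (a - b) (x - b) = - c by rewrite /c /cross/=; ring.
  move: (hw b a) => /=; rewrite cE oppr_lt0 oppr_eq0 lt0r c0 c_ge0 => /(_ isT isT).
  rewrite sgrN => h.
  rewrite [angle (x - a) _]angle_opp [angle (a - b) _]angle_opp [angle (b - x) _]angle_opp.
  by move: h; lra.
rewrite ltr0_sg// mulrN1 opprK => cn0.
have c1 : cross (x - a) (b - a) = - c by rewrite /c /cross/=; ring.
have c2 : cross (a - b) (x - b) = - c by rewrite /c /cross/=; ring.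
have c3 : cross (b - x) (a - x) = - c by rewrite /c /cross/=; ring.
apply: cosN1_eq_pi.
  rewrite /angle c1 c2 c3.
  have := @arg_gt0 (dot (x - a) (b - a)) (- c).
  have := @arg_gt0 (dot (a - b) (x - b)) (- c).
  have := @arg_gt0 (dot (b - x) (a - x)) (- c).
  by rewrite oppr_gt0 => /(_ c0) ? /(_ c0) ? /(_ c0) ?; lra.
have nz (u v : R * R) : cross u v != 0 -> u != 0 /\ v != 0.
  rewrite /cross => uv; split; apply: contraNneq uv => ->/=.
    by rewrite !mul0r subrr.
  by rewrite !mulr0 subrr.
have [xa ba] : x - a != 0 /\ b - a != 0 by apply: nz; rewrite c1 oppr_eq0.
have [bx _] : b - x != 0 /\ a - x != 0 by apply: nz; rewrite c3 oppr_eq0.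
have neg t' u v : is_angle t' (- u) (- v) -> is_angle t' u v.
  by rewrite /is_angle /enorm /dot /cross/= !sqrrN !mulrNN.
(* The three angles together carry x - a to its opposite, so the cosine of their sum is -1. *)
have h : is_angle (angle (x - a) (b - a) + angle (a - b) (x - b) + angle (b - x) (a - x))
    (x - a) (a - x).
  apply: (is_angleD bx); last by apply: angleP; rewrite c3 oppr_eq0 cn0.
  apply: (is_angleD ba); first by apply: angleP; rewrite c1 oppr_eq0 cn0.
  by apply: neg; rewrite !opprB; apply: angleP; rewrite c2 oppr_eq0 cn0.
have [+ _] := h; have [+ _] := is_angle0 (x - a); rewrite cos0.
have -> : enorm (a - x) = enorm (x - a) by rewrite -opprB /enorm/= !sqrrN.
have -> : dot (x - a) (a - x) = - dot (x - a) (x - a) by rewrite /dot/=; ring.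
move=> <-; rewrite -mulrN; apply: mulfI.
by rewrite mulf_neq0 ?enorm_eq0.
Qed.

End Angle.

(** * Branches of the angle on a simply connected set *)

Lemma within_continuous_comp (X Y Z : topologicalType) (D : set Y) (f : Y -> Z)
    (g : X -> Y) :
  {within D, continuous f} -> continuous g -> (forall x, D (g x)) ->
  continuous (f \o g).
Proof.
move=> /subspace_continuousP cf cg gD x B /(cf _ (gD x)).
move=> /cg; rewrite /fmap/=/nbhs/=.
by apply: filterS => y /(_ (gD y)).
Qed.

Section Lifting.
Context {R : realType}.

Lemma dot_gt0_near (p : R * R) : p != 0 ->
  \forall u \near p & v \near p, 0 < dot u v.
Proof.
move=> p0; have d0 : 0 < dot p p.
  by rewrite /dot -!expr2 -sqr_enorm exprn_gt0// enorm_gt0.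
have cd : (fun q : (R * R) * (R * R) => dot q.1 q.2) @ (p, p) --> dot p p.
  have c1 : (fun q : (R * R) * (R * R) => q.1) @ (p, p) --> p by exact: cvg_fst.
  have c2 : (fun q : (R * R) * (R * R) => q.2) @ (p, p) --> p by exact: cvg_snd.
  have c11 : (fun q : (R * R) * (R * R) => q.1.1) @ (p, p) --> p.1.
    by apply: cvg_comp c1 _; exact: cvg_fst.
  have c12 : (fun q : (R * R) * (R * R) => q.1.2) @ (p, p) --> p.2.
    by apply: cvg_comp c1 _; exact: cvg_snd.
  have c21 : (fun q : (R * R) * (R * R) => q.2.1) @ (p, p) --> p.1.
    by apply: cvg_comp c2 _; exact: cvg_fst.
  have c22 : (fun q : (R * R) * (R * R) => q.2.2) @ (p, p) --> p.2.
    by apply: cvg_comp c2 _; exact: cvg_snd.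
  by apply: cvgD; apply: cvgM.
exact: (cvgr_gt _ cd _ d0).
Qed.

(** Compactness of the square yields one step d for which successive values along t make an angle
    below a right angle, far from the cut of [angle]. *)
Lemma uniform_dot_gt0 (G : R * R -> R * R) : continuous G -> (forall p, G p != 0) ->
  exists2 d : R, 0 < d & forall s t t', 0 <= s <= 1 -> 0 <= t <= 1 -> `|t - t'| < d ->
    0 < dot (G (s, t)) (G (s, t')).
Proof.
move=> cG G0; have cK : compact (`[0 : R, 1] `*` `[0 : R, 1]).
  by apply: compact_setX; exact: segment_compact.
have /compact_near_coveringP/(_ _ _ (fun (d : R) p => forall t', `|p.2 - t'| < d ->
  0 < dot (G p) (G (p.1, t'))) (at_right_proper_filter 0)) cover := cK.
lapply cover; last first.
  move=> p _; have [[A B]/= [/cG nA /cG nB] AB] := dot_gt0_near (G0 p).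
  have /nbhs_ballP[e /= e0 eAB] : nbhs p (G @^-1` (A `&` B)) by exact: filterI.
  have e20 : 0 < e / 2 by rewrite divr_gt0.
  exists (ball p (e / 2), [set d | 0 < d < e / 2]) => /=.
    split; first exact: nbhsx_ballx.
    by near=> d; apply/andP; split=> //; near: d; exact: nbhs_right_lt.
  move=> [q d] [/= [q1 q2] dlt] t' tq.
  have h1 : ball p e q.
    by split; [move: q1|move: q2]; rewrite /ball/= => ?; lra.
  have h2 : ball p e (q.1, t').
    split; first by move: q1; rewrite /ball/= => ?; lra.
    move: q2; rewrite /ball/= => q2.
    by have := ler_distD q.2 p.2 t'; lra.
  by apply: (AB (G q, G (q.1, t'))); split; [case: (eAB _ h1)|case: (eAB _ h2)].
move=> nD {cover}; have [d [KD d0]] := @filter_ex _ _ (at_right_proper_filter (0 : R)) _ (filterI nD (nbhs_right_gt 0)).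
exists d => // s t t' s01 t01 tt.
by apply: (KD (s, t)) => //; split => /=; rewrite in_itv.
Unshelve. all: by end_near. Qed.

Lemma continuous_clamp_min (c : R) : continuous (fun t : R => Num.min (clamp t) c).
Proof.
by move=> t; apply: continuous_min; [exact: continuous_clamp|exact: cvg_cst].
Qed.

(* The lift is a sum of the small angles described along a fine subdivision. *)
Lemma homotopy_lift (G : R * R -> R * R) : continuous G -> (forall p, G p != 0) ->
  exists th : R -> R -> R, [/\ forall s, continuous (th s),
    continuous (fun s => th s 1),
    forall s, th s 0 = 0,
    forall s t, 0 <= s <= 1 -> is_angle (th s t) (G (s, 0)) (G (s, clamp t)) &
    forall s, 0 <= s <= 1 -> (forall t, G (s, t) = G (s, 0)) -> th s 1 = 0].
Proof.
move=> cG G0; have [d d0 Gd] := uniform_dot_gt0 cG G0.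
have [n nd] : exists n : nat, n.+1%:R^-1 < d.
  by have [n _ /(_ n (leqnn n))] := near_infty_natSinv_lt (PosNum d0); exists n.
(* [tau k t] follows clamp t but stops at k / (n + 1). As k grows it leads from 0 to clamp t by
   steps shorter than d, so the small angles compose, and each depends continuously on t. *)
pose tau k (t : R) := Num.min (clamp t) (k%:R / n.+1%:R).
have tau01 k t : 0 <= tau k t <= 1.
  have /andP[c0 c1] := clamp_itv t.
  by rewrite /tau le_min c0 divr_ge0//= ge_min c1.
have tauS k t : `|tau k t - tau k.+1 t| < d.
  apply: le_lt_trans nd; rewrite /tau -[k.+1%:R]natr1 mulrDl div1r.
  have i0 : 0 <= n.+1%:R^-1 :> R by rewrite invr_ge0.
  set x := k%:R / _; set y := n.+1%:R^-1 in i0 *.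
  by rewrite !minElt ler_norml; apply/andP; split; case: ifP; case: ifP; lra.
have ctau k : continuous (tau k) by exact: continuous_clamp_min.
pose g s k t := G (clamp s, tau k t).
have gd s k t : 0 < dot (g s k t) (g s k.+1 t).
  by apply: Gd => //; exact: clamp_itv.
have cgt s k : continuous (g s k).
  move=> t; apply: (continuous_comp (f := fun t => (clamp s, tau k t))); last exact: cG.
  by apply: (cvg_pair (G := nbhs (clamp s)) (H := nbhs (tau k t))); [exact: cvg_cst|exact: ctau].
have cgs k t : continuous (fun s => g s k t).
  move=> s; apply: (continuous_comp (f := fun s => (clamp s, tau k t))); last exact: cG.
  by apply: (cvg_pair (G := nbhs (clamp s)) (H := nbhs (tau k t))); [exact: continuous_clamp|exact: cvg_cst].
exists (fun s t => \sum_(k < n.+1) angle (g s k t) (g s k.+1 t)); split.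
- move=> s; apply: (continuous_big (op := +%R)) => [|k _]; first exact: add_continuous.
  move=> t.
  by apply: (continuous_angle (cgt _ _ _) (cgt _ _ _)); rewrite gd orbT.
- apply: (continuous_big (op := +%R)) => [|k _]; first exact: add_continuous.
  move=> s.
  by apply: (continuous_angle (cgs _ _ _) (cgs _ _ _)); rewrite gd orbT.
- move=> s; apply: big1 => k _; rewrite /g /tau (clamp_le0 (lexx 0)).
  by rewrite !min_l ?divr_ge0 ?ler0n// angle_refl.
- move=> s t s01; have -> : G (s, 0) = g s 0 t.
    by rewrite /g /tau mul0r (clamp_id s01) min_r//; case/andP: (clamp_itv t).
  have -> : G (s, clamp t) = g s n.+1 t.
    by rewrite /g /tau divff ?pnatr_eq0// (clamp_id s01) min_l//; case/andP: (clamp_itv t).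
  elim: n.+1 => [|m IH]; first by rewrite big_ord0; exact: is_angle0.
  rewrite big_ord_recr/=; apply: is_angleD IH _; first exact: G0.
  by apply: angleP; rewrite gd orbT.
- by move=> s s01 Gs; apply: big1 => k _; rewrite /g (clamp_id s01) !Gs angle_refl.
Qed.

Lemma path_lift (g : R -> R * R) : continuous g -> (forall t, g t != 0) ->
  exists th : R -> R, [/\ continuous th, th 0 = 0 &
    forall t, is_angle (th t) (g 0) (g (clamp t))].
Proof.
move=> cg g0.
have cG : continuous (fun p : R * R => g p.2).
  by move=> p; apply: (continuous_comp (f := snd)); [exact: cvg_snd|exact: cg].
have [th [th1 _ th3 th4 _]] := homotopy_lift cG (fun p => g0 p.2).
by exists (th 0); split=> // t; apply: th4; rewrite lexx ler01.
Qed.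

(** Contract the loop inside Omega, hence away from a: the total angle of the intermediate loops is
    a multiple of 2 pi depending continuously on s, so it keeps the value 0 that it has on the
    constant loop. *)
Lemma loop_lift_closed (Omega : set (R * R)) (a : R * R) (g : R -> R * R) (th : R -> R) :
  simply_connected Omega -> ~ Omega a ->
  continuous g -> (forall t, 0 <= t <= 1 -> Omega (g t)) -> g 1 = g 0 ->
  continuous th -> th 0 = 0 ->
  (forall t, 0 <= t <= 1 -> is_angle (th t) (g 0 - a) (g t - a)) ->
  th 1 = 0.
Proof.
move=> [_ sc] na cg Og g10 cth th0 thP.
have [|H [cH OH H0 H1 Hs]] := sc (g 0) g.
  by split=> //; exact: continuous_subspaceT.
pose c2 (p : R * R) := (clamp p.1, clamp p.2).
have cc2 : continuous c2.
  move=> p; apply: (cvg_pair (G := nbhs (clamp p.1)) (H := nbhs (clamp p.2))).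
    by apply: (continuous_comp (f := fst)); [exact: cvg_fst|exact: continuous_clamp].
  by apply: (continuous_comp (f := snd)); [exact: cvg_snd|exact: continuous_clamp].
have c2in p : (`[0 : R, 1] `*` `[0 : R, 1]) (c2 p).
  by split; rewrite /= in_itv/= clamp_itv.
pose G p := H (c2 p) - a.
have cG : continuous G.
  move=> p; apply: cvgB; last exact: cvg_cst.
  exact: (within_continuous_comp cH cc2 c2in).
have G0 p : G p != 0.
  rewrite subr_eq0; apply/eqP => Ha; apply: na; rewrite -Ha.
  by apply: OH; exact: clamp_itv.
have [D [D1 D2 D3 D4 D5]] := homotopy_lift cG G0.
have z01 : is_true (((0 : R) <= 0) && ((0 : R) <= 1)) by rewrite lexx ler01.
have o01 : is_true (((0 : R) <= 1) && ((1 : R) <= 1)) by rewrite lexx ler01.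
have D00 : D 0 1 = 0.
  have cD : continuous (fun s => D (clamp s) 1).
    by move=> s; apply: (continuous_comp (g := fun s => D s 1)); [exact: continuous_clamp|exact: D2].
  have cosD s : cos (D (clamp s) 1) = 1.
    apply: (is_angle_cos1 (G0 (clamp s, 0))).
    have GE : G (clamp s, clamp 1) = G (clamp s, 0).
      rewrite /G /c2/= (clamp_id z01) !(clamp_id o01) (clamp_id (clamp_itv s)).
      by have [-> ->] := Hs _ (clamp_itv s).
    by have := D4 (clamp s) 1 (clamp_itv s); rewrite GE.
  have := cos1_const cD cosD 0 1; rewrite (clamp_id z01) (clamp_id o01) => ->.
  by apply: D5 => // t; rewrite /G /c2/= (clamp_id z01) (clamp_id o01) !H1// ?clamp_itv.
(* Uniqueness of lifts: the given lift [th] and the constructed one differ by a multiple of 2 pi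
   that cannot vary with t. *)
have cE : continuous (fun t => th (clamp t) - D 0 t).
  move=> t; apply: cvgB; last exact: D1.
  by apply: (continuous_comp (f := clamp)); [exact: continuous_clamp|exact: cth].
have G00 : G (0, 0) = g 0 - a by rewrite /G /c2/= (clamp_id z01) H0.
have cosE t : cos (th (clamp t) - D 0 t) = 1.
  have ga : g 0 - a != 0 by rewrite -G00.
  apply: (is_angle_cos1 ga).
  apply: (is_angleD (v := g (clamp t) - a)).
  - rewrite subr_eq0; apply/eqP => Ha; apply: na; rewrite -Ha.
    by apply: Og; exact: clamp_itv.
  - by apply: thP; exact: clamp_itv.
  - apply: is_angleN; have := D4 0 t z01; rewrite G00 /G /c2/= (clamp_id z01).
    by rewrite (clamp_id (clamp_itv t)) H0 ?clamp_itv.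
have := cos1_const cE cosE 1 0.
by rewrite (clamp_id z01) (clamp_id o01) D00 D3 th0 !subr0.
Qed.

(** The branch at x is the angle described around a by some path in Omega from a base point to x.
    For two points joined by a segment in Omega, the two chosen paths and the segment form a loop,
    whose total angle is zero. *)
Lemma angle_branch (Omega : set (R * R)) (a : R * R) :
  simply_connected Omega -> ~ Omega a ->
  exists Th : R * R -> R, forall x y, segm x y `<=` Omega ->
    Th y - Th x = angle (x - a) (y - a).
Proof.
move=> sc na; have [[x0 Ox0]|O0] := pselect (exists x, Omega x); last first.
  by exists (fun=> 0) => x y xy; exfalso; apply: O0; exists x; apply: xy; exact: segm_left.
pose good (x : R * R) (v : R) := exists (g : R -> R * R) (th : R -> R),
  [/\ continuous g /\ (forall t, Omega (g t)),
  g 0 = x0, g 1 = x, continuous th /\ th 0 = 0 &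
  (forall t, 0 <= t <= 1 -> is_angle (th t) (x0 - a) (g t - a)) /\ th 1 = v].
have goodP x : Omega x -> exists v, good x v.
  move=> Ox; have [g [cg Og g0 g1]] := sc.1 _ _ Ox0 Ox.
  have z01 : is_true (((0 : R) <= 0) && ((0 : R) <= 1)) by rewrite lexx ler01.
  have o01 : is_true (((0 : R) <= 1) && ((1 : R) <= 1)) by rewrite lexx ler01.
  have cg' : continuous (g \o clamp).
    apply: within_continuous_comp cg (@continuous_clamp R) _ => t.
    by rewrite /= in_itv/= clamp_itv.
  have [|t|th [cth th0 thP]] := @path_lift (fun t => g (clamp t) - a).
  - by move=> t; apply: cvgB; [exact: cg'|exact: cvg_cst].
  - by rewrite subr_eq0; apply/eqP => ta; apply: na; rewrite -ta; apply: Og; exact: clamp_itv.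
  exists (th 1), (g \o clamp), th; split=> //=.
  - by split=> // t; apply: Og; exact: clamp_itv.
  - by rewrite clamp_id.
  - by rewrite clamp_id.
  split=> // t t01; have := thP t.
  by rewrite !(clamp_id t01) (clamp_id z01) g0.
exists (fun x => xget 0 [set v | good x v]) => x y xy.
have Ox : Omega x by apply: xy; exact: segm_left.
have Oy : Omega y by apply: xy; exact: segm_right.
have : good x (xget 0 [set v | good x v]) by have [u gu] := goodP x Ox; exact: (xgetPex 0 (ex_intro _ u gu)).
have : good y (xget 0 [set v | good y v]) by have [u gu] := goodP y Oy; exact: (xgetPex 0 (ex_intro _ u gu)).
set v := xget _ _; set u := xget _ _.
move=> [gy [ty [[cgy Ogy] gy0 gy1 [cty ty0] [tyP ty1]]]].
move=> [gx [tx [[cgx Ogx] gx0 gx1 [ctx tx0] [txP tx1]]]].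
have nza z : Omega z -> z - a != 0.
  by move=> Oz; rewrite subr_eq0; apply/eqP => za; apply: na; rewrite -za.
pose sg t := x + t *: (y - x).
have Osg t : 0 <= t <= 1 -> Omega (sg t) by move=> t01; apply: xy; exists t.
have sgcut t : 0 <= t <= 1 -> is_angle (angle (x - a) (sg t - a)) (x - a) (sg t - a).
  move=> t01; apply: angleP; apply: is_angle_cut_segm => xta; apply: na; apply: xy.
  by apply: (segm_convex (segm_left x y) _ xta); exists t.
(* On each third of [0, 1] only one of the three parameters moves, so the loop [L] through gx, the
   segment and gy reversed, and its lift [TL], are plain sums: continuity needs no gluing. *)
pose c1 t : R := clamp (3 * t); pose c2 t : R := clamp (3 * t - 1).
pose c3 t : R := 1 - clamp (3 * t - 2).
have cc1 : continuous c1.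
  move=> t; apply: (continuous_comp (f := fun t : R => 3 * t : R) (g := @clamp R)); last exact: continuous_clamp.
  exact: mulrl_continuous.
have cc2 : continuous c2.
  move=> t; apply: (continuous_comp (f := fun t : R => 3 * t - 1 : R) (g := @clamp R)); last exact: continuous_clamp.
  by apply: cvgB; [exact: mulrl_continuous|exact: cvg_cst].
have cc3 : continuous c3.
  move=> t; apply: cvgB; first exact: cvg_cst.
  apply: (continuous_comp (f := fun t : R => 3 * t - 2 : R) (g := @clamp R)); last exact: continuous_clamp.
  by apply: cvgB; [exact: mulrl_continuous|exact: cvg_cst].
pose L t := gx (c1 t) + (sg (c2 t) - x) + (gy (c3 t) - y).
pose TL t := tx (c1 t) + angle (x - a) (sg (c2 t) - a) + (ty (c3 t) - v).
have csg t : {for t, continuous (fun t => sg (c2 t))}.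
  by apply: cvgD; [exact: cvg_cst|apply: cvgZl; exact: cc2].
have cL : continuous L.
  move=> t; apply: cvgD; first apply: cvgD.
  - by apply: (continuous_comp (g := gx)); [exact: cc1|exact: cgx].
  - by apply: cvgB; [exact: csg|exact: cvg_cst].
  - apply: cvgB; last exact: cvg_cst.
    by apply: (continuous_comp (g := gy)); [exact: cc3|exact: cgy].
have cTL : continuous TL.
  move=> t; apply: cvgD; first apply: cvgD.
  - by apply: (continuous_comp (g := tx)); [exact: cc1|exact: ctx].
  - apply: (@continuous_angle _ _ (fun=> x - a) (fun t => sg (c2 t) - a)).
    + exact: cvg_cst.
    + by apply: cvgB; [exact: csg|exact: cvg_cst].
    + apply: is_angle_cut_segm => xta; apply: na; apply: xy.
      by apply: (segm_convex (segm_left x y) _ xta); exists (c2 t) => //; exact: clamp_itv.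
  - apply: cvgB; last exact: cvg_cst.
    by apply: (continuous_comp (g := ty)); [exact: cc3|exact: cty].
have sg0 : sg 0 = x by rewrite /sg scale0r addr0.
have sg1 : sg 1 = y by rewrite /sg scale1r addrC subrK.
have LT t : 0 <= t <= 1 -> Omega (L t) /\ is_angle (TL t) (x0 - a) (L t - a).
  move=> t01; rewrite /L /TL.
  have [t1|t1] := leP (3 * t) 1.
    rewrite /c1 /c2 /c3 (@clamp_le0 _ (3 * t - 1)) ?(@clamp_le0 _ (3 * t - 2)); [|lra..].
    rewrite subr0 gy1 ty1 sg0 !subrr angle_refl !addr0; split; first exact: Ogx.
    by apply: txP; exact: clamp_itv.
  rewrite /c1 (@clamp_ge1 _ (3 * t)) ?gx1 ?tx1; last by lra.
  have uP : is_angle u (x0 - a) (x - a) by rewrite -tx1 -gx1; apply: txP; rewrite ler01 lexx.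
  have [t2|t2] := leP (3 * t) 2.
    rewrite /c3 (@clamp_le0 _ (3 * t - 2)); last by lra.
    rewrite subr0 gy1 ty1 !subrr !addr0 addrC subrK; split.
      by apply: Osg; exact: clamp_itv.
    by apply: is_angleD uP _; [exact: nza|apply: sgcut; exact: clamp_itv].
  rewrite /c2 (@clamp_ge1 _ (3 * t - 1)); last by lra.
  rewrite sg1 (addrC x) subrK (addrC y) subrK; split; first exact: Ogy.
  have vP : is_angle v (x0 - a) (y - a) by rewrite -ty1 -gy1; apply: tyP; rewrite ler01 lexx.
  apply: (is_angleD (nza _ Oy)).
    by apply: is_angleD uP _; [exact: nza|rewrite -sg1; apply: sgcut; rewrite ler01 lexx].
  rewrite addrC; apply: (is_angleD (nza _ Ox0)); first exact: is_angleN.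
  by apply: tyP; rewrite /c3; have := clamp_itv (3 * t - 2); lra.
have c10 : c1 0 = 0 by rewrite /c1 mulr0 clamp_le0.
have c20 : c2 0 = 0 by rewrite /c2 mulr0 clamp_le0//; lra.
have c30 : c3 0 = 1 by rewrite /c3 mulr0 clamp_le0 ?subr0//; lra.
have c11 : c1 1 = 1 by rewrite /c1 clamp_ge1//; lra.
have c21 : c2 1 = 1 by rewrite /c2 clamp_ge1//; lra.
have c31 : c3 1 = 0 by rewrite /c3 clamp_ge1 ?subrr//; lra.
have L0 : L 0 = x0 by rewrite /L c10 c20 c30 gx0 gy1 sg0 !subrr !addr0.
have L1 : L 1 = x0 by rewrite /L c11 c21 c31 gx1 gy0 sg1 (addrC x) subrK (addrC y) subrK.
(* [TL] ends at u, plus the angle of the segment, minus v; its vanishing is the claim. *)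
have := @loop_lift_closed Omega a L TL sc na cL (fun t h => (LT t h).1).
rewrite L0 L1 => /(_ erefl cTL).
rewrite {1}/TL c10 c20 c30 tx0 ty1 sg0 angle_refl subrr !addr0 => /(_ erefl (fun t h => (LT t h).2)).
by rewrite /TL c11 c21 c31 tx1 ty0 sg1; lra.
Qed.

End Lifting.

(** * Geometry of the triangulation *)

Lemma three_cases (k l m : 'I_3) : k != l -> k != m -> l != m ->
  forall n, [\/ n = k, n = l | n = m].
Proof.
move: k l m => [[|[|[|//]]] ?] [[|[|[|//]]] ?] [[|[|[|//]]] ?] // _ _ _ [[|[|[|//]]] ?];
  by [constructor 1; exact: val_inj | constructor 2; exact: val_inj
     | constructor 3; exact: val_inj].
Qed.

Lemma third_index (k l : 'I_3) : k != l -> exists m : 'I_3, k != m /\ l != m.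
Proof.
have [i0 i1 i2] : [/\ (0 < 3)%N, (1 < 3)%N & (2 < 3)%N] by [].
move: k l => [[|[|[|//]]] ?] [[|[|[|//]]] ?] // _;
  by [exists (Ordinal i0) | exists (Ordinal i1) | exists (Ordinal i2)].
Qed.

Lemma sum_three (V : nmodType) (F : 'I_3 -> V) (k l m : 'I_3) :
  k != l -> k != m -> l != m -> \sum_n F n = F k + F l + F m.
Proof.
move=> kl km lm; rewrite (perm_big [:: k; l; m]).
  by rewrite !big_cons big_nil /= addr0 addrA.
apply: uniq_perm; first exact: index_enum_uniq.
  by rewrite /= !inE negb_or kl km lm.
move=> n; rewrite mem_index_enum !inE.
by have [->|->|->] := three_cases kl km lm n; rewrite eqxx ?orbT.
Qed.

Section Triangles.
Context {R : realType}.
Implicit Types (T : triangle R) (a b c p q x y z : R * R).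

(** Twice the signed area of the triangle a b c. *)
Definition det3 a b c : R := cross (b - a) (c - a).

Definition vertices_of T p q c : Prop := exists k l m : 'I_3,
  [/\ k != l, k != m & l != m] /\ [/\ T k = p, T l = q & T m = c].

Lemma edge_vertices T p q : edge_of T p q -> exists c, vertices_of T p q c.
Proof.
move=> [k [l [kl Tk Tl]]]; have [m [km lm]] := third_index kl.
by exists (T m), k, l, m.
Qed.

Lemma vertices_edge T p q c : vertices_of T p q c -> edge_of T p q.
Proof. by move=> [k [l [m [[kl _ _] [Tk Tl _]]]]]; exists k, l. Qed.

Lemma vertices_swap T p q c : vertices_of T p q c -> vertices_of T q p c.
Proof.
by move=> [k [l [m [[kl km lm] [Tk Tl Tm]]]]]; exists l, k, m; rewrite eq_sym.
Qed.

Lemma vertices_rot T p q c : vertices_of T p q c -> vertices_of T q c p.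
Proof.
move=> [k [l [m [[kl km lm] [Tk Tl Tm]]]]]; exists l, m, k.
by split; split=> //; rewrite eq_sym.
Qed.

Lemma edge_sym T p q : edge_of T p q -> edge_of T q p.
Proof. by move=> /edge_vertices[c] /vertices_swap /vertices_edge. Qed.

Lemma vertices_cases T p q c a : vertices_of T p q c -> vertex_of T a ->
  [\/ a = p, a = q | a = c].
Proof.
move=> [k [l [m [[kl km lm] [<- <- <-]]]]] [n <-].
by have [->|->|->] := three_cases kl km lm n; [constructor 1|constructor 2|constructor 3].
Qed.

Lemma edge_vertex T a b : edge_of T a b -> vertex_of T a /\ vertex_of T b.
Proof. by move=> [k [l [_ <- <-]]]; split; [exists k|exists l]. Qed.

Lemma vertex_edge T a : vertex_of T a -> exists b, edge_of T a b.
Proof.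
move=> [k <-]; have [m /andP[km _]] : exists m : 'I_3, (k != m) && true.
  have [/eqP k0|k0] := boolP (k == ord0); first by exists ord_max; rewrite k0.
  by exists ord0; rewrite k0.
by exists (T m), k, m.
Qed.

Definition bary (s t r : R) p q c : R * R := s *: p + t *: q + r *: c.

Lemma pairP (x y : R * R) : x.1 = y.1 -> x.2 = y.2 -> x = y.
Proof. by case: x y => [? ?] [? ?] /= -> ->. Qed.

Lemma cellP T p q c x : vertices_of T p q c ->
  cell T x <-> exists s t r, [/\ 0 <= s, 0 <= t, 0 <= r, s + t + r = 1 & x = bary s t r p q c].
Proof.
move=> [k [l [m [[kl km lm] [<- <- <-]]]]]; split.
  move=> [w [w0 w1 ->]]; exists (w k), (w l), (w m); split=> //.
    by rewrite -(sum_three w kl km lm).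
  by rewrite (sum_three (fun k => w k *: T k) kl km lm).
move=> [s [t [r [s0 t0 r0 str ->]]]].
exists (fun n => if n == k then s else if n == l then t else r); split.
- by move=> n; case: ifP => // _; case: ifP.
- by rewrite (sum_three _ kl km lm) eqxx (eq_sym l) (negPf kl) eqxx !(eq_sym m)
    (negPf km) (negPf lm).
- by rewrite (sum_three _ kl km lm) eqxx (eq_sym l) (negPf kl) eqxx !(eq_sym m)
    (negPf km) (negPf lm).
Qed.

Lemma nondegenerate_det3 T p q c : Defs.nondegenerate T -> vertices_of T p q c ->
  det3 p q c != 0.
Proof.
move=> nT [k [l [m [[kl km lm] [<- <- <-]]]]]; apply/eqP => d0.
have coef (u v w : R) : u + v + w = 0 -> bary u v w (T k) (T l) (T m) = 0 ->
    [/\ u = 0, v = 0 & w = 0].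
  move=> uvw0 b0; have := nT (fun n => if n == k then u else if n == l then v else w).
  rewrite !(sum_three _ kl km lm) eqxx (eq_sym l) (negPf kl) eqxx !(eq_sym m)
    (negPf km) (negPf lm) => /(_ uvw0 b0) h.
  have := h k; have := h l; have := h m.
  by rewrite eqxx (eq_sym l) (negPf kl) eqxx !(eq_sym m) (negPf km) (negPf lm).
move: d0; rewrite /det3 /cross/= => d0.
(* When the determinant vanishes, the cyclic differences of abscissae are the coefficients of an
   affine relation between the vertices, so they are zero; the same goes for ordinates, and two
   vertices coincide. *)
have [_ _ w1] : [/\ (T l).1 - (T m).1 = 0, (T m).1 - (T k).1 = 0 & (T k).1 - (T l).1 = 0].
  apply: coef; first by ring.
  apply: pairP; rewrite /bary/=/GRing.scale/=; first by ring.
  by rewrite -[RHS]oppr0 -d0; ring.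
have [_ _ w2] : [/\ (T l).2 - (T m).2 = 0, (T m).2 - (T k).2 = 0 & (T k).2 - (T l).2 = 0].
  apply: coef; first by ring.
  apply: pairP; rewrite /bary/=/GRing.scale/=; last by ring.
  by rewrite -d0; ring.
have kl' : T k = T l by apply: pairP; apply/eqP; rewrite -subr_eq0 ?w1 ?w2.
have [] := coef 1 (-1) 0; first by ring.
  by rewrite /bary kl' scale0r addr0 scale1r scaleN1r subrr.
by move=> /eqP; rewrite oner_eq0.
Qed.

Lemma bary_det3 (s t r : R) p q c : s + t + r = 1 -> let x := bary s t r p q c in
  [/\ det3 x q c = s * det3 p q c, det3 p x c = t * det3 p q c &
      det3 p q x = r * det3 p q c].
Proof.
move=> h x; have {h} rE : r = 1 - s - t by lra.
by rewrite /x rE /det3 /cross/=/GRing.scale/=; split; ring.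
Qed.

Lemma bary_of p q c x : det3 p q c != 0 ->
  let D := det3 p q c in
  det3 x q c / D + det3 p x c / D + det3 p q x / D = 1 /\
  x = bary (det3 x q c / D) (det3 p x c / D) (det3 p q x / D) p q c.
Proof.
move=> d0 D; have sE : det3 x q c + det3 p x c + det3 p q x = D.
  by rewrite /D /det3 /cross/=; ring.
split; first by rewrite -!mulrDl sE divff.
apply: pairP; apply: (mulIf d0); rewrite -/D /bary/=/GRing.scale/=.
  transitivity (det3 x q c * p.1 + det3 p x c * q.1 + det3 p q x * c.1); last by field.
  by rewrite /D /det3 /cross/=; ring.
transitivity (det3 x q c * p.2 + det3 p x c * q.2 + det3 p q x * c.2); last by field.
by rewrite /D /det3 /cross/=; ring.
Qed.

Lemma bary_uniq p q c (s t r s' t' r' : R) : det3 p q c != 0 ->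
  s + t + r = 1 -> s' + t' + r' = 1 ->
  bary s t r p q c = bary s' t' r' p q c -> [/\ s = s', t = t' & r = r'].
Proof.
move=> d0 h h' e; have [e1 e2 e3] := bary_det3 p q c h.
have [] := bary_det3 p q c h'; rewrite /= -e e1 e2 e3.
by move=> /(mulIf d0) -> /(mulIf d0) -> /(mulIf d0) ->.
Qed.

(** A point of an edge has coordinate zero at the opposite vertex. With positive coordinates at p
    and q, the opposite vertex can only be c. *)
Lemma edge_through T p q c a b x (s t r : R) :
  Defs.nondegenerate T -> vertices_of T p q c -> edge_of T a b -> segm a b x ->
  x = bary s t r p q c -> 0 < s -> 0 < t -> s + t + r = 1 ->
  r = 0 /\ ((a = p /\ b = q) \/ (a = q /\ b = p)).
Proof.
move=> nT V ab [u u01 ->] xE s0 t0 str.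
have d0 := nondegenerate_det3 nT V.
have [Va Vb] := edge_vertex ab.
have aneb : a != b.
  have [d Vab] := edge_vertices ab; have := nondegenerate_det3 nT Vab.
  by apply: contraNneq => ->; rewrite /det3 subrr /cross !mul0r subrr.
have seg v w : v + u *: (w - v) = (1 - u) *: v + u *: w.
  by rewrite scalerBr scalerBl scale1r addrA addrAC.
have H (s' t' r' : R) : s' + t' + r' = 1 ->
   a + u *: (b - a) = bary s' t' r' p q c -> [/\ s = s', t = t' & r = r'].
  by move=> h' xE'; apply: (bary_uniq d0) => //; rewrite -xE.
rewrite seg /bary in H.
have [ap|aq|ac] := vertices_cases V Va; have [bp|bq|bc] := vertices_cases V Vb;
  move: aneb; rewrite ?ap ?aq ?ac ?bp ?bq ?bc ?eqxx// => _.
- have [] := H (1 - u) u 0; rewrite ?ap ?bq ?scale0r ?addr0 //; first by ring.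
  by move=> _ _ ->; split=> //; left.
- have [] := H (1 - u) 0 u; rewrite ?ap ?bc ?scale0r ?addr0//; first by ring.
  by move=> _ t'; move: t0; rewrite t' ltxx.
- have [] := H u (1 - u) 0; rewrite ?aq ?bp ?scale0r ?addr0//; first by ring.
    by rewrite addrC.
  by move=> _ _ ->; split=> //; right.
- have [] := H 0 (1 - u) u; rewrite ?aq ?bc ?scale0r ?add0r//; first by ring.
  by move=> s'; move: s0; rewrite s' ltxx.
- have [] := H u 0 (1 - u); rewrite ?ac ?bp ?scale0r ?addr0//; first by ring.
    by rewrite addrC.
  by move=> _ t'; move: t0; rewrite t' ltxx.
- have [] := H 0 u (1 - u); rewrite ?ac ?bq ?scale0r ?add0r//; first by ring.
    by rewrite addrC.
  by move=> s'; move: s0; rewrite s' ltxx.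
Qed.

Lemma not_vertex T p q c x (s t r : R) :
  Defs.nondegenerate T -> vertices_of T p q c -> vertex_of T x ->
  x = bary s t r p q c -> 0 < s -> 0 < t -> s + t + r = 1 -> False.
Proof.
move=> nT V Vx xE s0 t0 str; have [b xb] := vertex_edge Vx.
have [r0 [[xp _]|[xq _]]] := edge_through nT V xb (segm_left x b) xE s0 t0 str.
  have [] := bary_uniq (nondegenerate_det3 nT V) str (_ : 1 + 0 + 0 = 1).
  - by rewrite !addr0.
  - by rewrite -xE xp /bary scale1r !scale0r !addr0.
  - by move=> _ t'; move: t0; rewrite t' ltxx.
have [] := bary_uniq (nondegenerate_det3 nT V) str (_ : 0 + 1 + 0 = 1).
- by rewrite addr0 add0r.
- by rewrite -xE xq /bary scale1r !scale0r addr0 add0r.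
- by move=> s'; move: s0; rewrite s' ltxx.
Qed.

Lemma cvg_det3 (X : Type) (F : set_system X) (FF : Filter F) (f g h : X -> R * R) a b c :
  f @ F --> a -> g @ F --> b -> h @ F --> c ->
  (fun u : X => det3 (f u) (g u) (h u)) @ F --> det3 a b c.
Proof.
move=> fa gb hc.
have fst_ (k : X -> R * R) (d : R * R) : k @ F --> d -> (fun u : X => (k u).1) @ F --> d.1.
  by move=> kd; apply: cvg_comp kd _; exact: cvg_fst.
have snd_ (k : X -> R * R) (d : R * R) : k @ F --> d -> (fun u : X => (k u).2) @ F --> d.2.
  by move=> kd; apply: cvg_comp kd _; exact: cvg_snd.
apply: cvgB; apply: cvgM; apply: cvgB; by [exact: fst_|exact: snd_].
Qed.

Lemma cell_triple T : exists p q c, vertices_of T p q c.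
Proof.
have [|c V] := @edge_vertices T (T ord0) (T ord_max); first by exists ord0, ord_max.
by exists (T ord0), (T ord_max), c.
Qed.

Lemma cell_closed T x : Defs.nondegenerate T -> ~ cell T x -> \forall y \near x, ~ cell T y.
Proof.
move=> nT nx; have [p [q [c V]]] := cell_triple T.
have d0 := nondegenerate_det3 nT V.
have cv (g : R * R -> R) : {for x, continuous g} -> g x < 0 ->
    (forall y, cell T y -> 0 <= g y) -> \forall y \near x, ~ cell T y.
  move=> cg gx gT; have H : \forall y \near x, g y < 0 := cvgr_lt _ cg _ gx.
  by near=> y => /gT; apply/negP; rewrite -ltNge; near: y; exact: H.
have nn y : cell T y -> [/\ 0 <= det3 y q c / det3 p q c,
    0 <= det3 p y c / det3 p q c & 0 <= det3 p q y / det3 p q c].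
  move=> /(cellP _ V)[s [t [r [s0 t0 r0 str ->]]]].
  by have [-> -> ->] := bary_det3 p q c str; rewrite !mulfK.
have [str xE] := bary_of x d0.
have cid : (fun y : R * R => y) @ x --> x by exact: cvg_id.
have [s0|s0] := ltP (det3 x q c / det3 p q c) 0.
  apply: (cv (fun y => det3 y q c / det3 p q c) _ s0) => [|y /nn[]//].
  by apply: cvgM; [apply: cvg_det3 => //; exact: cvg_cst|exact: cvg_cst].
have [t0|t0] := ltP (det3 p x c / det3 p q c) 0.
  apply: (cv (fun y => det3 p y c / det3 p q c) _ t0) => [|y /nn[]//].
  by apply: cvgM; [apply: cvg_det3 => //; exact: cvg_cst|exact: cvg_cst].
have [r0|r0] := ltP (det3 p q x / det3 p q c) 0.
  apply: (cv (fun y => det3 p q y / det3 p q c) _ r0) => [|y /nn[]//].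
  by apply: cvgM; [apply: cvg_det3 => //; exact: cvg_cst|exact: cvg_cst].
exfalso; apply: nx; apply/(cellP _ V).
by exists (det3 x q c / det3 p q c), (det3 p x c / det3 p q c), (det3 p q x / det3 p q c).
Unshelve. all: by end_near. Qed.

Lemma interior_cell T p q c (s t r : R) : Defs.nondegenerate T -> vertices_of T p q c ->
  0 < s -> 0 < t -> 0 < r -> s + t + r = 1 -> interior (cell T) (bary s t r p q c).
Proof.
move=> nT V s0 t0 r0 str; set x := bary _ _ _ _ _ _.
have d0 := nondegenerate_det3 nT V.
have [sE tE rE] := bary_det3 p q c str.
have cid : (fun y : R * R => y) @ x --> x by exact: cvg_id.
have c1 : (fun y => det3 y q c / det3 p q c) @ x --> det3 x q c / det3 p q c.
  by apply: cvgM; [apply: cvg_det3 => //; exact: cvg_cst|exact: cvg_cst].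
have c2 : (fun y => det3 p y c / det3 p q c) @ x --> det3 p x c / det3 p q c.
  by apply: cvgM; [apply: cvg_det3 => //; exact: cvg_cst|exact: cvg_cst].
have c3 : (fun y => det3 p q y / det3 p q c) @ x --> det3 p q x / det3 p q c.
  by apply: cvgM; [apply: cvg_det3 => //; exact: cvg_cst|exact: cvg_cst].
rewrite sE tE rE !mulfK// in c1 c2 c3.
have n1 : \forall y \near x, 0 < det3 y q c / det3 p q c := cvgr_gt _ c1 _ s0.
have n2 : \forall y \near x, 0 < det3 p y c / det3 p q c := cvgr_gt _ c2 _ t0.
have n3 : \forall y \near x, 0 < det3 p q y / det3 p q c := cvgr_gt _ c3 _ r0.
near=> y; apply/(cellP _ V).
have [y1 y2 y3] : [/\ 0 < det3 y q c / det3 p q c, 0 < det3 p y c / det3 p q c &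
  0 < det3 p q y / det3 p q c].
  by split; near: y; [exact: n1|exact: n2|exact: n3].
have [sum yE] := bary_of y d0.
exists (det3 y q c / det3 p q c), (det3 p y c / det3 p q c), (det3 p q y / det3 p q c).
split=> //; exact: ltW.
Unshelve. all: by end_near. Qed.

Lemma segm_det3 a b x : segm a b x -> det3 a b x = 0.
Proof. by move=> [t _ ->]; rewrite /det3 /cross/=/GRing.scale/=; ring. Qed.

Lemma segm_edge T a b : edge_of T a b -> segm a b `<=` cell T.
Proof.
move=> /edge_vertices[c V] _ [t /andP[t0 t1] ->]; apply/(cellP _ V).
exists (1 - t), t, 0; split=> //; first by rewrite subr_ge0.
  by ring.
by apply: pairP; rewrite /bary/=/GRing.scale/=; ring.
Qed.

Lemma det3_edge_neq T p q c : Defs.nondegenerate T -> vertices_of T p q c -> p != q.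
Proof.
move=> nT V; apply: contraNneq (nondegenerate_det3 nT V) => ->.
by rewrite /det3 subrr /cross !mul0r subrr.
Qed.

End Triangles.

Lemma exists_max (R : realType) (I : finType) (P : I -> Prop) (F : I -> R) :
  (exists i, P i) -> exists2 i, P i & forall j, P j -> F j <= F i.
Proof.
move=> [i0 Pi0]; have Pi0' : (fun i => `[< P i >]) i0 by exact/asboolP.
case: (@arg_maxP _ _ _ _ (fun i => `[< P i >]) F Pi0') => i /asboolP Pi Fi; exists i => // j Pj.
by apply: Fi; exact/asboolP.
Qed.

Section Mesh.
Context {R : realType} (Omega : set (R * R)) (N : nat) (Th : 'I_N -> triangle R).
Hypothesis Omega_polygonal : polygonal_domain Omega.
Hypothesis Th_triangulation : triangulation Omega Th.
Implicit Types (a b c d p q x y z : R * R) (i j : 'I_N).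

Let nd i : Defs.nondegenerate (Th i).
Proof. by have [] := Th_triangulation. Qed.

Let Omega_open : open Omega.
Proof. by have [[]] := Omega_polygonal. Qed.

Lemma interior_closure_domain : interior (closure Omega) = Omega.
Proof. by have [_ []] := Omega_polygonal. Qed.

Lemma cell_closure i : cell (Th i) `<=` closure Omega.
Proof. by have [_ -> _] := Th_triangulation; move=> x xi; exists i. Qed.

Lemma domain_cell x : Omega x -> exists i, cell (Th i) x.
Proof.
have [_ E _] := Th_triangulation.
by move=> /subset_closure; rewrite E => -[i _ xi]; exists i.
Qed.

(** Cells only lie in the closure of Omega; the condition excluding slits brings their interiors
    into Omega itself. *)
Lemma interior_cell_domain i : interior (cell (Th i)) `<=` Omega.
Proof. by rewrite -interior_closure_domain; apply: interiorS; exact: cell_closure. Qed.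

Lemma frontier_domain x : closure Omega x -> ~ frontier Omega x -> Omega x.
Proof.
move=> cx nf; apply: contrapT => nO; apply: nf; split=> //.
by move: Omega_open; rewrite openE => _ /interior_subset.
Qed.

Lemma frontierN x : frontier Omega x -> ~ Omega x.
Proof. by move=> [_ nx] Ox; apply: nx; move: Ox; exact: Omega_open. Qed.

Lemma cells_meet i j x : i != j -> cell (Th i) x -> cell (Th j) x ->
  (vertex_of (Th i) x /\ forall y, cell (Th i) y -> cell (Th j) y -> y = x) \/
  exists a b, [/\ edge_of (Th i) a b, edge_of (Th j) a b, segm a b x &
    forall y, cell (Th i) y -> cell (Th j) y -> segm a b y].
Proof.
move=> ij xi xj; have [_ _ /(_ i j ij)[E|[a [ai aj E]]|[a [b [abi abj E]]]]] := Th_triangulation.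
- by have : set0 x by rewrite -E.
- have xa : x = a by have : [set a] x by rewrite -E.
  by left; rewrite xa; split=> // y yi yj; have : [set a] y by rewrite -E.
- right; exists a, b; split=> //; first by rewrite -E.
  by move=> y yi yj; rewrite -E.
Qed.

(** If c and d were on the same side, a point z of the first cell close to the middle of [p, q]
    would lie in both cells. Their intersection contains p and q, so it is a segment, and z would be
    collinear with p and q. *)
Lemma opposite_sides i j p q c d : i != j ->
  vertices_of (Th i) p q c -> vertices_of (Th j) p q d ->
  det3 p q c * det3 p q d < 0.
Proof.
move=> ij Vi Vj; rewrite ltNge; apply/negP => cd.
have c0 := nondegenerate_det3 (@nd i) Vi; have d0 := nondegenerate_det3 (@nd j) Vj.
have {}cd : 0 < det3 p q c / det3 p q d.
  have -> : det3 p q c / det3 p q d = det3 p q c * det3 p q d / det3 p q d ^+ 2 by field.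
  by rewrite divr_gt0// lt0r ?cd ?mulf_neq0 ?sqr_ge0 ?sqrf_eq0 ?d0.
have [sum cE] := bary_of c d0.
set l := det3 c q d / _ in sum cE; set m := det3 p c d / _ in sum cE.
set r := det3 p q c / _ in sum cE cd.
(* Chosen so that (1 - e) / 2 = e (|l| + |m|): this keeps the coordinates of z at p and q
   nonnegative when c is expressed through p, q and d. *)
pose e := (1 + 2 * `|l| + 2 * `|m|)^-1.
have den : 0 < 1 + 2 * `|l| + 2 * `|m| by have := normr_ge0 l; have := normr_ge0 m; lra.
have e0 : 0 < e by rewrite /e invr_gt0.
have eE : e * (1 + 2 * `|l| + 2 * `|m|) = 1 by rewrite /e mulVf// gt_eqF.
have el : 0 <= e * `|l| by rewrite mulr_ge0// ltW.
have em : 0 <= e * `|m| by rewrite mulr_ge0// ltW.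
have el' : - (e * `|l|) <= e * l by rewrite -mulrN ler_pM2l// lerNl -normrN ler_norm.
have em' : - (e * `|m|) <= e * m by rewrite -mulrN ler_pM2l// lerNl -normrN ler_norm.
rewrite !mulrDr mulr1 !(mulrCA e) in eE.
pose z := bary ((1 - e) / 2) ((1 - e) / 2) e p q c.
have zi : cell (Th i) z.
  by apply/(cellP _ Vi); exists ((1 - e) / 2), ((1 - e) / 2), e; split=> //; lra.
have zj : cell (Th j) z.
  apply/(cellP _ Vj); exists ((1 - e) / 2 + e * l), ((1 - e) / 2 + e * m), (e * r).
  split; [lra|lra|by rewrite mulr_ge0 ?ltW| |].
    by rewrite -[RHS](_ : (1 - e) + e * (l + m + r) = 1); [field|rewrite sum; ring].
  by rewrite /z {1}cE; apply: pairP; rewrite /bary/=/GRing.scale/=; ring.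
have [pi pj] : cell (Th i) p /\ cell (Th j) p.
  by split; apply: (@segm_edge _ _ p q); [exact: vertices_edge Vi|exact: segm_left|
    exact: vertices_edge Vj|exact: segm_left].
have [qi qj] : cell (Th i) q /\ cell (Th j) q.
  by split; apply: (@segm_edge _ _ p q); [exact: vertices_edge Vi|exact: segm_right|
    exact: vertices_edge Vj|exact: segm_right].
have pq := det3_edge_neq (@nd i) Vi.
have [[_ h]|[a [b [_ _ _ h]]]] := cells_meet ij pi pj.
  by move: pq; rewrite (h _ qi qj) eqxx.
have : det3 p q z = 0.
  have [[t1 _ ->] [t2 _ ->] [t3 _ ->]] := And3 (h _ pi pj) (h _ qi qj) (h _ zi zj).
  by rewrite /det3 /cross/=/GRing.scale/=; ring.
have h1 : (1 - e) / 2 + (1 - e) / 2 + e = 1 by field.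
have [_ _ ->] := bary_det3 p q c h1.
by apply/eqP; rewrite mulf_neq0// gt_eqF.
Qed.

Lemma shared_edge i j p q c x (s t r : R) : i != j -> vertices_of (Th i) p q c ->
  cell (Th j) x -> x = bary s t r p q c -> 0 < s -> 0 < t -> 0 <= r -> s + t + r = 1 ->
  edge_of (Th j) p q /\ r = 0.
Proof.
move=> ij V xj xE s0 t0 r0 str.
have xi : cell (Th i) x.
  by apply/(cellP _ V); exists s, t, r; split=> //; exact: ltW.
have [[vx _]|[a [b [abi abj abx _]]]] := cells_meet ij xi xj.
  by case: (not_vertex (@nd i) V vx xE s0 t0 str).
have [-> [[<- <-]//|[<- <-]]] := edge_through (@nd i) V abi abx xE s0 t0 str.
by split=> //; exact: edge_sym.
Qed.

Lemma interior_disjoint i j x : i != j ->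
  interior (cell (Th i)) x -> interior (cell (Th j)) x -> False.
Proof.
move=> ij xi xj; have xij : \forall y \near x, cell (Th i) y /\ cell (Th j) y.
  by apply: filterI.
have [a [b ab]] : exists a b, forall y, cell (Th i) y -> cell (Th j) y -> segm a b y.
  have [[_ h]|[a [b [_ _ _ h]]]] := cells_meet ij (nbhs_singleton xi) (nbhs_singleton xj).
    by exists x, x => y yi yj; rewrite (h y yi yj); exact: segm_left.
  by exists a, b.
have /nbhs_ballP[e /= e0 xe] := xij.
have e2 : 0 < e / 2 by rewrite divr_gt0.
have near (v : R * R) : `|v.1| < e -> `|v.2| < e -> segm a b (x + v).
  move=> v1 v2; have [] := xe (x + v); last by move=> *; exact: ab.
  by split; rewrite /ball/= opprD addNKr normrN.
have ne2 : `|e / 2| < e by rewrite gtr0_norm//; lra.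
have n0 : `|0 : R| < e by rewrite normr0.
(* The intersection of the cells lies in a segment, which cannot contain three points in the
   directions of both axes unless it is reduced to a point, and then not even two. *)
have h0 := near 0 n0 n0; have h1 := near (e / 2, 0) ne2 n0; have h2 := near (0, e / 2) n0 ne2.
have [E0 E1 E2] := And3 (segm_det3 h0) (segm_det3 h1) (segm_det3 h2).
move: E0 E1 E2; rewrite /det3 /cross/= !addr0 => E0 E1 E2.
have b2 : (b.2 - a.2) * (e / 2) = 0 by lra.
have b1 : (b.1 - a.1) * (e / 2) = 0 by lra.
have {}b1 : b.1 = a.1 by apply/eqP; rewrite -subr_eq0 -(mulIr_eq0 _ (mulIf (lt0r_neq0 e2))) b1.
have {}b2 : b.2 = a.2 by apply/eqP; rewrite -subr_eq0 -(mulIr_eq0 _ (mulIf (lt0r_neq0 e2))) b2.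
have ba : b = a by exact: pairP.
move: h0 h1; rewrite ba => -[t0 _] + [t1 _]; rewrite subrr !scaler0 !addr0 => -> /(congr1 fst)/=.
by move: e2; lra.
Qed.

(** If no other cell reached a point z of the open edge lying in Omega, then near z the single cell
    i would cover Omega, although it lies on one side of the edge only. *)
Lemma edge_neighbour i p q : edge_of (Th i) p q -> ~ (segm p q `<=` frontier Omega) ->
  exists j t, [/\ j != i, edge_of (Th j) p q, 0 < t < 1 & Omega (p + t *: (q - p))].
Proof.
move=> pq /existsNP[z0 /not_implyP[z0s nf]].
have Oz0 : Omega z0 by apply: frontier_domain nf; apply: cell_closure; exact: segm_edge pq _ z0s.
have [c V] := edge_vertices pq.
have [t [t01 Ot]] : exists t, 0 < t < 1 /\ Omega (p + t *: (q - p)).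
  have [t0 t001 z0E] := z0s.
  (* The given point may be an end of the edge; it is pushed towards the midpoint by so little that
     it stays in Omega. *)
  pose f (s : R) := p + (t0 + s * (2^-1 - t0)) *: (q - p).
  have cf : f @ (0 : R) --> f 0.
    apply: cvgD; first exact: cvg_cst.
    apply: cvgZl; apply: cvgD; first exact: cvg_cst.
    by apply: cvgMl; exact: cvg_id.
  have f0 : f 0 = z0 by rewrite /f mul0r addr0 z0E.
  have nO : \forall s \near (0:R), Omega (f s) by apply: cf; rewrite f0; exact: Omega_open.
  have /nbhs_ballP[e /= e0 eO] := nO.
  pose s := Num.min (e / 2) 2^-1.
  have s0 : 0 < s by rewrite lt_min divr_gt0//= invr_gt0.
  have s1 : s <= 2^-1 by rewrite ge_min lexx orbT.
  have se : s < e by rewrite (le_lt_trans (_ : _ <= e / 2)) ?ge_min ?lexx//; lra.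
  exists (t0 + s * (2^-1 - t0)); split.
    by apply/andP; split; nra.
  by apply: eO; rewrite /ball/= sub0r normrN gtr0_norm.
set z := p + t *: (q - p) in Ot.
have /andP[t0 t1] := t01.
have zE : z = bary (1 - t) t 0 p q c.
  by apply: pairP; rewrite /z /bary/=/GRing.scale/=; ring.
have [[j [ji zj]]|noj] := pselect (exists j, j != i /\ cell (Th j) z).
  have ij : i != j by rewrite eq_sym.
  have [pqj _] := shared_edge ij V zj zE ltac:(lra) t0 (lexx 0) ltac:(lra).
  by exists j, t; split.
exfalso; have near_z : \forall y \near z, Omega y /\ forall j, j != i -> ~ cell (Th j) y.
  have nO : \forall y \near z, Omega y by exact: Omega_open.
  have nj : \forall y \near z, forall j, j != i -> ~ cell (Th j) y.
    have nj' j : \forall y \near z, j != i -> ~ cell (Th j) y.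
      have [->|ji] := eqVneq j i; first by near=> y => /eqP.
      have njz : ~ cell (Th j) z by move=> zj; apply: noj; exists j.
      by near=> y => _; near: y; exact: cell_closed.
    exact: (@filter_forall _ _ _ _ (nbhs_filter z) nj').
  by near=> y; split; near: y.
(* [g] moves from z away from c: beyond the edge the coordinate at c is negative, so the point is in
   no cell. *)
pose g (s : R) := z - s *: (c - z).
have cg : g @ (0 : R) --> z.
  rewrite -[X in _ --> X](_ : g 0 = z); last by rewrite /g scale0r subr0.
  by apply: cvgB; [exact: cvg_cst|apply: cvgZl; exact: cvg_id].
have /nbhs_ballP[e /= e0 eg] := cg _ near_z.
have [Og ng] : Omega (g (e / 2)) /\ forall j, j != i -> ~ cell (Th j) (g (e / 2)).
  by apply: eg; rewrite /ball/= sub0r normrN gtr0_norm; lra.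
have [k gk] := domain_cell Og.
have [ki|] := eqVneq k i; last by move=> /ng; apply.
move: gk; rewrite ki => /(cellP _ V)[s1 [s2 [s3 [_ _ s30 str gE]]]].
have [_ _ dE] := bary_det3 p q c str; have d0 := nondegenerate_det3 (@nd i) V.
have : det3 p q (g (e / 2)) = - (e / 2) * det3 p q c.
  by rewrite /g zE /det3 /bary /cross/=/GRing.scale/=; ring.
by rewrite gE dE => /(mulIf d0); lra.
Unshelve. all: by end_near. Qed.

Definition centroid p q c : R * R := bary 3^-1 3^-1 3^-1 p q c.

(** Along the segment from the centroid to a point of a side, only the end lies on the boundary of
    the cell. Potentials of neighbouring cells will be compared along two such segments with a
    common end. *)
Lemma spoke i p q c x (t : R) : vertices_of (Th i) p q c -> 0 < t < 1 ->
  segm (centroid p q c) (p + t *: (q - p)) x -> exists s t' r : R,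
  [/\ 0 < s, 0 < t', 0 <= r, s + t' + r = 1 & x = bary s t' r p q c] /\
  (r = 0 -> x = p + t *: (q - p)).
Proof.
move=> V /andP[t0 t1] [u /andP[u0 u1] ->].
have ut : 0 <= u * t by apply: mulr_ge0; lra.
have ut' : 0 <= u * (1 - t) by apply: mulr_ge0; lra.
have [u_eq1|u_neq1] := eqVneq u 1.
  exists (1 - t), t, 0; split; last by rewrite u_eq1 scale1r addrC subrK.
  split=> //; [lra|lra|].
  by apply: pairP; rewrite u_eq1 /centroid /bary/=/GRing.scale/=; ring.
have {}u1 : u < 1 by rewrite lt_neqAle u_neq1.
exists ((1 - u) / 3 + u * (1 - t)), ((1 - u) / 3 + u * t), ((1 - u) / 3); split.
  split; [lra|lra|lra|lra|].
  by apply: pairP; rewrite /centroid /bary/=/GRing.scale/=; field.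
by move=> r0; exfalso; lra.
Qed.

Lemma spoke_domain i p q c (t : R) : vertices_of (Th i) p q c -> 0 < t < 1 ->
  Omega (p + t *: (q - p)) -> segm (centroid p q c) (p + t *: (q - p)) `<=` Omega.
Proof.
move=> V t01 Oz x xs; have [s [t' [r [[s0 t'0 r0 str xE] rz]]]] := spoke V t01 xs.
move: r0; rewrite le_eqVlt => /orP[/eqP r0|r0]; first by rewrite rz.
by apply: (@interior_cell_domain i); rewrite xE; exact: interior_cell.
Qed.

Lemma spoke_edge i j p q c a b (t : R) : vertices_of (Th i) p q c -> 0 < t < 1 ->
  edge_of (Th j) a b -> ~ ((a = p /\ b = q) \/ (a = q /\ b = p)) ->
  segm (centroid p q c) (p + t *: (q - p)) `&` segm a b = set0.
Proof.
move=> V t01 ab nab; apply/disjoints_subset => x xs xab.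
have [s [t' [r [[s0 t'0 r0 str xE] rz]]]] := spoke V t01 xs.
have [ij|ij] := eqVneq i j.
  have := edge_through (@nd i) V; rewrite ij => /(_ _ _ _ _ _ _ ab xab xE s0 t'0 str)[_].
  exact: nab.
have xj := segm_edge ab xab.
have [pqj rE] := shared_edge ij V xj xE s0 t'0 r0 str.
have [d Vj] := edge_vertices pqj.
have xE' : x = bary s t' 0 p q d by rewrite xE rE /bary !scale0r.
rewrite rE in str.
by have [_] := edge_through (@nd j) Vj ab xab xE' s0 t'0 str; exact: nab.
Qed.

(* The lexicographically largest vertex of the cells in S is extreme; among the
   edges of these cells issuing from it, take the one of largest slope. *)
Lemma exposed_edge (S : 'I_N -> Prop) : (exists i, S i) ->
  exists i a b, [/\ S i, edge_of (Th i) a b &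
    forall j, S j -> edge_of (Th j) a b -> j = i].
Proof.
move=> [i0 Si0].
have [a [[ia [Sia Va]] aM]] : exists a, (exists i, S i /\ vertex_of (Th i) a) /\
    forall j b, S j -> vertex_of (Th j) b -> b.1 < a.1 \/ (b.1 = a.1 /\ b.2 <= a.2).
  have [|[i k]/= Si M1] := @exists_max R ('I_N * 'I_3)%type (fun ik => S ik.1)
    (fun ik => (Th ik.1 ik.2).1); first by exists (i0, ord0).
  have [|[i' k']/= [Si' E'] M2] := @exists_max R ('I_N * 'I_3)%type
    (fun ik => S ik.1 /\ (Th ik.1 ik.2).1 = (Th i k).1) (fun ik => (Th ik.1 ik.2).2).
    by exists (i, k).
  exists (Th i' k'); split; first by exists i'; split=> //; exists k'.
  move=> j _ Sj [l <-]; rewrite E'.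
  have := M1 (j, l) Sj; rewrite /= le_eqVlt => /orP[/eqP jl|]; last by left.
  by right; split=> //; apply: (M2 (j, l)).
pose half (v : R * R) := v.1 < 0 \/ (v.1 = 0 /\ v.2 < 0).
(* A substitute for the polar angle: as v.1 <= 0, this is the ordinate of v scaled to the unit
   sphere of the l1 norm. It decreases strictly when v turns counterclockwise through [half] and
   stays finite on vertical edges. *)
pose key (v : R * R) := v.2 / (`|v.2| - v.1).
have keyP u v : half u -> half v -> 0 < cross u v -> key v < key u.
  move=> hu hv; rewrite /cross /key => uv.
  have den w : half w -> 0 < `|w.2| - w.1.
    by move=> [w1|[-> w2]]; [have := normr_ge0 w.2; lra|rewrite subr0 normr_gt0 lt_eqF].
  rewrite ltr_pdivrMr ?den// mulrAC ltr_pdivlMr ?den//.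
  have half1 w : half w -> w.1 <= 0 by move=> [/ltW//|[->]].
  have := half1 _ hu; have := half1 _ hv => v1 u1.
  rewrite !mulrBr; case: (lerP 0 u.2) => u2; case: (lerP 0 v.2) => v2.
  - by rewrite !ger0_norm//; lra.
  - by rewrite (ger0_norm u2) (ltr0_norm v2); have := mulr_ge0 u2 (ltW (_ : 0 < - v.2)); nra.
  - nra.
  - by rewrite !ltr0_norm//; lra.
have halfV j b : S j -> edge_of (Th j) a b -> half (b - a).
  move=> Sj ab; have [_ Vb] := edge_vertex ab.
  have [c V] := edge_vertices ab; have ne := det3_edge_neq (@nd j) V.
  have [h|[b1 b2]] := aM _ _ Sj Vb; [by left; rewrite subr_lt0|right].
  rewrite /= b1 subrr subr_lt0 lt_neqAle b2 andbT; split=> //.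
  by apply: contraNneq ne => ba; apply/eqP/pairP.
have [b0 ab0] := vertex_edge Va.
have [|[i k]/= [Si abi] kM] := @exists_max R ('I_N * 'I_3)%type
    (fun ik => S ik.1 /\ edge_of (Th ik.1) a (Th ik.1 ik.2))
    (fun ik => - key (Th ik.1 ik.2 - a)).
  by have [_ [k kb0]] := edge_vertex ab0; exists (ia, k); rewrite /= kb0.
exists i, a, (Th i k); split=> // j Sj abj.
apply/eqP; apply/negPn/negP => ji.
have [c Vi] := edge_vertices abi; have [d Vj] := edge_vertices abj.
(* By extremality no cell of S lies on the counterclockwise side of the edge, so two of them would
   lie on the same side. *)
have kM' j' c' : S j' -> vertices_of (Th j') a (Th i k) c' -> det3 a (Th i k) c' <= 0.
  move=> Sj' V'; rewrite leNgt; apply/negP => pos.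
  have ac : edge_of (Th j') a c' by apply: vertices_edge; apply: vertices_rot (vertices_swap V').
  have := keyP _ _ (halfV _ _ Si abi) (halfV _ _ Sj' ac) pos.
  have [_ [l lc]] := edge_vertex ac.
  have := kM (j', l); rewrite /= lc => /(_ (conj Sj' ac)).
  by rewrite lerN2 leNgt => /negP.
have := opposite_sides ji Vj Vi; apply/negP; rewrite -leNgt.
by apply: mulr_le0; [exact: kM' Vj|exact: kM' Vi].
Qed.

End Mesh.

(** * Exactness of the relative cochain complex *)

(** A row lies in the row space of a matrix exactly when the cokernel kills it; the hypothesis is
    applied to the columns of [cokermx]. *)
Lemma fredholm (F : fieldType) (I J : finType) (D : I -> J -> F) (om : J -> F) :
  (forall eta : J -> F, (forall i, \sum_j D i j * eta j = 0) -> \sum_j om j * eta j = 0) ->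
  exists W : I -> F, forall j, om j = \sum_i W i * D i j.
Proof.
move=> H; pose A := \matrix_(i < #|I|, j < #|J|) D (enum_val i) (enum_val j).
pose o := \row_(j < #|J|) om (enum_val j).
have /submxP[W WE] : (o <= A)%MS.
  rewrite submxE; apply/eqP/rowP => k; rewrite !mxE.
  have reJ (G : 'I_#|J| -> F) : \sum_j G j = \sum_(j : J) G (enum_rank j).
    by rewrite (reindex_onto (@enum_rank J) enum_val) => [|j _]; rewrite ?enum_valK//;
      apply: eq_bigl => j; rewrite enum_rankK eqxx.
  rewrite reJ; under eq_bigr do rewrite mxE enum_rankK.
  apply: (H (fun j => cokermx A (enum_rank j) k)) => i.
  have := mulmx_coker A => /matrixP/(_ (enum_rank i) k); rewrite !mxE reJ => E; rewrite -[RHS]E.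
  by apply: eq_bigr => j _; rewrite [A _ _]mxE !enum_rankK.
exists (fun i => W 0 (enum_rank i)) => j.
have := congr1 (fun M : 'rV_ _ => M 0 (enum_rank j)) WE; rewrite !mxE enum_rankK => ->.
rewrite (reindex_onto (@enum_rank I) enum_val) => [|i _]; last by rewrite enum_valK.
rewrite (eq_bigl xpredT) => [|i]; last by rewrite enum_rankK eqxx.
by apply: eq_bigr => i _; rewrite [A _ _]mxE !enum_rankK.
Qed.

Section Cochains.
Context {R : realType} (Omega : set (R * R)) (N : nat) (Th : 'I_N -> triangle R).
Hypothesis Omega_polygonal : polygonal_domain Omega.
Hypothesis Omega_sc : simply_connected Omega.
Hypothesis Th_triangulation : triangulation Omega Th.
Implicit Types (a b c d p q x y z : R * R) (i j : 'I_N).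

Let nd i : Defs.nondegenerate (Th i).
Proof. by have [] := Th_triangulation. Qed.

(** For an edge a b of T the ends contribute 0, so the sum is the sign of the opposite vertex,
    obtained without naming that vertex. *)
Definition side (T : triangle R) a b : R := \sum_k Num.sg (det3 a b (T k)).

Lemma side_vertices (T : triangle R) p q c : vertices_of T p q c ->
  side T p q = Num.sg (det3 p q c).
Proof.
move=> [k [l [m [[kl km lm] [<- <- <-]]]]]; rewrite /side (sum_three _ kl km lm).
have -> : det3 (T k) (T l) (T k) = 0 by rewrite /det3 /cross/=; ring.
have -> : det3 (T k) (T l) (T l) = 0 by rewrite /det3 /cross/=; ring.
by rewrite sgr0 !add0r.
Qed.

Lemma side_refl (T : triangle R) a : side T a a = 0.
Proof.
apply: big1 => k _; have -> : det3 a a (T k) = 0; last exact: sgr0.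
by rewrite /det3 /cross/=; ring.
Qed.

Lemma side_opposite i j p q : i != j -> edge_of (Th i) p q -> edge_of (Th j) p q ->
  side (Th j) p q = - side (Th i) p q /\ side (Th i) p q ^+ 2 = 1.
Proof.
move=> ij /edge_vertices[c Vi] /edge_vertices[d Vj].
rewrite (side_vertices Vi) (side_vertices Vj).
have := opposite_sides Th_triangulation ij Vi Vj.
have := nondegenerate_det3 (@nd i) Vi.
rewrite sqr_sg => ->; case: (ltrgt0P (det3 p q c)) => [c0|c0|->]; last by rewrite mul0r ltxx.
  by rewrite pmulr_rlt0// => d0; rewrite (gtr0_sg c0) (ltr0_sg d0).
by rewrite nmulr_rlt0// => d0; rewrite (ltr0_sg c0) (gtr0_sg d0) opprK.
Qed.

(** Through the subtype [V] of its members, a vertex common to several cells becomes a single index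
    for sums and matrices. *)
Definition mesh_points : seq (R * R) := [seq Th ik.1 ik.2 | ik <- enum {: 'I_N * 'I_3}].

Local Notation V := (seq_sub mesh_points).

Lemma mem_mesh_points i k : Th i k \in mesh_points.
Proof. by apply/mapP; exists (i, k); rewrite ?mem_enum. Qed.

Lemma vertex_mem i a : vertex_of (Th i) a -> a \in mesh_points.
Proof. by move=> [k <-]; exact: mem_mesh_points. Qed.

Lemma sum_mesh_points (T : triangle R) (G : R * R -> R) :
  Defs.nondegenerate T -> (forall k, T k \in mesh_points) ->
  \sum_(v : V | `[< vertex_of T (val v) >]) G (val v) = \sum_k G (T k).
Proof.
move=> nT TV; have Tinj : injective T.
  move=> k l; have [//|kl] := eqVneq k l; have [m [km lm]] := third_index kl.
  have VT : vertices_of T (T k) (T l) (T m) by exists k, l, m.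
  by have /eqP := det3_edge_neq nT VT.
rewrite (reindex_onto (fun k => SeqSub (TV k)) (fun v => odflt ord0 [pick k | T k == val v])).
  apply: eq_big => // k; rewrite /=; case: pickP => [l /eqP/Tinj ->|/(_ k)]; last by rewrite eqxx.
  by rewrite eqxx andbT; apply/asboolP; exists k.
move=> v /asboolP[k kv]; apply: val_inj => /=; case: pickP => [l /eqP//|/(_ k)].
by rewrite kv eqxx.
Qed.

(** Double counting: circulations weighted by cell constants are regrouped by mesh edges, where the
    weights become jumps of these constants. *)
Lemma sum_cells_edges (om : R * R -> R * R -> R) (c : 'I_N -> R) :
  \sum_i c i * (\sum_k \sum_l side (Th i) (Th i k) (Th i l) * om (Th i k) (Th i l)) =
  \sum_(v : V) \sum_(w : V) om (val v) (val w) *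
    \sum_(i | `[< edge_of (Th i) (val v) (val w) >]) c i * side (Th i) (val v) (val w).
Proof.
transitivity (\sum_i \sum_(v : V) \sum_(w : V | `[< edge_of (Th i) (val v) (val w) >])
    om (val v) (val w) * (c i * side (Th i) (val v) (val w))); last first.
  rewrite exchange_big; apply: eq_bigr => v _ /=.
  rewrite (exchange_big_dep xpredT)//=; apply: eq_bigr => w _.
  by rewrite mulr_sumr.
apply: eq_bigr => i _.
rewrite -(sum_mesh_points (fun a => \sum_l side (Th i) a (Th i l) * om a (Th i l)));
  [|exact: nd|exact: mem_mesh_points].
rewrite mulr_sumr [RHS](bigID (fun v : V => `[< vertex_of (Th i) (val v) >]))/=.
rewrite [X in _ = _ + X]big1 ?addr0; last first.
  move=> v nv; apply: big1 => w /asboolP/edge_vertex[Vv _].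
  by move: nv; rewrite asboolT.
apply: eq_bigr => v /asboolP Vv.
rewrite -(sum_mesh_points (fun b => side (Th i) (val v) b * om (val v) b));
  [|exact: nd|exact: mem_mesh_points].
rewrite mulr_sumr [LHS](bigID (fun w : V => val w == val v))/=.
rewrite [X in X + _]big1 ?add0r; last first.
  by move=> w /andP[_ /eqP ->]; rewrite side_refl mul0r mulr0.
apply: eq_big => [w|w _]; last by rewrite mulrA mulrC.
apply/andP/asboolP => [[/asboolP[l lw] wv]|vw].
  have [k kv] := Vv; exists k, l; split=> //; apply: contraNneq wv => kl.
  by rewrite -lw -kv kl.
split; first by apply/asboolP; have [] := edge_vertex vw.
have [d W] := edge_vertices vw.
by rewrite eq_sym; exact: det3_edge_neq (@nd i) W.
Qed.

Definition interior_mesh_edge a b : Prop :=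
  (exists i, edge_of (Th i) a b) /\ ~ (segm a b `<=` frontier Omega).

Lemma sum_edge_cells i j p q (c : 'I_N -> R) : i != j ->
  edge_of (Th i) p q -> edge_of (Th j) p q ->
  \sum_(k | `[< edge_of (Th k) p q >]) c k * side (Th k) p q =
  (c i - c j) * side (Th i) p q.
Proof.
move=> ij ei ej; rewrite (bigD1 i)/=; last exact/asboolP.
rewrite (bigD1 j)/=; last by rewrite eq_sym ij andbT; apply/asboolP.
rewrite big1 ?addr0 => [|k /andP[/andP[/asboolP ek ki] kj]].
  by have [-> _] := side_opposite ij ei ej; ring.
have [si s1] := side_opposite ij ei ej.
have ik : i != k by rewrite eq_sym.
have jk : j != k by rewrite eq_sym.
have [sk _] := side_opposite ik ei ek; have [sk' _] := side_opposite jk ej ek.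
(* A third cell k on the edge would be opposite to both i and j, which are opposite to each
   other. *)
suff s0 : side (Th i) p q = 0 by move: s1; rewrite s0 expr0n/= => /eqP; rewrite eq_sym oner_eq0.
by move: sk'; rewrite sk si; lra.
Qed.

Lemma sum_pair (I : finType) (F : I -> I -> R) (i j : I) : i != j ->
  (forall k l, F k l != 0 -> (k = i /\ l = j) \/ (k = j /\ l = i)) ->
  \sum_k \sum_l F k l = F i j + F j i.
Proof.
move=> ij H; have F0 k l : ~ ((k = i /\ l = j) \/ (k = j /\ l = i)) -> F k l = 0.
  by move=> nkl; apply/eqP; apply/negPn/negP => /H.
have ji : j != i by rewrite eq_sym.
have rowi : \sum_l F i l = F i j.
  rewrite (bigD1 j)//= big1 ?addr0// => l lj; apply: F0 => -[[_ lj']|[/eqP]].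
    by move: lj; rewrite lj' eqxx.
  by rewrite (negPf ij).
have rowj : \sum_l F j l = F j i.
  rewrite (bigD1 i)//= big1 ?addr0// => l li; apply: F0 => -[[/eqP]|[_ li']].
    by rewrite (negPf ji).
  by move: li; rewrite li' eqxx.
rewrite (bigD1 i)//= rowi (bigD1 j)//= rowj big1 ?addr0// => k /andP[ki kj].
apply: big1 => l _; apply: F0.
by move=> [[ki' _]|[kj' _]]; [move: ki|move: kj]; rewrite ?ki' ?kj' eqxx.
Qed.

Lemma centroid_mean (T : triangle R) p q c : vertices_of T p q c ->
  centroid p q c = 3^-1 *: \sum_k T k.
Proof.
move=> [k [l [m [[kl km lm] [<- <- <-]]]]].
by rewrite (sum_three _ kl km lm) /centroid /bary !scalerDr.
Qed.

Section Dual.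
Variable zeta : R * R -> R * R -> R.
Hypothesis zetaC : forall a b, zeta b a = - zeta a b.
Hypothesis zeta_supp : forall a b, zeta a b != 0 -> interior_mesh_edge a b.
Hypothesis zeta_sum : forall v : V, Omega (val v) -> \sum_(w : V) zeta (val v) (val w) = 0.

(* The function Pot below jumps by 2 pi zeta across an edge and is otherwise
   constant: around a vertex v, the angles of the edges at v contribute
   rho v times the angle around v, which vanishes if v is in Omega and is
   compensated by a branch of the angle if v is not. *)
Lemma dual_exact : exists c : 'I_N -> R, forall i j p q, i != j ->
  edge_of (Th i) p q -> edge_of (Th j) p q -> ~ (segm p q `<=` frontier Omega) ->
  zeta p q = (c i - c j) * side (Th i) p q.
Proof.
(* Inside Omega there need not be a branch; the dummy is harmless, since the weight [rho] of such a
   vertex is zero. *)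
have exbr v : exists f : R * R -> R, ~ Omega v -> forall x y, segm x y `<=` Omega ->
    f y - f x = angle (x - v) (y - v).
  have [Ov|nOv] := pselect (Omega v); first by exists (fun=> 0).
  by have [f fP] := angle_branch Omega_sc nOv; exists f.
have [br brP] := choice exbr.
pose rho (v : V) := \sum_(w : V) zeta (val v) (val w).
pose Pot x := \sum_(v : V) rho v * br (val v) x +
  2^-1 * \sum_(v : V) \sum_(w : V) zeta (val v) (val w) * angle (val v - x) (val w - x).
pose ctr i := 3^-1 *: \sum_k Th i k.
have spokeP i p q c t : vertices_of (Th i) p q c -> 0 < t < 1 ->
    Omega (p + t *: (q - p)) ->
    Pot (ctr i) = Pot (p + t *: (q - p)) + pi * zeta p q * side (Th i) p q.
  move=> W t01 Oz; rewrite (side_vertices W) /ctr -(centroid_mean W).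
  set x := centroid p q c; set z := p + t *: (q - p).
  have seg := spoke_domain Omega_polygonal Th_triangulation W t01 Oz.
  (* The total turn along the quadrilateral formed by the spoke [x, z] and the edge [a, b]: zero
     when they are disjoint, and minus or plus pi when the spoke ends on the edge. *)
  pose Q a b := angle (x - a) (z - a) + angle (a - z) (b - z) + angle (z - b) (x - b) +
    angle (b - x) (a - x).
  have d0 := nondegenerate_det3 (@nd i) W.
  have xE : forall u v, cross (u - v) (x - v) = 3^-1 * (det3 v u p + det3 v u q + det3 v u c).
    move=> u v; rewrite /x /centroid /bary /det3 /cross/=/GRing.scale/=.
    by field.
  have dx : cross (q - p) (x - p) = 3^-1 * det3 p q c.
    by rewrite xE /det3 /cross/=; ring.
  have dx' : cross (p - q) (x - q) = - (3^-1 * det3 p q c).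
    by rewrite xE /det3 /cross/=; ring.
  have sg3 : Num.sg (3^-1 * det3 p q c) = Num.sg (det3 p q c).
    by rewrite sgrM gtr0_sg ?mul1r// invr_gt0.
  have Qpq : Q p q = - pi * Num.sg (det3 p q c).
    rewrite /Q (angle_sum_triangle t01) //; first by rewrite dx sg3.
    by rewrite dx mulf_neq0// invr_eq0.
  have Qqp : Q q p = pi * Num.sg (det3 p q c).
    have t01' : 0 < 1 - t < 1 by case/andP: t01 => *; lra.
    rewrite /Q (angle_sum_triangle t01') ?dx' ?sgrN ?sg3 ?mulrNN//.
      by apply: pairP; rewrite /z/=/GRing.scale/=; ring.
    by rewrite oppr_eq0 mulf_neq0// invr_eq0.
  have Q0 a b : zeta a b != 0 -> ~ ((a = p /\ b = q) \/ (a = q /\ b = p)) -> Q a b = 0.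
    move=> /zeta_supp[[j ab] _] nab; apply: angle_sum_disjoint.
      by have [d W'] := edge_vertices ab; exact: det3_edge_neq (@nd j) W'.
    exact: (spoke_edge Th_triangulation W t01 ab nab).
  have pV : p \in mesh_points by have [] := edge_vertex (vertices_edge W) => /vertex_mem.
  have qV : q \in mesh_points by have [_] := edge_vertex (vertices_edge W) => /vertex_mem.
  have pq : SeqSub pV != SeqSub qV :> V by exact: det3_edge_neq (@nd i) W.
  have QS : \sum_(v : V) \sum_(w : V) zeta (val v) (val w) * Q (val v) (val w) =
      - (2 * (pi * zeta p q * Num.sg (det3 p q c))).
    rewrite (sum_pair pq) /= ?Qpq ?Qqp; first by rewrite (zetaC p q); ring.
    move=> v w; rewrite mulf_eq0 negb_or => /andP[z0 Qn0].
    have [[vp wq]|[vq wp]] : (val v = p /\ val w = q) \/ (val v = q /\ val w = p).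
    - by apply: contrapT => /(Q0 _ _ z0) Q00; move: Qn0; rewrite Q00 eqxx.
    - by left; split; apply: val_inj.
    - by right; split; apply: val_inj.
  have brS : \sum_(v : V) rho v * br (val v) z - \sum_(v : V) rho v * br (val v) x =
      \sum_(v : V) \sum_(w : V) zeta (val v) (val w) * angle (x - val v) (z - val v).
    rewrite -sumrB; apply: eq_bigr => v _; rewrite -mulr_suml -/(rho v).
    have [Ov|nOv] := pselect (Omega (val v)).
      by rewrite (_ : rho v = 0) ?mul0r ?subrr//; exact: zeta_sum.
    by rewrite -mulrBr (brP _ nOv).
  have swap : \sum_(v : V) \sum_(w : V) zeta (val v) (val w) * angle (x - val w) (z - val w) =
      - \sum_(v : V) \sum_(w : V) zeta (val v) (val w) * angle (x - val v) (z - val v).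
    rewrite exchange_big -sumrN; apply: eq_bigr => v _; rewrite -sumrN.
    by apply: eq_bigr => w _; rewrite (zetaC (val v)) mulNr.
  (* [Q] trades the variation of the angle subtended by an edge for the angles under which its two
     ends see the spoke. By antisymmetry of zeta these add up to -2 times the sum in [brS]; the
     factor 1/2 in [Pot] makes them cancel the branches. *)
  have angS : \sum_(v : V) \sum_(w : V) zeta (val v) (val w) * angle (val v - z) (val w - z) -
      \sum_(v : V) \sum_(w : V) zeta (val v) (val w) * angle (val v - x) (val w - x) =
      \sum_(v : V) \sum_(w : V) zeta (val v) (val w) * Q (val v) (val w) +
      \sum_(v : V) \sum_(w : V) zeta (val v) (val w) * angle (x - val w) (z - val w) -
      \sum_(v : V) \sum_(w : V) zeta (val v) (val w) * angle (x - val v) (z - val v).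
    rewrite -big_split/= -!sumrB; apply: eq_bigr => v _.
    rewrite -big_split/= -!sumrB; apply: eq_bigr => w _.
    rewrite /Q (angle_opp (x - val w) (z - val w)) (angle_opp (val v - x) (val w - x)).
    by ring.
  move: brS angS; rewrite swap QS /Pot => brS angS.
  by lra.
(* Both spokes end at the same z and the two cells have opposite [side], so the half jumps pi zeta
   add up to 2 pi zeta. *)
exists (fun i => Pot (ctr i) / (2 * pi)) => i j p q ij ei ej nf.
have [_ [t [_ _ t01 Oz]]] := edge_neighbour Omega_polygonal Th_triangulation ei nf.
have [c W] := edge_vertices ei; have [d W'] := edge_vertices ej.
rewrite (spokeP i p q c t)// (spokeP j p q d t)//.
have [-> s1] := side_opposite ij ei ej.
transitivity (zeta p q * side (Th i) p q ^+ 2); first by rewrite s1 mulr1.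
have p0 : pi != 0 :> R by rewrite lt0r_neq0// pi_gt0.
by move: p0; generalize (pi : R) => P p0; field.
Qed.

End Dual.

(** Each side occurs in both directions, with [side] and om both changing sign: hence the factor
    2. *)
Lemma cell_circulation (T : triangle R) (om : R * R -> R * R -> R) p q c :
  (forall a b, om b a = - om a b) -> vertices_of T p q c ->
  \sum_k \sum_l side T (T k) (T l) * om (T k) (T l) =
  2 * Num.sg (det3 p q c) * (om p q + om q c + om c p).
Proof.
move=> omC W; have sideC a b : side T b a = - side T a b.
  rewrite /side -sumrN; apply: eq_bigr => k _; rewrite -sgrN; congr Num.sg.
  by rewrite /det3 /cross/=; ring.
have sqc := side_vertices (vertices_rot W).
have scp := side_vertices (vertices_rot (vertices_rot W)).
have rot (u v w : R * R) : det3 u v w = det3 v w u by rewrite /det3 /cross/=; ring.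
rewrite -(rot p q c) in sqc; rewrite -(rot q c p) -(rot p q c) in scp.
have spq := side_vertices W.
case: W => [k [l [m [[kl km lm] [kp lq mc]]]]].
rewrite !(sum_three _ kl km lm) kp lq mc !side_refl !mul0r.
rewrite (sideC p q) (sideC q c) (sideC c p) spq sqc scp (omC p q) (omC q c) (omC c p).
by ring.
Qed.

Lemma interior_mesh_edge_cells a b : interior_mesh_edge a b ->
  exists i j, [/\ i != j, edge_of (Th i) a b & edge_of (Th j) a b].
Proof.
move=> [[i ei] nf].
have [j [_ [ji ej _ _]]] := edge_neighbour Omega_polygonal Th_triangulation ei nf.
by exists i, j; rewrite eq_sym.
Qed.

Lemma interior_mesh_edge_sym a b : interior_mesh_edge a b -> interior_mesh_edge b a.
Proof.
move=> [[i ei] nf]; split; first by exists i; exact: edge_sym.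
by move=> h; apply: nf => x /segm_sym; exact: h.
Qed.

(** Discrete Stokes formula: an interior edge is seen from opposite sides by its two cells and
    cancels, while om vanishes on the other edges. *)
Lemma sum_circulation (om : R * R -> R * R -> R) :
  (forall i a b, edge_of (Th i) a b -> segm a b `<=` frontier Omega -> om a b = 0) ->
  \sum_i \sum_k \sum_l side (Th i) (Th i k) (Th i l) * om (Th i k) (Th i l) = 0.
Proof.
move=> om0; have := sum_cells_edges om (fun=> 1).
under eq_bigr do rewrite mul1r; move=> ->.
apply: big1 => v _; apply: big1 => w _.
have [/interior_mesh_edge_cells[i [j [ij ei ej]]]|nI] := pselect (interior_mesh_edge (val v) (val w)).
  by rewrite (sum_edge_cells (fun=> 1) ij ei ej) subrr mul0r mulr0.
rewrite mulr_sumr; apply: big1 => i /asboolP ei.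
rewrite (om0 i) ?mul0r//; apply: contrapT => nf; apply: nI; split=> //.
by exists i.
Qed.

Lemma cochain_exact (om : R * R -> R * R -> R) :
  (forall a b, om b a = - om a b) ->
  (forall i p q c, vertices_of (Th i) p q c -> om p q + om q c + om c p = 0) ->
  (forall i a b, edge_of (Th i) a b -> segm a b `<=` frontier Omega -> om a b = 0) ->
  exists W : R * R -> R, (forall a, frontier Omega a -> W a = 0) /\
    forall i a b, edge_of (Th i) a b -> om a b = W b - W a.
Proof.
move=> omC om1 om0.
pose IE (v w : V) : R := (`[< interior_mesh_edge (val v) (val w) >])%:R.
have IEC v w : IE w v = IE v w.
  by rewrite /IE; congr (_%:R); congr nat_of_bool; apply/asbool_equiv_eq; split;
    exact: interior_mesh_edge_sym.
have pairE (G : V * V -> R) : \sum_e G e = \sum_(v : V) \sum_(w : V) G (v, w).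
  by rewrite pair_bigA/=; apply: eq_bigr => -[].
pose In (v : V) : R := (`[< Omega (val v) >])%:R.
(* Coboundary from the vertices in Omega to the edges not contained in the frontier, over ordered
   pairs; the indicators [In] and [IE] cut the full mesh down to the relative complex. *)
pose D (a : V) (j : V * V) : R := In a * (IE j.1 j.2 * ((a == j.2)%:R - (a == j.1)%:R)).
have [|W WE] := @fredholm R V (V * V)%type D (fun e => IE e.1 e.2 * om (val e.1) (val e.2)).
  move=> eta eta0.
  (* The antisymmetric part of eta, without the factor 1/2, extended by zero to all pairs of points.
     That eta is killed by [D] says exactly that zeta sums to zero around the vertices in Omega. *)
  pose zeta (a b : R * R) : R := if insub a is Some v then
    (if insub b is Some w then IE v w * (eta (v, w) - eta (w, v)) else 0) else 0.
  have zetaE (v w : V) : zeta (val v) (val w) = IE v w * (eta (v, w) - eta (w, v)).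
    by rewrite /zeta !valK.
  have zetaC a b : zeta b a = - zeta a b.
    rewrite /zeta; case: (insub a : option V) => [v|]; case: (insub b : option V) => [w|];
      rewrite ?oppr0//.
    by rewrite (IEC v w); ring.
  have zeta_supp a b : zeta a b != 0 -> interior_mesh_edge a b.
    rewrite /zeta; case: (insubP V a) => [v _ <-|_]; rewrite ?eqxx//.
    case: (insubP V b) => [w _ <-|_]; rewrite ?eqxx//.
    by rewrite /IE; case: asboolP => // _; rewrite mul0r eqxx.
  have zeta_sum (a : V) : Omega (val a) -> \sum_(w : V) zeta (val a) (val w) = 0.
    move=> Oa; have := eta0 a; rewrite /D /In asboolT//.
    under eq_bigr do rewrite mul1r; rewrite pairE/= => E.
    apply/eqP; rewrite -oppr_eq0 -[X in _ == X]E; apply/eqP.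
    transitivity (\sum_(v : V) \sum_(w : V) IE v w * (a == w)%:R * eta (v, w) -
      \sum_(v : V) \sum_(w : V) IE v w * (a == v)%:R * eta (v, w)); last first.
      rewrite -sumrB; apply: eq_bigr => v _; rewrite -sumrB; apply: eq_bigr => w _.
      by ring.
    rewrite exchange_big/= -sumrB [RHS](bigD1 a)//= [X in _ = _ + X]big1 ?addr0; last first.
      move=> v va; rewrite eq_sym (negPf va) -sumrB; apply: big1 => w _.
      by rewrite !mulr0 !mul0r subrr.
    rewrite eqxx -sumrB -sumrN; apply: eq_bigr => w _.
    by rewrite zetaE (IEC a w) /=; ring.
  have [c cP] := dual_exact zetaC zeta_supp zeta_sum.
  rewrite pairE/=.
  have half : \sum_(v : V) \sum_(w : V) om (val v) (val w) * zeta (val v) (val w) =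
      2 * \sum_(v : V) \sum_(w : V) IE v w * om (val v) (val w) * eta (v, w).
    have -> : \sum_(v : V) \sum_(w : V) om (val v) (val w) * zeta (val v) (val w) =
        \sum_(v : V) \sum_(w : V) IE v w * om (val v) (val w) * eta (v, w) -
        \sum_(v : V) \sum_(w : V) IE v w * om (val v) (val w) * eta (w, v).
      rewrite -sumrB; apply: eq_bigr => v _; rewrite -sumrB; apply: eq_bigr => w _.
      by rewrite zetaE; ring.
    rewrite [X in _ - X]exchange_big/=.
    rewrite mulr_natl mulr2n; congr (_ + _); rewrite -sumrN; apply: eq_bigr => v _.
    rewrite -sumrN; apply: eq_bigr => w _.
    by rewrite (IEC v w) (omC (val v)); ring.
  suff : \sum_(v : V) \sum_(w : V) om (val v) (val w) * zeta (val v) (val w) = 0.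
    by rewrite half => /eqP; rewrite mulf_eq0 pnatr_eq0/= => /eqP.
  (* As zeta is the jump of the cell constants c, its pairing with om regroups into circulations
     weighted by c, and these vanish because om is closed. *)
  transitivity (\sum_i c i * (\sum_k \sum_l side (Th i) (Th i k) (Th i l) *
      om (Th i k) (Th i l))); last first.
    apply: big1 => i _; have [p [q [d W]]] := cell_triple (Th i).
    by rewrite (cell_circulation omC W) (om1 i)// !mulr0.
  rewrite sum_cells_edges; apply: eq_bigr => v _; apply: eq_bigr => w _.
  have [I|nI] := pselect (interior_mesh_edge (val v) (val w)).
    have [i [j [ij ei ej]]] := interior_mesh_edge_cells I.
    by rewrite (sum_edge_cells c ij ei ej) (cP i j)//; case: I.
  rewrite zetaE /IE asboolF// mul0r mulr0 mulr_sumr; apply/esym/big1 => i /asboolP ei.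
  rewrite (om0 i) ?mul0r//; apply: contrapT => nf; apply: nI; split=> //.
  by exists i.
(* The values at vertices off Omega, to which [D] gives weight zero, are reset to 0 as the boundary
   condition requires. *)
pose W' (a : R * R) : R := if insub a is Some v then In v * W v else 0.
have W'E (v : V) : W' (val v) = In v * W v by rewrite /W' valK.
have W'0 a : frontier Omega a -> W' a = 0.
  move=> fa; rewrite /W'; case: (insubP V a) => // v _ va.
  rewrite /In asboolF ?mul0r// va; exact: (frontierN Omega_polygonal).
exists W'; split=> // i a b ei.
have [va vb] := edge_vertex ei.
have [f|nf] := pselect (segm a b `<=` frontier Omega).
  rewrite (om0 i)// !W'0 ?subrr//; apply: f; [exact: segm_left|exact: segm_right].
pose v : V := SeqSub (vertex_mem va); pose w : V := SeqSub (vertex_mem vb).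
have I1 : IE v w = 1 by rewrite /IE asboolT//; split=> //; exists i.
have := WE (v, w); rewrite /= I1 mul1r => ->.
rewrite -[b]/(val w) -[a]/(val v) !W'E.
transitivity (\sum_u In u * W u * ((u == w)%:R - (u == v)%:R)).
  by apply: eq_bigr => u _; rewrite /D /= I1; ring.
have pick (u0 : V) : \sum_u In u * W u * (u == u0)%:R = In u0 * W u0.
  rewrite (bigD1 u0)//= eqxx mulr1 big1 ?addr0// => u /negPf ->.
  by rewrite mulr0.
by under eq_bigr do rewrite mulrBr; rewrite sumrB !pick.
Qed.

End Cochains.

(** * Cubic polynomials and edge moments *)

Section Cubics.
Context {R : realType}.
Implicit Types (c d : nat -> nat -> R) (a b x y : R * R) (k : nat) (f g : R * R -> R).

(** All polynomials in play have degree at most 3; with the ten monomials displayed, identities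
    between them are within reach of [ring]. *)
Definition cubic c x : R :=
  c 0%N 0%N + c 1%N 0%N * x.1 + c 0%N 1%N * x.2 + c 2%N 0%N * x.1 ^+ 2 +
  c 1%N 1%N * x.1 * x.2 + c 0%N 2%N * x.2 ^+ 2 + c 3%N 0%N * x.1 ^+ 3 +
  c 2%N 1%N * x.1 ^+ 2 * x.2 + c 1%N 2%N * x.1 * x.2 ^+ 2 + c 0%N 3%N * x.2 ^+ 3.

Definition supp k c : Prop := forall i j, (k < i + j)%N -> c i j = 0.

Lemma cubicE k c x : (k <= 3)%N -> supp k c ->
  cubic c x = \sum_(i < k.+1) \sum_(j < k.+1 | (i + j <= k)%N) c i j * x.1 ^+ i * x.2 ^+ j.
Proof.
move=> k3 ck; have E i j : c i j = if (i + j <= k)%N then c i j else 0.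
  by case: leqP => // /ck.
under [RHS]eq_bigr do rewrite big_mkcond/=.
rewrite /cubic (E 0 0)%N (E 1 0)%N (E 0 1)%N (E 2 0)%N (E 1 1)%N (E 0 2)%N (E 3 0)%N
  (E 2 1)%N (E 1 2)%N (E 0 3)%N.
by case: k k3 {ck E} => [|[|[|[|//]]]] _; rewrite !big_ord_recl !big_ord0 /=; ring.
Qed.

Lemma PkP k (w : R * R -> R) : (k <= 3)%N -> Pk k w <-> exists2 c, supp k c & w = cubic c.
Proof.
move=> k3; split => [[c wE]|[c ck ->]]; last by exists c => x; exact: cubicE.
exists (fun i j => if (i + j <= k)%N then c i j else 0).
  by move=> i j; rewrite ltnNge => /negPf ->.
apply/funext => x; rewrite wE (@cubicE k)//; last by move=> i j; rewrite ltnNge => /negPf ->.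
by apply: eq_bigr => i _; apply: eq_bigr => j ->.
Qed.

Lemma supp_le k l c : (k <= l)%N -> supp k c -> supp l c.
Proof. by move=> kl ck i j lij; apply: ck; exact: leq_ltn_trans lij. Qed.

Definition coef_add c d : nat -> nat -> R := fun i j => c i j + d i j.
Definition coef_scale (s : R) c : nat -> nat -> R := fun i j => s * c i j.

Lemma cubic_add c d : cubic (coef_add c d) = (fun x => cubic c x + cubic d x).
Proof. by apply/funext => x; rewrite /cubic /coef_add; ring. Qed.

Lemma cubic_scale s c : cubic (coef_scale s c) = (fun x => s * cubic c x).
Proof. by apply/funext => x; rewrite /cubic /coef_scale; ring. Qed.

Lemma supp_add k c d : supp k c -> supp k d -> supp k (coef_add c d).
Proof. by move=> ck dk i j ij; rewrite /coef_add ck// dk// addr0. Qed.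

Lemma supp_scale k s c : supp k c -> supp k (coef_scale s c).
Proof. by move=> ck i j ij; rewrite /coef_scale ck// mulr0. Qed.

Lemma Pk_add k f g : (k <= 3)%N -> Pk k f -> Pk k g -> Pk k (fun x => f x + g x).
Proof.
move=> k3 /(PkP _ k3)[c ck ->] /(PkP _ k3)[d dk ->]; apply/(PkP _ k3).
by exists (coef_add c d); [exact: supp_add|rewrite cubic_add].
Qed.

Lemma Pk_scale k s f : (k <= 3)%N -> Pk k f -> Pk k (fun x => s * f x).
Proof.
move=> k3 /(PkP _ k3)[c ck ->]; apply/(PkP _ k3).
by exists (coef_scale s c); [exact: supp_scale|rewrite cubic_scale].
Qed.

Lemma Pk_sub k f g : (k <= 3)%N -> Pk k f -> Pk k g -> Pk k (fun x => f x - g x).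
Proof.
move=> k3 fk gk; rewrite (_ : (fun x => _) = (fun x => f x + -1 * g x)).
  by apply: Pk_add => //; exact: Pk_scale.
by apply/funext => x; rewrite mulN1r.
Qed.

Lemma Pk_le k l f : (k <= l <= 3)%N -> Pk k f -> Pk l f.
Proof.
move=> /andP[kl l3] /(PkP _ (leq_trans kl l3))[c ck ->]; apply/(PkP _ l3).
by exists c => //; exact: supp_le ck.
Qed.

Lemma Pk_affine k (s t r : R) : (0 < k <= 3)%N -> Pk k (fun x => s + t * x.1 + r * x.2).
Proof.
move=> /andP[k0 k3]; apply/(PkP _ k3).
exists (fun i j => match i, j with 0%N, 0%N => s | 1%N, 0%N => t | 0%N, 1%N => r | _, _ => 0 end).
  by move=> [|[|i]] [|[|j]] //=; rewrite ltnS leqNgt k0.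
by apply/funext => x; rewrite /cubic; ring.
Qed.

Lemma Pk_cst k (s : R) : (k <= 3)%N -> Pk k (fun=> s).
Proof.
move=> k3; apply/(PkP _ k3).
exists (fun i j => match i, j with 0%N, 0%N => s | _, _ => 0 end); first by move=> [|i] [|j].
by apply/funext => x; rewrite /cubic; ring.
Qed.

Definition coef_dx c : nat -> nat -> R := fun i j => i.+1%:R * c i.+1 j.
Definition coef_dy c : nat -> nat -> R := fun i j => j.+1%:R * c i j.+1.

Lemma supp_dx k c : supp k.+1 c -> supp k (coef_dx c).
Proof. by move=> ck i j ij; rewrite /coef_dx ck ?mulr0// addSn. Qed.

Lemma supp_dy k c : supp k.+1 c -> supp k (coef_dy c).
Proof. by move=> ck i j ij; rewrite /coef_dy ck ?mulr0// addnS. Qed.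

Lemma is_derive_fst x v : is_derive x v (fst : R * R -> R) v.1.
Proof.
have cv : (fun h : R => h^-1 *: ((fst \o shift x) (h *: v) - x.1)) @ 0^' --> v.1.
  apply: (@cvg_trans _ ((fun=> v.1) @ (0 : R)^')); last exact: cvg_cst.
  apply: near_eq_cvg; near=> h; have h0 : h != 0 by near: h; exact: nbhs_dnbhs_neq.
  by rewrite /= addrK scalerA mulVf// scale1r.
by split; [apply/cvg_ex; exists v.1|exact/cvg_lim].
Unshelve. all: by end_near. Qed.

Lemma is_derive_snd x v : is_derive x v (snd : R * R -> R) v.2.
Proof.
have cv : (fun h : R => h^-1 *: ((snd \o shift x) (h *: v) - x.2)) @ 0^' --> v.2.
  apply: (@cvg_trans _ ((fun=> v.2) @ (0 : R)^')); last exact: cvg_cst.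
  apply: near_eq_cvg; near=> h; have h0 : h != 0 by near: h; exact: nbhs_dnbhs_neq.
  by rewrite /= addrK scalerA mulVf// scale1r.
by split; [apply/cvg_ex; exists v.2|exact/cvg_lim].
Unshelve. all: by end_near. Qed.

Lemma derive_cubic c x v : supp 3 c ->
  'D_v (cubic c) x = v.1 * cubic (coef_dx c) x + v.2 * cubic (coef_dy c) x.
Proof.
move=> c3; have d1 := is_derive_fst x v; have d2 := is_derive_snd x v.
have d11 := is_deriveM d1 d1; have d12 := is_deriveM d1 d2; have d22 := is_deriveM d2 d2.
have d111 := is_deriveM d11 d1; have d112 := is_deriveM d11 d2.
have d122 := is_deriveM d12 d2; have d222 := is_deriveM d22 d2.
have D := is_deriveD (is_deriveD (is_deriveD (is_deriveD (is_deriveD (is_deriveD (is_deriveD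
  (is_deriveD (is_deriveD (is_derive_cst (c 0%N 0%N) x v) (is_deriveZ (c 1%N 0%N) d1))
  (is_deriveZ (c 0%N 1%N) d2)) (is_deriveZ (c 2%N 0%N) d11)) (is_deriveZ (c 1%N 1%N) d12))
  (is_deriveZ (c 0%N 2%N) d22)) (is_deriveZ (c 3%N 0%N) d111)) (is_deriveZ (c 2%N 1%N) d112))
  (is_deriveZ (c 1%N 2%N) d122)) (is_deriveZ (c 0%N 3%N) d222).
have scE (s r : R) : s *: (r : R^o) = s * r by [].
have := derive_val (is_derive := D).
set F := (X in 'D_v X x = _); have -> : F = cubic c.
  apply/funext => y; rewrite /F /cubic !fctE /= !scE; ring.
move=> ->; rewrite !fctE /= !scE /cubic /coef_dx /coef_dy.
(* [cubic] applied to differentiated coefficients reads the degree 4 entries of c, which must be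
   known to vanish. *)
have c4 i j : (3 < i + j)%N -> c i j = 0 by exact: c3.
rewrite (c4 4 0)%N// (c4 3 1)%N// (c4 2 2)%N// (c4 1 3)%N// (c4 0 4)%N//.
by ring.
Qed.

Definition subst_cubic c (X Y : {poly R}) : {poly R} :=
  (c 0%N 0%N)%:P + (c 1%N 0%N)%:P * X + (c 0%N 1%N)%:P * Y + (c 2%N 0%N)%:P * X ^+ 2 +
  (c 1%N 1%N)%:P * X * Y + (c 0%N 2%N)%:P * Y ^+ 2 + (c 3%N 0%N)%:P * X ^+ 3 +
  (c 2%N 1%N)%:P * X ^+ 2 * Y + (c 1%N 2%N)%:P * X * Y ^+ 2 + (c 0%N 3%N)%:P * Y ^+ 3.

Lemma deriv_subst_cubic c X Y : supp 3 c ->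
  (subst_cubic c X Y)^`() = X^`() * subst_cubic (coef_dx c) X Y + Y^`() * subst_cubic (coef_dy c) X Y.
Proof.
move=> c4; rewrite /subst_cubic /coef_dx /coef_dy.
rewrite (c4 4 0)%N// (c4 3 1)%N// (c4 2 2)%N// (c4 1 3)%N// (c4 0 4)%N//.
rewrite !(exprS, expr0, mulr1) !(derivD, derivM, derivC).
by rewrite !(mulr0, polyC0, polyCM, polyC_natr); ring.
Qed.

(** The trace on the edge as a univariate polynomial in the parameter t, so that edge conditions
    become conditions on [{poly R}]. *)
Definition restr a b c : {poly R} :=
  subst_cubic c (a.1%:P + (b.1 - a.1)%:P * 'X) (a.2%:P + (b.2 - a.2)%:P * 'X).

Lemma restrE a b c (t : R) : (restr a b c).[t] = cubic c (a + t *: (b - a)).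
Proof.
have E1 : (a + t *: (b - a)).1 = a.1 + (b.1 - a.1) * t by rewrite mulrC.
have E2 : (a + t *: (b - a)).2 = a.2 + (b.2 - a.2) * t by rewrite mulrC.
by rewrite /restr /subst_cubic /cubic E1 E2 !hornerE.
Qed.

Lemma restr0 a b c : (restr a b c).[0] = cubic c a.
Proof. by rewrite restrE scale0r addr0. Qed.

Lemma restr1 a b c : (restr a b c).[1] = cubic c b.
Proof. by rewrite restrE scale1r addrC subrK. Qed.

Lemma deriv_restr a b c : supp 3 c ->
  (restr a b c)^`() = (b.1 - a.1)%:P * restr a b (coef_dx c) + (b.2 - a.2)%:P * restr a b (coef_dy c).
Proof.
have dl (s t : R) : (s%:P + t%:P * 'X)^`() = t%:P.
  by rewrite derivD derivM !derivC derivX mul0r !add0r mulr1.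
by move=> c3; rewrite /restr deriv_subst_cubic// !dl.
Qed.

Definition int01 (q : {poly R}) : R := \int[lebesgue_measure]_(t in `[0%R, 1%R]) q.[t].

Lemma int01_integrable (q : {poly R}) :
  (@lebesgue_measure R).-integrable `[0%R, 1%R] (EFin \o horner q).
Proof.
apply: continuous_compact_integrable; first exact: segment_compact.
by apply: continuous_subspaceT => t; exact: continuous_horner.
Qed.

Lemma int01D (p q : {poly R}) : int01 (p + q) = int01 p + int01 q.
Proof.
rewrite /int01 -RintegralD//; try exact: int01_integrable.
by apply: eq_Rintegral => t _; rewrite hornerD.
Qed.

Lemma int01Z (s : R) (q : {poly R}) : int01 (s%:P * q) = s * int01 q.
Proof.
rewrite /int01 -RintegralZl//; try exact: int01_integrable.
by apply: eq_Rintegral => t _; rewrite hornerCM.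
Qed.

Lemma int01B (p q : {poly R}) : int01 (p - q) = int01 p - int01 q.
Proof.
by rewrite -mulN1r -polyC1 -polyCN int01D int01Z mulN1r.
Qed.

Lemma int01_deriv (q : {poly R}) : int01 q^`() = q.[1] - q.[0].
Proof.
rewrite /int01 /Rintegral (@continuous_FTC2 _ _ (horner q))//.
- by apply: continuous_subspaceT => t; exact: continuous_horner.
- split.
  + by move=> t _; exact: derivable_horner.
  + by apply: cvg_at_right_filter; exact: continuous_horner.
  + by apply: cvg_at_left_filter; exact: continuous_horner.
- by move=> t _; rewrite derivE.
Qed.

Lemma eq_int01 (p q : {poly R}) : (forall t, p.[t] = q.[t]) -> int01 p = int01 q.
Proof. by move=> pq; apply: eq_Rintegral => t _. Qed.

Lemma int010 : int01 0 = 0.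
Proof. by rewrite -(subrr (0 : {poly R})) int01B subrr. Qed.

(** Integration by parts. With [int01_deriv] it expresses the affine moments of a derivative through
    end values and mean, which links the edge conditions of B to those of G. *)
Lemma int01_Xderiv (q : {poly R}) : int01 ('X * q^`()) = q.[1] - int01 q.
Proof.
have := int01_deriv ('X * q); rewrite derivM derivX mul1r int01D !hornerM !hornerX.
by rewrite mul1r mul0r subr0 => <-; rewrite addrAC subrr add0r.
Qed.

Lemma edge_integral_poly a b f (G : {poly R}) : (forall t, f (a + t *: (b - a)) = G.[t]) ->
  edge_integral a b f = enorm (b - a) * int01 G.
Proof. by move=> fG; rewrite /edge_integral; congr (_ * _); apply: eq_Rintegral => t _. Qed.

Lemma edge_moment0P a b f (G : {poly R}) : a != b ->
  (forall t, f (a + t *: (b - a)) = G.[t]) ->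
  (forall p, Pk 0 p -> edge_integral a b (fun x => p x * f x) = 0) <-> int01 G = 0.
Proof.
move=> ab fG; have n0 : enorm (b - a) != 0 by rewrite enorm_eq0 subr_eq0 eq_sym.
split=> [H|G0 p /(PkP _ (leq0n 3))[c c0 ->]].
  have := H _ (@Pk_cst 0 1 isT); rewrite (edge_integral_poly (G := G)).
    by move/eqP; rewrite mulf_eq0 (negPf n0) => /eqP.
  by move=> t; rewrite mul1r fG.
rewrite (edge_integral_poly (G := (c 0%N 0%N)%:P * G)) ?int01Z ?G0 ?mulr0// => t.
rewrite hornerCM -fG (@cubicE 0)//; congr (_ * _).
by rewrite big_ord1 big_mkcond big_ord1/= !expr0 !mulr1.
Qed.

Lemma edge_moment1P a b f (G : {poly R}) : a != b ->
  (forall t, f (a + t *: (b - a)) = G.[t]) ->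
  (forall p, Pk 1 p -> edge_integral a b (fun x => p x * f x) = 0) <->
  int01 G = 0 /\ int01 ('X * G) = 0.
Proof.
move=> ab fG; have n0 : enorm (b - a) != 0 by rewrite enorm_eq0 subr_eq0 eq_sym.
split=> [H|[G0 G1] p /(PkP (k := 1) _ isT)[c c1 ->]].
  split.
    have := H _ (@Pk_cst 1 1 isT); rewrite (edge_integral_poly (G := G)).
      by move/eqP; rewrite mulf_eq0 (negPf n0) => /eqP.
    by move=> t; rewrite mul1r fG.
  (* u and v are the coefficients of the affine function of the plane that equals the parameter t
     along the edge: the normalised projection on b - a. *)
  pose n2 := enorm (b - a) ^+ 2; have n20 : n2 != 0 by rewrite sqrf_eq0.
  pose u := (b.1 - a.1) / n2; pose v := (b.2 - a.2) / n2.
  have := H _ (@Pk_affine 1 (- (u * a.1 + v * a.2)) u v isT).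
  rewrite (edge_integral_poly (G := 'X * G)).
    by move/eqP; rewrite mulf_eq0 (negPf n0) => /eqP.
  move=> t; rewrite hornerM hornerX -fG; congr (_ * _).
  have E1 : (a + t *: (b - a)).1 = a.1 + t * (b.1 - a.1) by [].
  have E2 : (a + t *: (b - a)).2 = a.2 + t * (b.2 - a.2) by [].
  transitivity (t * (((b.1 - a.1) ^+ 2 + (b.2 - a.2) ^+ 2) / n2)).
    by rewrite E1 E2 /u /v; ring.
  have -> : (b.1 - a.1) ^+ 2 + (b.2 - a.2) ^+ 2 = n2 by rewrite /n2 sqr_enorm.
  by rewrite divff ?mulr1.
pose s := cubic c a; pose t1 := cubic c b - cubic c a.
rewrite (edge_integral_poly (G := s%:P * G + t1%:P * ('X * G))).
  by rewrite int01D !int01Z G0 G1 !mulr0 addr0 mulr0.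
move=> t; rewrite hornerD !hornerCM hornerM hornerX -fG mulrA -mulrDl; congr (_ * _).
have cE x : cubic c x = c 0%N 0%N + c 1%N 0%N * x.1 + c 0%N 1%N * x.2.
  rewrite /cubic (c1 2 0)%N// (c1 1 1)%N// (c1 0 2)%N// (c1 3 0)%N// (c1 2 1)%N//.
  by rewrite (c1 1 2)%N// (c1 0 3)%N//; ring.
have E1 : (a + t *: (b - a)).1 = a.1 + t * (b.1 - a.1) by [].
have E2 : (a + t *: (b - a)).2 = a.2 + t * (b.2 - a.2) by [].
by rewrite /t1 /s !cE E1 E2; ring.
Qed.

Lemma gradient0_cst c x y : supp 3 c -> (forall z, cubic (coef_dx c) z = 0) ->
  (forall z, cubic (coef_dy c) z = 0) -> cubic c x = cubic c y.
Proof.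
move=> c3 cx cy; have := int01_deriv (restr x y c).
rewrite restr0 restr1 deriv_restr// (@eq_int01 _ 0) => [|t].
  by rewrite int010 => /eqP; rewrite eq_sym subr_eq0 => /eqP.
by rewrite hornerD !hornerM !restrE cx cy !mulr0 addr0 horner0.
Qed.

(** On the line from x to y the cubic is a univariate polynomial with more roots than its degree
    allows. *)
Lemma cubic_eq0_near c x (e : R) : 0 < e ->
  (forall y, `|y.1 - x.1| < e -> `|y.2 - x.2| < e -> cubic c y = 0) ->
  forall y, cubic c y = 0.
Proof.
move=> e0 H y; suff q0 : restr x y c = 0 by rewrite -(restr1 x) q0 horner0.
apply/eqP/negPn/negP => q0.
pose m := 1 + `|y.1 - x.1| + `|y.2 - x.2|.
have [n1 n2] : 0 <= `|y.1 - x.1| /\ 0 <= `|y.2 - x.2| by [].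
have m0 : 0 < m by rewrite /m; lra.
(* Distinct parameters so small that x + r k (y - x) stays in the box: m exceeds both coordinates of
   the displacement. *)
pose r (k : nat) : R := e / m / k.+1%:R.
have r0 k : 0 < r k by rewrite !divr_gt0.
have rinj : injective r.
  move=> k l /(mulfI (lt0r_neq0 (divr_gt0 e0 m0))) /invr_inj /eqP.
  by rewrite eqr_nat eqSS => /eqP.
have rroot k : root (restr x y c) (r k).
  have rm : r k * m <= e.
    rewrite /r mulrAC divfK ?gt_eqF// ler_pdivrMr//.
    by rewrite ler_peMr ?ler1n// ltW.
  have E1 : (x + r k *: (y - x)).1 - x.1 = r k * (y.1 - x.1) by rewrite addrAC subrr add0r.
  have E2 : (x + r k *: (y - x)).2 - x.2 = r k * (y.2 - x.2) by rewrite addrAC subrr add0r.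
  have rk := r0 k; have := mulr_ge0 (ltW rk) n1; have := mulr_ge0 (ltW rk) n2 => rn2 rn1.
  have rm' : r k + r k * `|y.1 - x.1| + r k * `|y.2 - x.2| <= e.
    by rewrite (le_trans _ rm)// /m !mulrDr mulr1.
  by apply/eqP; rewrite restrE; apply: H; rewrite ?E1 ?E2 normrM gtr0_norm//; lra.
pose rs := [seq r k | k <- iota 0 (size (restr x y c))].
have allr : all (root (restr x y c)) rs by apply/allP => z /mapP[k _ ->].
have unir : uniq rs by rewrite map_inj_uniq ?iota_uniq.
by have := max_poly_roots q0 allr unir; rewrite size_map size_iota ltnn.
Qed.

End Cubics.

(** * The broken inner product *)

Section PlaneMeasure.
Context {R : realType}.

Local Notation plane := (measurableTypeR R * measurableTypeR R)%type.
Local Notation leb2 := (@lebesgue_measure R \x @lebesgue_measure R)%E.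

Lemma ball_plane (x : R * R) (e : R) : ball x e = ball x.1 e `*` ball x.2 e.
Proof. by []. Qed.

Lemma measurable_ball_plane (x : R * R) (e : R) : measurable (ball x e : set plane).
Proof. by rewrite ball_plane; apply: measurableX; apply: open_measurable; exact: ball_open. Qed.

(** Balls of the sup norm are rectangles, and an open set is a countable union of those with
    rational data: a radius between e / 4 and e / 2 and a centre within e / 4 of x fit inside the
    ball of radius e. *)
Lemma open_measurable_plane (U : set (R * R)) : open U -> measurable (U : set plane).
Proof.
move=> oU.
pose bl (p q r : rat) : set (R * R) := ball ((ratr p, ratr q) : R * R) (ratr r).
pose B p q r : set plane := if `[< bl p q r `<=` U >] then bl p q r else set0.
have -> : U = \bigcup_p \bigcup_q \bigcup_r B p q r.
  rewrite eqEsubset; split=> [x Ux|x [p _ [q _ [r _]]]]; last first.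
    by rewrite /B; case: asboolP => // h; exact: h.
  have /nbhs_ballP[e /= e0 eU] : nbhs x U by exact: oU.
  have [r] : exists r, ratr r \in `]e / 4, e / 2[ by apply: rat_in_itvoo; lra.
  rewrite in_itv/= => r12.
  have [p] : exists p, ratr p \in `]x.1 - e / 4, x.1 + e / 4[ by apply: rat_in_itvoo; lra.
  rewrite in_itv/= => p12.
  have [q] : exists q, ratr q \in `]x.2 - e / 4, x.2 + e / 4[ by apply: rat_in_itvoo; lra.
  rewrite in_itv/= => q12.
  exists p => //; exists q => //; exists r => //.
  rewrite /B /bl asboolT; first by split; rewrite /ball/= ltr_norml; apply/andP; split; lra.
  move=> y [y1 y2]; apply: eU; move: y1 y2; rewrite /ball/= !ltr_norml => y1 y2.
  by split; rewrite /ball/= ltr_norml; apply/andP; split; lra.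
apply: bigcupT_measurable_rat => p; apply: bigcupT_measurable_rat => q.
apply: bigcupT_measurable_rat => r; rewrite /B; case: asboolP => _.
  exact: measurable_ball_plane.
exact: measurable0.
Qed.

Lemma measurable_cubic (c : nat -> nat -> R) :
  measurable_fun [set: plane] (cubic c : plane -> R).
Proof.
have mf : measurable_fun [set: plane] (fun x : plane => x.1 : R) by exact: measurable_fst.
have ms : measurable_fun [set: plane] (fun x : plane => x.2 : R) by exact: measurable_snd.
rewrite /cubic.
by repeat first [apply: measurable_funD|apply: measurable_funM|apply: measurable_funX
  |exact: measurable_cst|exact: mf|exact: ms].
Qed.

(** Broken functions jump, so integrability does not come from continuity: boundedness on boxes,
    together with measurability, suffices on a bounded domain. *)
Definition box_bounded (K : R) (f : R * R -> R) : Prop :=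
  exists M, forall x, `|x.1| <= K -> `|x.2| <= K -> `|f x| <= M.

Lemma box_boundedD K f g : box_bounded K f -> box_bounded K g ->
  box_bounded K (fun x => f x + g x).
Proof.
move=> [M fM] [L gL]; exists (M + L) => x x1 x2.
by rewrite (le_trans (ler_normD _ _))// lerD ?fM ?gL.
Qed.

Lemma box_boundedM K f g : box_bounded K f -> box_bounded K g ->
  box_bounded K (fun x => f x * g x).
Proof.
move=> [M fM] [L gL]; exists (M * L) => x x1 x2.
by rewrite normrM ler_pM ?fM ?gL.
Qed.

Lemma box_bounded_cst K s : box_bounded K (fun=> s).
Proof. by exists `|s|. Qed.

Lemma box_bounded_cubic K c : box_bounded K (cubic c).
Proof.
have b1 : box_bounded K fst by exists K.
have b2 : box_bounded K snd by exists K.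
have bX f n : box_bounded K f -> box_bounded K (fun x => f x ^+ n).
  move=> bf; elim: n => [|n IH]; first exact: box_bounded_cst.
  under eq_fun do rewrite exprS; exact: box_boundedM.
rewrite /cubic.
by repeat first [exact: box_bounded_cst|exact: b1|exact: b2|apply: bX
  |apply: box_boundedD|apply: box_boundedM].
Qed.

End PlaneMeasure.

Section BrokenInner.
Context {R : realType} (Omega : set (R * R)) (N : nat) (Th : 'I_N -> triangle R).
Hypothesis Omega_polygonal : polygonal_domain Omega.
Hypothesis Th_triangulation : triangulation Omega Th.
Implicit Types (w v : broken R N) (x : R * R) (i j : 'I_N).

Local Notation plane := (measurableTypeR R * measurableTypeR R)%type.
Local Notation leb2 := (@lebesgue_measure R \x @lebesgue_measure R)%E.

Let Omega_open : open Omega.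
Proof. by have [[]] := Omega_polygonal. Qed.

Let mOmega : measurable (Omega : set plane).
Proof. exact: open_measurable_plane. Qed.

Lemma domain_box : exists K, forall x, Omega x -> `|x.1| <= K /\ `|x.2| <= K.
Proof.
have [[_ _ _ [M [_ hM]]] _] := Omega_polygonal.
have MM : M < `|M| + 1 by rewrite (le_lt_trans (ler_norm M))// ltrDl.
exists (`|M| + 1) => x Ox; have : `|x| <= `|M| + 1 := hM _ MM x Ox.
by rewrite /Num.norm/= /ProdNormedZmodule.norm ge_max => /andP.
Qed.

Let finite_Omega : (leb2 (Omega : set plane) < +oo)%E.
Proof.
have [K hK] := domain_box.
apply: (@le_lt_trans _ _ (leb2 (`[- K, K] `*` `[- K, K] : set plane))).
  apply: le_measure; rewrite ?inE//; first by apply: measurableX; exact: measurable_itv.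
  by move=> x /hK; rewrite !ler_norml => -[? ?]; split; rewrite /= in_itv.
rewrite product_measure1E; [|exact: measurable_itv|exact: measurable_itv].
have fin : (@lebesgue_measure R `[(- K)%R, K] < +oo)%E.
  by rewrite lebesgue_measure_itv/=; case: ifP => _; rewrite ltry.
by rewrite lte_mul_pinfty// ge0_fin_numE.
Qed.

Lemma broken_fun_interior w i x : interior (cell (Th i)) x -> broken_fun Th w x = w i x.
Proof.
move=> xi; rewrite /broken_fun (bigD1 i)//= big1 ?addr0 => [|j ji].
  by rewrite indicE mem_set// mulr1.
rewrite indicE memNset ?mulr0// => xj.
exact: (interior_disjoint Th_triangulation ji xj xi).
Qed.

Lemma broken_fun_exterior w x : (forall i, ~ interior (cell (Th i)) x) -> broken_fun Th w x = 0.
Proof.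
by move=> nx; apply: big1 => i _; rewrite indicE memNset ?mulr0//; exact: nx.
Qed.

Let measurable_broken w : Ph 3 w ->
  measurable_fun [set: plane] (broken_fun Th w : plane -> R).
Proof.
move=> w3; apply: measurable_sum => i; apply: measurable_funM.
  by have /PkP[//|c _ ->] := w3 i; exact: measurable_cubic.
by apply: measurable_indic; apply: open_measurable_plane; exact: open_interior.
Qed.

Let bounded_broken w K : Ph 3 w -> box_bounded K (broken_fun Th w).
Proof.
move=> w3; rewrite /broken_fun; elim: (index_enum _) => [|i r IH].
  by under eq_fun do rewrite big_nil; exact: box_bounded_cst.
under eq_fun do rewrite big_cons; apply: box_boundedD IH; apply: box_boundedM.
  by have /PkP[//|c _ ->] := w3 i; exact: box_bounded_cubic.
by exists 1 => x _ _; rewrite indicE; case: (_ \in _); rewrite ?normr1 ?normr0.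
Qed.

Let integrable_bounded (F : R * R -> R) : measurable_fun [set: plane] (F : plane -> R) ->
  (forall K, box_bounded K F) -> leb2.-integrable (Omega : set plane) (EFin \o F).
Proof.
move=> mF bF; apply: measurable_bounded_integrable => //.
  exact: measurable_funS mF.
have [K hK] := domain_box; have [M hM] := bF K.
exists M; split; first exact: num_real.
move=> L ML x Ox; have [x1 x2] := hK x Ox.
exact: le_trans (hM _ x1 x2) (ltW ML).
Qed.

Lemma integrable_broken w v : Ph 3 w -> Ph 3 v ->
  leb2.-integrable (Omega : set plane) (EFin \o (fun x => broken_fun Th w x * broken_fun Th v x)).
Proof.
move=> w3 v3; apply: integrable_bounded.
  by apply: measurable_funM; exact: measurable_broken.
by move=> K; apply: box_boundedM; exact: bounded_broken.
Qed.

Lemma bipB w w' v : Ph 3 w -> Ph 3 w' -> Ph 3 v ->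
  bip Omega Th (fun i x => w i x - w' i x) v = bip Omega Th w v - bip Omega Th w' v.
Proof.
move=> w3 w'3 v3; rewrite /bip /ip -RintegralB//; try exact: integrable_broken.
apply: eq_Rintegral => x _; rewrite -mulrBl; congr (_ * _).
by rewrite /broken_fun -sumrB; apply: eq_bigr => i _; rewrite mulrBl.
Qed.

Lemma bipZ (s : R) w v : Ph 3 w -> Ph 3 v ->
  bip Omega Th (fun i x => s * w i x) v = s * bip Omega Th w v.
Proof.
move=> w3 v3; rewrite /bip /ip -RintegralZl//; try exact: integrable_broken.
apply: eq_Rintegral => x _; rewrite mulrA; congr (_ * _).
by rewrite /broken_fun mulr_sumr; apply: eq_bigr => i _; rewrite mulrA.
Qed.

Lemma bipC w v : bip Omega Th w v = bip Omega Th v w.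
Proof. by apply: eq_Rintegral => x _; rewrite mulrC. Qed.

Lemma bip_ge0 w : 0 <= bip Omega Th w w.
Proof. by apply: Rintegral_ge0 => x _; rewrite -expr2 sqr_ge0. Qed.

(** Outside the interiors of the cells the function representing 1 is zero, but so is the one
    representing w; the integrands therefore agree at every point. *)
Lemma bip_one w : bip Omega Th w (fun _ _ => 1) =
  \int[leb2]_(x in (Omega : set plane)) broken_fun Th w x.
Proof.
apply: eq_Rintegral => x _.
have [[i xi]|nx] := pselect (exists i, interior (cell (Th i)) x).
  by rewrite !(broken_fun_interior _ xi) mulr1.
by rewrite broken_fun_exterior ?mul0r// => i xi; apply: nx; exists i.
Qed.

(** A cubic nonzero somewhere near the centroid of a cell stays away from zero on a small ball,
    which bounds the integral of the square from below. So the cubic vanishes near the centroid,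
    hence everywhere. *)
Lemma bip_eq0 w i x : Ph 3 w -> bip Omega Th w w = 0 -> w i x = 0.
Proof.
move=> w3 b0; have /PkP[//|c c3 wE] := w3 i.
have [p [q [d V]]] := cell_triple (Th i).
have ndi : Defs.nondegenerate (Th i) by have [] := Th_triangulation.
pose z := bary 3^-1 3^-1 3^-1 p q d.
have zi : interior (cell (Th i)) z by apply: interior_cell => //; lra.
have [e e0 ze] : exists2 e : R, 0 < e & ball z e `<=` interior (cell (Th i)).
  have /nbhs_ballP[e /= e0 ez] : nbhs z (interior (cell (Th i))).
    by apply: open_nbhs_nbhs; split=> //; exact: open_interior.
  by exists e.
rewrite wE; move: x; apply: (@cubic_eq0_near _ _ z _ e0) => y y1 y2.
apply/eqP/negPn/negP => cy.
have ye : ball z e y by split; rewrite /ball/= distrC.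
have cc : cubic c @ y --> cubic c y.
  have f1 : (fun x : R * R => x.1) @ y --> y.1 by exact: cvg_fst.
  have f2 : (fun x : R * R => x.2) @ y --> y.2 by exact: cvg_snd.
  have fX (g : R * R -> R) (l : R) n : g @ y --> l -> (fun x => g x ^+ n) @ y --> l ^+ n.
    move=> gl; elim: n => [|n IH]; first exact: cvg_cst.
    by under eq_fun do rewrite exprS; rewrite exprS; exact: cvgM.
  rewrite /cubic.
  by repeat first [exact: cvg_cst|exact: f1|exact: f2|apply: fX|apply: cvgD|apply: cvgM].
have [a0|a0] := ltP 0 (`|cubic c y| / 2); last by move: a0; rewrite leNgt divr_gt0// normr_gt0.
set a := `|cubic c y| / 2 in a0.
have nc : (fun u => `|cubic c u|) @ y --> `|cubic c y| by exact: cvg_norm.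
have ha : a < `|cubic c y| by rewrite /a ltr_pdivrMr// ltr_pMr ?normr_gt0// ltr1n.
have nrm : \forall u \near y, a < `|cubic c u| := cvgr_gt _ nc _ ha.
have nin : \forall u \near y, interior (cell (Th i)) u.
  by apply: open_nbhs_nbhs; split; [exact: open_interior|exact: ze].
have /nbhs_ballP[h /= h0 hball] : \forall u \near y, a < `|cubic c u| /\ interior (cell (Th i)) u.
  by near=> u; split; near: u; [exact: nrm|exact: nin].
pose B : set plane := ball y h.
have mB : measurable B by exact: measurable_ball_plane.
have BO : B `<=` Omega.
  by move=> u /hball[_]; exact: (interior_cell_domain Omega_polygonal Th_triangulation).
have posB : 0 < \int[leb2]_(x in (Omega : set plane)) (a ^+ 2 * \1_B x).
  rewrite RintegralZl//; last first.
    apply: integrable_bounded; first exact: measurable_indic.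
    by move=> K; exists 1 => u _ _; rewrite indicE; case: (_ \in _); rewrite ?normr1 ?normr0.
  rewrite mulr_gt0 ?exprn_gt0// /Rintegral integral_indic// (setIidl BO).
  have [m1 m2] : measurable (ball y.1 h : set (measurableTypeR R)) /\
      measurable (ball y.2 h : set (measurableTypeR R)).
    by split; apply: open_measurable; exact: ball_open.
  have EB : leb2 B = ((h *+ 2) * (h *+ 2))%:E.
    have -> : B = ball y.1 h `*` ball y.2 h by exact: ball_plane.
    rewrite (@product_measure1E _ _ _ _ _ _ _ _ _ m1 m2) EFinM.
    by congr (_ * _)%E; apply: lebesgue_measure_ball; exact: ltW.
  by rewrite [X in fine X]EB /= mulr_gt0// mulr2n addr_gt0.
have : \int[leb2]_(x in (Omega : set plane)) (a ^+ 2 * \1_B x) <= bip Omega Th w w.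
  apply: le_Rintegral => //.
  - apply: integrable_bounded; first by apply: measurable_funM => //; exact: measurable_indic.
    move=> K; apply: box_boundedM; first exact: box_bounded_cst.
    by exists 1 => u _ _; rewrite indicE; case: (_ \in _); rewrite ?normr1 ?normr0.
  - exact: integrable_broken.
  - move=> u Ou; rewrite indicE; case: (boolP (u \in B)) => [uB|_]; last first.
      by rewrite mulr0 -expr2 sqr_ge0.
    move: uB; rewrite inE => /hball[au ui].
    rewrite mulr1 (broken_fun_interior _ ui) wE -expr2 -[leRHS]real_normK ?num_real//.
    by rewrite ler_pXn2r// ?nnegrE ltW.
by rewrite b0 leNgt posB.
Unshelve. all: by end_near. Qed.

End BrokenInner.

(** * The discrete Stokes complex *)

Section Complex.
Context {R : realType} (Omega : set (R * R)) (N : nat) (Th : 'I_N -> triangle R).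
Hypothesis Omega_polygonal : polygonal_domain Omega.
Hypothesis Omega_sc : simply_connected Omega.
Hypothesis Th_triangulation : triangulation Omega Th.
Implicit Types (a b x y : R * R) (i j : 'I_N) (c d : 'I_N -> nat -> nat -> R).

Let nd i : Defs.nondegenerate (Th i).
Proof. by have [] := Th_triangulation. Qed.

Definition cubics c : broken R N := fun i => cubic (c i).

Lemma Ph_cubics k (w : broken R N) : (k <= 3)%N -> Ph k w ->
  exists c, (forall i, supp k (c i)) /\ w = cubics c.
Proof.
move=> k3 wk; have h i : exists e, supp k e /\ w i = cubic e.
  by have /(PkP _ k3)[e ke we] := wk i; exists e.
have [c cP] := choice h; exists c; split=> [i|]; first exact: (cP i).1.
by apply/funext => i; exact: (cP i).2.
Qed.

Lemma cubics_Ph k c : (k <= 3)%N -> (forall i, supp k (c i)) -> Ph k (cubics c).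
Proof. by move=> k3 ck i; apply/(PkP _ k3); exists (c i). Qed.

Lemma dx_h_cubics c : (forall i, supp 3 (c i)) -> dx_h (cubics c) = cubics (coef_dx \o c).
Proof.
move=> c3; apply/funext => i; apply/funext => x.
by rewrite /dx_h /cubics derive_cubic//= mul1r mul0r addr0.
Qed.

Lemma dy_h_cubics c : (forall i, supp 3 (c i)) -> dy_h (cubics c) = cubics (coef_dy \o c).
Proof.
move=> c3; apply/funext => i; apply/funext => x.
by rewrite /dy_h /cubics derive_cubic//= mul1r mul0r add0r.
Qed.

Definition coef_dn (n : R * R) (e : nat -> nat -> R) :=
  coef_add (coef_scale n.1 (coef_dx e)) (coef_scale n.2 (coef_dy e)).

Lemma dn_h_cubics a b c : (forall i, supp 3 (c i)) ->
  dn_h a b (cubics c) = cubics (coef_dn (unit_normal a b) \o c).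
Proof.
move=> c3; apply/funext => i; apply/funext => x.
by rewrite /dn_h /cubics derive_cubic// /coef_dn/= cubic_add !cubic_scale.
Qed.

(* Uniform description of the jump (s = 1, interior edge) and of the trace
   (s = 0, boundary edge) of a piecewise polynomial as [w i - s * w j]. *)
Definition jump_cells a b i (s : R) j : Prop := edge_of (Th i) a b /\
  ((s = 1 /\ [/\ interior_edge Omega Th a b, edge_of (Th j) a b & i != j]) \/
   (s = 0 /\ boundary_edge Omega Th a b)).

Definition jump a b i (s : R) j c : {poly R} := restr a b (c i) - s%:P * restr a b (c j).

Definition moment1 (q : {poly R}) : Prop := int01 q = 0 /\ int01 ('X * q) = 0.

Lemma moment1_comb (s t : R) (p q : {poly R}) : moment1 p -> moment1 q ->
  moment1 (s%:P * p + t%:P * q).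
Proof.
move=> [p0 p1] [q0 q1]; split; first by rewrite int01D !int01Z p0 q0 !mulr0 addr0.
by rewrite mulrDr !(mulrCA 'X) int01D !int01Z p1 q1 !mulr0 addr0.
Qed.

Lemma edge_neq i a b : edge_of (Th i) a b -> a != b.
Proof. by move=> /edge_vertices[c V]; exact: det3_edge_neq (@nd i) V. Qed.

Lemma jumpE a b i s j c (t : R) :
  (jump a b i s j c).[t] = cubics c i (a + t *: (b - a)) - s * cubics c j (a + t *: (b - a)).
Proof. by rewrite /jump hornerD hornerN hornerCM !restrE. Qed.

Lemma jumps_moment1 a b c :
  ((interior_edge Omega Th a b -> jump_orthogonal Th 1 a b (cubics c)) /\
   (boundary_edge Omega Th a b -> trace_orthogonal Th 1 a b (cubics c))) <->
  forall i s j, jump_cells a b i s j -> moment1 (jump a b i s j c).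
Proof.
split=> [[Hi Hb] i s j [ei]|H].
  have ab := edge_neq ei; move=> [[-> [ie ej ij]]|[-> be]].
    apply/(edge_moment1P (f := fun x => cubics c i x - cubics c j x) ab).
      by move=> t; rewrite jumpE mul1r.
    by move=> p pP; exact: Hi.
  apply/(edge_moment1P (f := cubics c i) ab); first by move=> t; rewrite jumpE mul0r subr0.
  by move=> p pP; exact: Hb.
split=> [ie p i j pP ei ej ij|be p i pP ei].
  have jc : jump_cells a b i 1 j by split=> //; left.
  move: p pP; apply/(edge_moment1P (G := jump a b i 1 j c) (edge_neq ei)); last exact: H.
  by move=> t; rewrite jumpE mul1r.
have jc : jump_cells a b i 0 i by split=> //; right.
move: p pP; apply/(edge_moment1P (G := jump a b i 0 i c) (edge_neq ei)); last exact: H.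
by move=> t; rewrite jumpE mul0r subr0.
Qed.

Lemma jumps_moment0 a b c :
  ((interior_edge Omega Th a b -> jump_orthogonal Th 0 a b (cubics c)) /\
   (boundary_edge Omega Th a b -> trace_orthogonal Th 0 a b (cubics c))) <->
  forall i s j, jump_cells a b i s j -> int01 (jump a b i s j c) = 0.
Proof.
split=> [[Hi Hb] i s j [ei]|H].
  have ab := edge_neq ei; move=> [[-> [ie ej ij]]|[-> be]].
    apply/(edge_moment0P (f := fun x => cubics c i x - cubics c j x) ab).
      by move=> t; rewrite jumpE mul1r.
    by move=> p pP; exact: Hi.
  apply/(edge_moment0P (f := cubics c i) ab); first by move=> t; rewrite jumpE mul0r subr0.
  by move=> p pP; exact: Hb.
split=> [ie p i j pP ei ej ij|be p i pP ei].
  have jc : jump_cells a b i 1 j by split=> //; left.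
  move: p pP; apply/(edge_moment0P (G := jump a b i 1 j c) (edge_neq ei)); last exact: H.
  by move=> t; rewrite jumpE mul1r.
have jc : jump_cells a b i 0 i by split=> //; right.
move: p pP; apply/(edge_moment0P (G := jump a b i 0 i c) (edge_neq ei)); last exact: H.
by move=> t; rewrite jumpE mul0r subr0.
Qed.

Lemma G2h0P c d : (forall i, supp 2 (c i)) -> (forall i, supp 2 (d i)) ->
  G2h0 Omega Th (cubics c, cubics d) <->
  forall a b i s j, jump_cells a b i s j ->
    moment1 (jump a b i s j c) /\ moment1 (jump a b i s j d).
Proof.
move=> c2 d2; split=> [[_ _ Hi Hb] a b i s j jc|H].
  by split; move: i s j jc; apply/jumps_moment1; split=> h;
    first [exact: (Hi _ _ h).1|exact: (Hb _ _ h).1|exact: (Hi _ _ h).2|exact: (Hb _ _ h).2].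
have Hc a b := (jumps_moment1 a b c).2 (fun i s j jc => (H a b i s j jc).1).
have Hd a b := (jumps_moment1 a b d).2 (fun i s j jc => (H a b i s j jc).2).
split; [exact: cubics_Ph|exact: cubics_Ph|move=> a b h|move=> a b h].
  by split; [exact: (Hc a b).1|exact: (Hd a b).1].
by split; [exact: (Hc a b).2|exact: (Hd a b).2].
Qed.

Lemma B3h0P c : (forall i, supp 3 (c i)) ->
  B3h0 Omega Th (cubics c) <->
  [/\ vertex_continuous Th (cubics c), vertex_zero Omega Th (cubics c) &
    forall a b i s j, jump_cells a b i s j -> int01 (jump a b i s j c) = 0 /\
      moment1 (jump a b i s j (coef_dn (unit_normal a b) \o c))].
Proof.
move=> c3; split=> [[[_ vc Hi] vz Hb]|[vc vz H]].
  split=> // a b i s j jc; split; move: i s j jc.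
    by apply/jumps_moment0; split=> h; [exact: (Hi _ _ h).1|exact: (Hb _ _ h).1].
  apply/jumps_moment1; rewrite -dn_h_cubics//.
  by split=> h; [exact: (Hi _ _ h).2|exact: (Hb _ _ h).2].
have H0 a b := (jumps_moment0 a b c).2 (fun i s j jc => (H a b i s j jc).1).
have H1 a b := (jumps_moment1 a b _).2 (fun i s j jc => (H a b i s j jc).2).
split=> //; [split=> //; first exact: cubics_Ph|] => a b h; rewrite dn_h_cubics//.
  by split; [exact: (H0 a b).1|exact: (H1 a b).1].
by split; [exact: (H0 a b).2|exact: (H1 a b).2].
Qed.

Lemma jump_comb a b i s j (u v : R) c d :
  jump a b i s j (fun i => coef_add (coef_scale u (c i)) (coef_scale v (d i))) =
  u%:P * jump a b i s j c + v%:P * jump a b i s j d.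
Proof.
rewrite /jump /restr /subst_cubic /coef_add /coef_scale !(polyCD, polyCM).
by ring.
Qed.

Lemma deriv_jump a b i s j c : (forall i, supp 3 (c i)) ->
  (jump a b i s j c)^`() = (b.1 - a.1)%:P * jump a b i s j (coef_dx \o c) +
    (b.2 - a.2)%:P * jump a b i s j (coef_dy \o c).
Proof.
by move=> c3; rewrite /jump derivB derivM derivC mul0r add0r !deriv_restr//=; ring.
Qed.

Lemma int01C (s : R) : int01 s%:P = s.
Proof.
have i1 : int01 (1 : {poly R}) = 1.
  by have := int01_deriv ('X : {poly R}); rewrite derivX !hornerX subr0.
by rewrite -[s%:P]mulr1 int01Z i1 mulr1.
Qed.

Lemma int01X : int01 ('X : {poly R}) = 1 / 2.
Proof. by have := int01_Xderiv ('X : {poly R}); rewrite derivX mulr1 hornerX; lra. Qed.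

(** Adding the rotation (kappa / 2) (y, - x) cancels the constant kappa and leaves a field with zero
    rot, integrated coefficient by coefficient. *)
Lemma potential (f g : nat -> nat -> R) (kappa : R) : supp 2 f -> supp 2 g ->
  (forall x, cubic (coef_dx g) x - cubic (coef_dy f) x = kappa) ->
  exists e, [/\ supp 3 e, forall x, cubic (coef_dx e) x = cubic f x + kappa / 2 * x.2 &
    forall x, cubic (coef_dy e) x = cubic g x - kappa / 2 * x.1].
Proof.
move=> f2 g2 H.
have f0 : [/\ f 3%N 0%N = 0, f 2%N 1%N = 0, f 1%N 2%N = 0 & f 0%N 3%N = 0].
  by rewrite !f2.
have g0 : [/\ g 3%N 0%N = 0, g 2%N 1%N = 0, g 1%N 2%N = 0 & g 0%N 3%N = 0].
  by rewrite !g2.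
case: f0 => f30 f21 f12 f03; case: g0 => g30 g21 g12 g03.
(* The rot of a quadratic field is affine, so three points determine its coefficients. *)
have E0 := H (0, 0); have E1 := H (1, 0); have E2 := H (0, 1).
have E3 : [/\ g 1%N 0%N = f 0%N 1%N + kappa, 2 * g 2%N 0%N = f 1%N 1%N &
    g 1%N 1%N = 2 * f 0%N 2%N].
  have Z (h : nat -> nat -> R) k l : supp 2 h -> (2 < k + l)%N -> h k l = 0 by move=> h2 /h2.
  move: E0 E1 E2; rewrite /cubic /coef_dx /coef_dy/=.
  rewrite f21 f12 f03 g30 g21 g12 (Z f 0 4)%N// (Z f 1 3)%N// (Z f 2 2)%N// (Z f 3 1)%N//.
  rewrite (Z g 4 0)%N// (Z g 3 1)%N// (Z g 2 2)%N// (Z g 1 3)%N//.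
  by move=> E0 E1 E2; split; lra.
case: E3 => g10 g20 g11.
exists (fun k l : nat => match k, l with
  | 1%N, 0%N => f 0%N 0%N | 0%N, 1%N => g 0%N 0%N
  | 2%N, 0%N => f 1%N 0%N / 2 | 1%N, 1%N => f 0%N 1%N + kappa / 2 | 0%N, 2%N => g 0%N 1%N / 2
  | 3%N, 0%N => f 2%N 0%N / 3 | 2%N, 1%N => f 1%N 1%N / 2 | 1%N, 2%N => f 0%N 2%N
  | 0%N, 3%N => g 0%N 2%N / 3 | _, _ => 0 end); split.
- by move=> [|[|[|[|i]]]] [|[|[|[|j]]]].
- by move=> x; rewrite /cubic /coef_dx/= f30 f21 f12 f03; field.
- move=> x; rewrite /cubic /coef_dy/= g30 g21 g12 g03.
  have -> : g 2%N 0%N = f 1%N 1%N / 2 by lra.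
  by rewrite g10 g11; field.
Qed.

Definition circulation a b (f g : nat -> nat -> R) : R :=
  (b.1 - a.1) * int01 (restr a b f) + (b.2 - a.2) * int01 (restr a b g).

(** The correction is kappa times the signed area of the triangle formed by the origin, a and b;
    around a cell these areas add up to that of the cell. *)
Lemma circulation_potential a b (e f g : nat -> nat -> R) (kappa : R) : supp 3 e ->
  (forall x, cubic (coef_dx e) x = cubic f x + kappa / 2 * x.2) ->
  (forall x, cubic (coef_dy e) x = cubic g x - kappa / 2 * x.1) ->
  circulation a b f g = cubic e b - cubic e a + kappa / 2 * cross a b.
Proof.
move=> e3 ex ey; have := int01_deriv (restr a b e); rewrite restr0 restr1 deriv_restr// => <-.
rewrite (@eq_int01 _ _ ((b.1 - a.1)%:P * (restr a b f + (kappa / 2)%:P *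
    (a.2%:P + (b.2 - a.2)%:P * 'X)) + (b.2 - a.2)%:P * (restr a b g +
    (- (kappa / 2))%:P * (a.1%:P + (b.1 - a.1)%:P * 'X)))); last first.
  move=> t; rewrite !(hornerD, hornerCM, hornerC, hornerX, restrE) ex ey.
  have E1 : (a + t *: (b - a)).1 = a.1 + t * (b.1 - a.1) by [].
  have E2 : (a + t *: (b - a)).2 = a.2 + t * (b.2 - a.2) by [].
  by rewrite E1 E2; ring.
rewrite /circulation; generalize (restr a b f) (restr a b g) => F G.
by rewrite !(int01D, int01Z, int01C, int01X) /cross; field.
Qed.

Section Fields.
Variables c d : 'I_N -> nat -> nat -> R.
Hypothesis c2 : forall i, supp 2 (c i).
Hypothesis d2 : forall i, supp 2 (d i).
Hypothesis cd_G : G2h0 Omega Th (cubics c, cubics d).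
Variable kappa : R.
Hypothesis rot_cst : forall i x, cubic (coef_dx (d i)) x - cubic (coef_dy (c i)) x = kappa.

Lemma circulation_edge i j a b : edge_of (Th i) a b -> edge_of (Th j) a b ->
  circulation a b (c i) (d i) = circulation a b (c j) (d j) /\
  (segm a b `<=` frontier Omega -> circulation a b (c i) (d i) = 0).
Proof.
move=> ei ej; have H := (G2h0P c2 d2).1 cd_G.
have E k s l : jump_cells a b k s l ->
    circulation a b (c k) (d k) = s * circulation a b (c l) (d l).
  move=> /H[[+ _] [+ _]]; rewrite /jump !int01B !int01Z => hc hd.
  rewrite /circulation; have -> : int01 (restr a b (c k)) = s * int01 (restr a b (c l)) by lra.
  have -> : int01 (restr a b (d k)) = s * int01 (restr a b (d l)) by lra.
  by ring.
have B k : edge_of (Th k) a b -> segm a b `<=` frontier Omega ->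
    circulation a b (c k) (d k) = 0.
  move=> ek f; rewrite (E k 0 k) ?mul0r//; split=> //; right; split=> //.
  by split=> //; exists k.
split; last exact: B.
have [->//|ij] := eqVneq i j.
have [f|nf] := pselect (segm a b `<=` frontier Omega); first by rewrite !B.
rewrite (E i 1 j) ?mul1r//; split=> //; left; split=> //; split=> //.
by split=> //; exists i.
Qed.

(** Zero off the mesh edges, so that antisymmetry holds for all pairs of points. The constant kappa
    is kept general: the cochain serves first to prove kappa = 0, then to build the potential. *)
Lemma edge_cochain : exists om : R * R -> R * R -> R,
  [/\ forall a b, om b a = - om a b,
    forall i a b, edge_of (Th i) a b -> om a b = circulation a b (c i) (d i) &
    forall i a b, edge_of (Th i) a b -> segm a b `<=` frontier Omega -> om a b = 0].
Proof.
have h a b : exists r : R, (forall i, edge_of (Th i) a b -> r = circulation a b (c i) (d i)) /\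
    ((forall i, ~ edge_of (Th i) a b) -> r = 0).
  have [[i ei]|ne] := pselect (exists i, edge_of (Th i) a b).
    exists (circulation a b (c i) (d i)); split=> [j ej|/(_ i)//].
    exact: (circulation_edge ei ej).1.
  by exists 0; split=> // i ei; exfalso; apply: ne; exists i.
have [om' omP'] := choice (fun p : (R * R) * (R * R) => h p.1 p.2).
have [om omP] : exists om : R * R -> R * R -> R, forall a b,
    (forall i, edge_of (Th i) a b -> om a b = circulation a b (c i) (d i)) /\
    ((forall i, ~ edge_of (Th i) a b) -> om a b = 0).
  by exists (fun a b => om' (a, b)) => a b; exact: omP' (a, b).
have omE i a b : edge_of (Th i) a b -> om a b = circulation a b (c i) (d i).
  by move=> ei; exact: (omP a b).1.
exists om; split=> // [a b|i a b ei f]; last first.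
  by rewrite (omE i)//; exact: (circulation_edge ei ei).2.
have [[i ei]|ne] := pselect (exists i, edge_of (Th i) a b).
  have [e [e3 ex ey]] := potential (c2 i) (d2 i) (rot_cst i).
  rewrite (omE i _ _ ei) (omE i _ _ (edge_sym ei)) !(circulation_potential _ _ e3 ex ey).
  by rewrite /cross; ring.
rewrite (omP a b).2 => [|i ei]; last by apply: ne; exists i.
rewrite (omP b a).2 ?oppr0// => i ei; apply: ne; exists i.
exact: edge_sym.
Qed.

(** The doubled, oriented circulation around a cell is kappa times twice its area; the total is
    zero, and the areas are positive. *)
Lemma rot_cst_eq0 : (exists i : 'I_N, True) -> kappa = 0.
Proof.
move=> [i0 _]; have [om [omC omE om0]] := edge_cochain.
have h i : exists A : R, 0 < A /\
    \sum_k \sum_l side (Th i) (Th i k) (Th i l) * om (Th i k) (Th i l) = kappa * A.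
  have [p [q [z V]]] := cell_triple (Th i).
  exists `|det3 p q z|; split; first by rewrite normr_gt0; exact: nondegenerate_det3 (@nd i) V.
  rewrite (cell_circulation omC V).
  have [e [e3 ex ey]] := potential (c2 i) (d2 i) (rot_cst i).
  rewrite (omE i _ _ (vertices_edge V)) (omE i _ _ (vertices_edge (vertices_rot V))).
  rewrite (omE i _ _ (vertices_edge (vertices_rot (vertices_rot V)))).
  rewrite !(circulation_potential _ _ e3 ex ey) [in RHS]normrEsg.
  transitivity (kappa * (Num.sg (det3 p q z) * (cross p q + cross q z + cross z p))).
    by field.
  by congr (_ * (_ * _)); rewrite /det3 /cross/=; ring.
have [A AP] := choice h.
have := sum_circulation Omega_polygonal Th_triangulation om0.
under eq_bigr do rewrite (AP _).2.
rewrite -mulr_sumr => /eqP; rewrite mulf_eq0 => /orP[/eqP//|/eqP A0].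
have : 0 < \sum_i A i.
  by rewrite (bigD1 i0)//= ltr_pwDl ?(AP i0).1// sumr_ge0// => i _; exact: ltW (AP i).1.
by rewrite A0 ltxx.
Qed.

End Fields.

Lemma stokes_exact c d : (forall i, supp 2 (c i)) -> (forall i, supp 2 (d i)) ->
  G2h0 Omega Th (cubics c, cubics d) ->
  (forall i x, cubic (coef_dx (d i)) x - cubic (coef_dy (c i)) x = 0) ->
  exists e, [/\ forall i, supp 3 (e i), B3h0 Omega Th (cubics e) &
    grad_h (cubics e) = (cubics c, cubics d)].
Proof.
move=> c2 d2 cdG rot0.
have [om [omC omE om0]] := edge_cochain c2 d2 cdG rot0.
have pe i : exists e, [/\ supp 3 e, forall x, cubic (coef_dx e) x = cubic (c i) x &
    forall x, cubic (coef_dy e) x = cubic (d i) x].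
  have [e [e3 ex ey]] := potential (c2 i) (d2 i) (rot0 i).
  by exists e; split=> // x; rewrite ?ex ?ey !mul0r ?addr0 ?subr0.
have [e eP] := choice pe.
have om_e i a b : edge_of (Th i) a b -> om a b = cubic (e i) b - cubic (e i) a.
  move=> ei; have [e3 ex ey] := eP i.
  rewrite (omE i)// (@circulation_potential _ _ (e i) _ _ 0) ?mul0r ?addr0//.
    by move=> x; rewrite ex !mul0r addr0.
  by move=> x; rewrite ey !mul0r subr0.
have [W [W0 WE]] : exists W : R * R -> R, (forall a, frontier Omega a -> W a = 0) /\
    forall i a b, edge_of (Th i) a b -> om a b = W b - W a.
  apply: (cochain_exact Omega_polygonal Omega_sc Th_triangulation omC) om0 => i p q z V.
  rewrite (om_e i _ _ (vertices_edge V)) (om_e i _ _ (vertices_edge (vertices_rot V))).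
  by rewrite (om_e i _ _ (vertices_edge (vertices_rot (vertices_rot V)))); ring.
pose cst (s : R) : nat -> nat -> R := fun k l : nat => match k, l with 0%N, 0%N => s | _, _ => 0 end.
(* The free constant of each cell is fixed at its first vertex; the other two vertices then agree
   with W because the edge differences do. *)
pose e' i := coef_add (e i) (cst (W (Th i ord0) - cubic (e i) (Th i ord0))).
have e'E i x : cubic (e' i) x = cubic (e i) x + (W (Th i ord0) - cubic (e i) (Th i ord0)).
  by rewrite /e' cubic_add /cubic /cst/=; ring.
have e'3 i : supp 3 (e' i).
  by apply: supp_add; [have [] := eP i|move=> [|k] [|l]].
have e'W i a : vertex_of (Th i) a -> cubic (e' i) a = W a.
  move=> va; rewrite e'E; have [->|a0] := eqVneq a (Th i ord0); first by ring.
  have ea : edge_of (Th i) (Th i ord0) a.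
    by move: va a0 => [k <-] k0; exists ord0, k; split=> //; apply: contraNneq k0 => <-.
  by have := WE i _ _ ea; rewrite (om_e i _ _ ea); lra.
have dxe : coef_dx \o e' = coef_dx \o e.
  apply/funext => i; apply/funext => k; apply/funext => l.
  by rewrite /= /coef_dx /e' /coef_add /cst/= addr0.
have dye : coef_dy \o e' = coef_dy \o e.
  apply/funext => i; apply/funext => k; apply/funext => l.
  by rewrite /= /coef_dy /e' /coef_add /cst; case: k => [|k]; rewrite addr0.
have gE : grad_h (cubics e') = (cubics c, cubics d).
  rewrite /grad_h dx_h_cubics// dy_h_cubics// dxe dye; congr pair.
    by apply/funext => i; apply/funext => x; have [_ ex _] := eP i; exact: ex.
  by apply/funext => i; apply/funext => x; have [_ _ ey] := eP i; exact: ey.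
exists e'; split=> //; apply/(B3h0P e'3); split.
- by move=> a i j ai aj; rewrite /cubics !e'W.
- by move=> a i [_ fa] ai; rewrite /cubics e'W// W0.
move=> a b i s j jc; have [Mc Md] := (G2h0P c2 d2).1 cdG a b i s j jc.
have cE t : (jump a b i s j (coef_dx \o e')).[t] = (jump a b i s j c).[t].
  rewrite !jumpE; have := congr1 fst gE; rewrite /= dx_h_cubics// => E.
  by rewrite E.
have dE t : (jump a b i s j (coef_dy \o e')).[t] = (jump a b i s j d).[t].
  rewrite !jumpE; have := congr1 snd gE; rewrite /= dy_h_cubics// => E.
  by rewrite E.
have mE (p q : {poly R}) : (forall t, p.[t] = q.[t]) -> moment1 q -> moment1 p.
  move=> pq [q0 q1]; split; first by rewrite (eq_int01 pq).
  by rewrite (@eq_int01 _ _ ('X * q))// => t; rewrite !hornerM pq.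
have Mx := mE _ _ cE Mc; have My := mE _ _ dE Md.
split; last by rewrite jump_comb; exact: moment1_comb.
(* Along the edge the derivative of the jump combines the jumps of the two components. Integration
   by parts identifies the mean of the jump with its value at b, which is zero by the choice of
   vertex values. *)
have [D0 D1] : moment1 (jump a b i s j e')^`().
  by rewrite deriv_jump//; exact: moment1_comb.
rewrite int01_Xderiv in D1.
have -> : int01 (jump a b i s j e') = (jump a b i s j e').[1] by lra.
have bE : a + 1 *: (b - a) = b by rewrite scale1r addrC subrK.
rewrite jumpE bE; case: jc => ei [[-> [_ ej _]]|[-> [_ f]]].
  by rewrite /cubics !e'W ?mul1r ?subrr//; have [] := edge_vertex ei; have [] := edge_vertex ej.
rewrite mul0r subr0 /cubics e'W; last by have [] := edge_vertex ei.
by apply: W0; apply: f; exact: segm_right.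
Qed.

End Complex.

(** * Uniqueness and the decoupled scheme *)

Section Scheme.
Context {R : realType} (Omega : set (R * R)) (N : nat) (Th : 'I_N -> triangle R).
Hypothesis Omega_polygonal : polygonal_domain Omega.
Hypothesis Omega_sc : simply_connected Omega.
Hypothesis Th_triangulation : triangulation Omega Th.
Implicit Types (a b x y : R * R) (i j : 'I_N) (c d e f : 'I_N -> nat -> nat -> R).

Lemma moment1_solve (u v u' v' : R) (p q : {poly R}) : u * v' - v * u' != 0 ->
  moment1 (u%:P * p + v%:P * q) -> moment1 (u'%:P * p + v'%:P * q) -> moment1 p /\ moment1 q.
Proof.
move=> D0 [h0 h1] [h0' h1'].
rewrite !mulrDr !(mulrCA 'X) in h1 h1'.
rewrite !int01D !int01Z in h0 h1 h0' h1'.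
have solve (A B : R) : u * A + v * B = 0 -> u' * A + v' * B = 0 -> A = 0 /\ B = 0.
  move=> E E'; split; apply: (mulfI D0); rewrite mulr0.
    transitivity (v' * (u * A + v * B) - v * (u' * A + v' * B)); first by ring.
    by rewrite E E' !mulr0 subrr.
  transitivity (u * (u' * A + v' * B) - u' * (u * A + v * B)); first by ring.
  by rewrite E E' !mulr0 subrr.
by have [p0 q0] := solve _ _ h0 h0'; have [p1 q1] := solve _ _ h1 h1'.
Qed.

(** Vertex values and edge means control the affine moments of the tangential derivative, the
    definition of B those of the normal one; a linear system of order two recovers both partial
    derivatives. *)
Lemma grad_B3h0 e : (forall i, supp 3 (e i)) -> B3h0 Omega Th (cubics e) ->
  G2h0 Omega Th (grad_h (cubics e)).
Proof.
move=> e3 /(B3h0P Th_triangulation e3)[vc vz H].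
rewrite /grad_h dx_h_cubics// dy_h_cubics//.
apply/(G2h0P Th_triangulation); [by move=> i; exact: supp_dx|by move=> i; exact: supp_dy|].
move=> a b i s j jc; have [J0 Jn] := H a b i s j jc.
rewrite jump_comb in Jn.
have bE : a + 1 *: (b - a) = b by rewrite scale1r addrC subrK.
have [ei _] := jc; have ab := edge_neq Th_triangulation ei.
have [Va Vb] := edge_vertex ei.
have bv z : segm a b `<=` frontier Omega -> segm a b z -> vertex_of (Th i) z ->
    boundary_vertex Omega Th z.
  by move=> ff sz Vz; split; [exists i|exact: ff].
have ends : (jump a b i s j e).[0] = 0 /\ (jump a b i s j e).[1] = 0.
  rewrite !jumpE bE scale0r addr0; case: jc => _ [[-> [_ ej _]]|[-> [_ ff]]].
    have [Wa Wb] := edge_vertex ej.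
    by rewrite !mul1r (vc a i j)// (vc b i j)// !subrr.
  rewrite !mul0r !subr0 !vz//; first by apply: (bv b ff) => //; exact: segm_right.
  by apply: (bv a ff) => //; exact: segm_left.
have Jt : moment1 (jump a b i s j e)^`().
  by split; rewrite ?int01_deriv ?int01_Xderiv ?J0 ?ends.1 ?ends.2 subrr.
rewrite deriv_jump// in Jt.
apply: (moment1_solve _ Jt Jn).
have l0 : enorm (b - a) != 0 by rewrite enorm_eq0 subr_eq0 eq_sym.
(* Determinant of the tangent b - a against the unit normal. *)
rewrite (_ : _ - _ = - enorm (b - a)) ?oppr_eq0//.
rewrite /unit_normal/=/GRing.scale/=.
transitivity (- ((enorm (b - a))^-1 * ((b.1 - a.1) ^+ 2 + (b.2 - a.2) ^+ 2))); first by ring.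
by rewrite -[X in _ * X](sqr_enorm (b - a)) expr2 mulKf.
Qed.

Lemma rot_grad e : (forall i, supp 3 (e i)) -> rot_h (grad_h (cubics e)) = fun _ _ => 0.
Proof.
move=> e3; have h k l (g : nat -> nat -> R) : supp k.+1 g -> (k.+1 <= l)%N ->
    supp l (coef_dx g) /\ supp l (coef_dy g).
  by move=> gk kl; split; apply: (supp_le (ltnW kl)); [exact: supp_dx|exact: supp_dy].
rewrite /rot_h /grad_h/= !(dx_h_cubics, dy_h_cubics)//; last 2 first.
- by move=> i; exact: (h 2 3 _ (e3 i) isT).1.
- by move=> i; exact: (h 2 3 _ (e3 i) isT).2.
apply/funext => i; apply/funext => x; rewrite /cubics/=.
rewrite (_ : coef_dx (coef_dy (e i)) = coef_dy (coef_dx (e i))) ?subrr//.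
by apply/funext => k; apply/funext => l; rewrite /coef_dx /coef_dy mulrCA.
Qed.

(** Apply [exposed_edge] to the cells where the constant is nonzero: beyond the exposed edge lies
    the boundary or a cell with constant 0, and a vertex of the edge transmits the value 0. *)
Lemma flat_eq0 e : (forall i, supp 3 (e i)) -> vertex_continuous Th (cubics e) ->
  vertex_zero Omega Th (cubics e) ->
  (forall i x, cubic (coef_dx (e i)) x = 0) -> (forall i x, cubic (coef_dy (e i)) x = 0) ->
  forall i x, cubic (e i) x = 0.
Proof.
move=> e3 vc vz ex ey i0 x0; apply/eqP/negPn/negP => n0.
have cst i x y : cubic (e i) x = cubic (e i) y by exact: gradient0_cst.
have [|i [a [b [[z Sz] ei uniq]]]] := exposed_edge Th_triangulation
  (S := fun i => exists x, cubic (e i) x != 0); first by exists i0, x0.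
have [Va _] := edge_vertex ei.
move: Sz; rewrite (cst i z a); apply/negP/negPn/eqP.
have [ff|nf] := pselect (segm a b `<=` frontier Omega).
  by apply: (vz a i) => //; split; [exists i|apply: ff; exact: segm_left].
have [j [_ [ji ej _ _]]] := edge_neighbour Omega_polygonal Th_triangulation ei nf.
have [Wa _] := edge_vertex ej.
rewrite -/(cubics e i a) (vc a i j)//; apply/eqP/negPn/negP => Sj.
by move: ji; rewrite (uniq j) ?eqxx//; exists a.
Qed.

(** The same argument with edge means in place of vertex values: for cellwise constant fields the
    mean of the jump is the jump itself. *)
Lemma flat_grad_eq0 c d : (forall i, supp 2 (c i)) -> (forall i, supp 2 (d i)) ->
  G2h0 Omega Th (cubics c, cubics d) ->
  (forall i x y, cubic (c i) x = cubic (c i) y) -> (forall i x y, cubic (d i) x = cubic (d i) y) ->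
  forall i x, cubic (c i) x = 0 /\ cubic (d i) x = 0.
Proof.
move=> c2 d2 /(G2h0P Th_triangulation c2 d2) H cc cd i0 x0; apply: contrapT => n0.
have [|i [a [b [[z Sz] ei uniq]]]] := exposed_edge Th_triangulation
  (S := fun i => exists x, ~ (cubic (c i) x = 0 /\ cubic (d i) x = 0)); first by exists i0, x0.
apply: Sz; rewrite (cc i z a) (cd i z a).
have J0 s j g : (forall i x y, cubic (g i) x = cubic (g i) y) -> s * cubic (g j) a = 0 ->
    int01 (jump a b i s j g) = 0 -> cubic (g i) a = 0.
  move=> cg sg; rewrite (@eq_int01 _ _ (cubic (g i) a)%:P) ?int01C// => t.
  by rewrite jumpE hornerC /cubics (cg i _ a) (cg j _ a) sg subr0.
have [ff|nf] := pselect (segm a b `<=` frontier Omega).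
  have [|[hc _] [hd _]] := H a b i 0 i.
    by split=> //; right; split=> //; split=> //; exists i.
  by split; [apply: (J0 0 i c)|apply: (J0 0 i d)] => //; rewrite mul0r.
have [j [_ [ji ej _ _]]] := edge_neighbour Omega_polygonal Th_triangulation ei nf.
have [|[hc _] [hd _]] := H a b i 1 j.
  split=> //; left; split=> //; split=> //; last by rewrite eq_sym.
  by split=> //; exists i.
have [cj dj] : cubic (c j) a = 0 /\ cubic (d j) a = 0.
  by apply: contrapT => Sj; move: ji; rewrite (uniq j) ?eqxx//; exists a.
by split; [apply: (J0 1 j c)|apply: (J0 1 j d)] => //; rewrite mul1r.
Qed.

(** The scalings by 1 and -1 give this the shape of [jump_comb]. *)
Definition coef_sub e f : 'I_N -> nat -> nat -> R :=
  fun i => coef_add (coef_scale 1 (e i)) (coef_scale (-1) (f i)).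

Lemma cubics_sub e f : cubics (coef_sub e f) = fun i x => cubics e i x - cubics f i x.
Proof.
apply/funext => i; apply/funext => x.
by rewrite /cubics /coef_sub cubic_add !cubic_scale mul1r mulN1r.
Qed.

Lemma supp_sub k e f : (forall i, supp k (e i)) -> (forall i, supp k (f i)) ->
  forall i, supp k (coef_sub e f i).
Proof. by move=> ek fk i; apply: supp_add; apply: supp_scale. Qed.

Lemma dx_sub e f : coef_dx \o coef_sub e f = coef_sub (coef_dx \o e) (coef_dx \o f).
Proof.
apply/funext => i; apply/funext => k; apply/funext => l.
by rewrite /= /coef_sub /coef_dx /coef_add /coef_scale/=; ring.
Qed.

Lemma dy_sub e f : coef_dy \o coef_sub e f = coef_sub (coef_dy \o e) (coef_dy \o f).
Proof.
apply/funext => i; apply/funext => k; apply/funext => l.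
by rewrite /= /coef_sub /coef_dy /coef_add /coef_scale/=; ring.
Qed.

Lemma A3h0_sub e f : (forall i, supp 3 (e i)) -> (forall i, supp 3 (f i)) ->
  A3h0 Omega Th (cubics e) -> A3h0 Omega Th (cubics f) ->
  A3h0 Omega Th (cubics (coef_sub e f)).
Proof.
move=> e3 f3 [_ ve ze] [_ vf zf]; split.
- by apply: cubics_Ph => //; exact: supp_sub.
- by move=> a i j ai aj; rewrite cubics_sub (ve a i j)// (vf a i j).
- by move=> a i ba ai; rewrite cubics_sub (ze a i)// (zf a i)// subrr.
Qed.

Lemma B3h0_A3h0 (w : broken R N) : B3h0 Omega Th w -> A3h0 Omega Th w.
Proof. by move=> [[w3 vc _] vz _]. Qed.

Lemma B3h0_sub e f : (forall i, supp 3 (e i)) -> (forall i, supp 3 (f i)) ->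
  B3h0 Omega Th (cubics e) -> B3h0 Omega Th (cubics f) ->
  B3h0 Omega Th (cubics (coef_sub e f)).
Proof.
move=> e3 f3 Be Bf; have [_ vc vz] := A3h0_sub e3 f3 (B3h0_A3h0 Be) (B3h0_A3h0 Bf).
have [_ _ He] := (B3h0P Th_triangulation e3).1 Be.
have [_ _ Hf] := (B3h0P Th_triangulation f3).1 Bf.
apply/(B3h0P Th_triangulation (supp_sub e3 f3)); split=> // a b i s j jc.
have [e0 e1] := He a b i s j jc; have [f0 f1] := Hf a b i s j jc; split.
  by rewrite jump_comb int01D !int01Z e0 f0 !mulr0 addr0.
set n := unit_normal a b in e1 f1 *.
have -> : coef_dn n \o coef_sub e f = coef_sub (coef_dn n \o e) (coef_dn n \o f).
  apply/funext => k; apply/funext => l; apply/funext => m.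
  by rewrite /= /coef_sub /coef_dn /coef_dx /coef_dy /coef_add /coef_scale/=; ring.
by rewrite jump_comb; exact: moment1_comb.
Qed.

Lemma vbip_sub c d c' d' c'' d'' :
  (forall i, supp 3 (c i)) -> (forall i, supp 3 (d i)) ->
  (forall i, supp 3 (c' i)) -> (forall i, supp 3 (d' i)) ->
  (forall i, supp 3 (c'' i)) -> (forall i, supp 3 (d'' i)) ->
  vbip Omega Th (cubics (coef_sub c c'), cubics (coef_sub d d')) (cubics c'', cubics d'') =
  vbip Omega Th (cubics c, cubics d) (cubics c'', cubics d'') -
  vbip Omega Th (cubics c', cubics d') (cubics c'', cubics d'').
Proof.
move=> c3 d3 c'3 d'3 c''3 d''3; have P k : (forall i, supp 3 (k i)) -> Ph 3 (cubics k).
  by move=> k3; exact: cubics_Ph.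
rewrite /vbip/= !cubics_sub !bipB//; try exact: P.
by ring.
Qed.

Lemma vbip_eq0 c d : (forall i, supp 3 (c i)) -> (forall i, supp 3 (d i)) ->
  vbip Omega Th (cubics c, cubics d) (cubics c, cubics d) = 0 ->
  forall i x, cubic (c i) x = 0 /\ cubic (d i) x = 0.
Proof.
move=> c3 d3; rewrite /vbip/= => /eqP; rewrite paddr_eq0 ?bip_ge0// => /andP[/eqP hc /eqP hd] i x.
split.
  exact: (bip_eq0 Omega_polygonal Th_triangulation i x (cubics_Ph (leqnn 3) c3) hc).
exact: (bip_eq0 Omega_polygonal Th_triangulation i x (cubics_Ph (leqnn 3) d3) hd).
Qed.

(** Subtract from rho its mean kappa: the remainder q has mean zero, so it is orthogonal to rho by
    hypothesis and to constants, hence to itself. *)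
Lemma rot_mean_free (rho : broken R N) : Ph 1 rho ->
  (forall q, Ph0 Omega Th 1 q -> bip Omega Th q rho = 0) ->
  exists kappa, forall i x, rho i x = kappa.
Proof.
move=> rho1 H; have P3 (w : broken R N) : Ph 1 w -> Ph 3 w by move=> w1 i; exact: (Pk_le (k := 1)).
have one1 : Ph 1 ((fun _ _ => 1) : broken R N) by move=> i; exact: Pk_cst.
have [[i0 _]|no] := pselect (exists i : 'I_N, True); last first.
  by exists 0 => i; exfalso; apply: no; exists i.
set mu := bip Omega Th (fun _ _ => 1) (fun _ _ => 1).
have mu0 : mu != 0.
  apply/eqP => mu0; have := bip_eq0 Omega_polygonal Th_triangulation i0 (0, 0) (P3 _ one1) mu0.
  by move/eqP; rewrite oner_eq0.
pose kappa := bip Omega Th rho (fun _ _ => 1) / mu.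
have kap1 : Ph 1 ((fun _ _ => kappa * 1) : broken R N).
  by move=> i; apply: Pk_scale => //; exact: one1.
pose q : broken R N := fun i x => rho i x - kappa * 1.
have q1 : Ph 1 q by move=> i; exact: Pk_sub (rho1 i) (kap1 i).
have q_one : bip Omega Th q (fun _ _ => 1) = 0.
  rewrite (bipB Th Omega_polygonal (P3 _ rho1) (P3 _ kap1) (P3 _ one1)).
  rewrite (bipZ Th Omega_polygonal kappa (P3 _ one1) (P3 _ one1)).
  by rewrite /kappa divfK// subrr.
have q_rho : bip Omega Th q rho = 0 by apply: H; split=> //; rewrite -bip_one.
have qq : bip Omega Th q q = 0.
  rewrite {1}/q (bipB Th Omega_polygonal (P3 _ rho1) (P3 _ kap1) (P3 _ q1)).
  rewrite (bipZ Th Omega_polygonal kappa (P3 _ one1) (P3 _ q1)).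
  by rewrite (bipC _ _ rho) q_rho (bipC _ _ (fun _ _ => 1)) q_one mulr0 subrr.
exists kappa => i x; apply/eqP; rewrite -subr_eq0 -[X in _ - X]mulr1.
by rewrite -/(q i x) (bip_eq0 Omega_polygonal Th_triangulation i x (P3 _ q1) qq).
Qed.

Lemma supp3_dx e : (forall i, supp 3 (e i)) -> forall i, supp 3 ((coef_dx \o e) i).
Proof. by move=> e3 i; apply: (supp_le (k := 2)) => //; exact: supp_dx. Qed.

Lemma supp3_dy e : (forall i, supp 3 (e i)) -> forall i, supp 3 ((coef_dy \o e) i).
Proof. by move=> e3 i; apply: (supp_le (k := 2)) => //; exact: supp_dy. Qed.

Lemma grad_h_cubics e : (forall i, supp 3 (e i)) ->
  grad_h (cubics e) = (cubics (coef_dx \o e), cubics (coef_dy \o e)).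
Proof. by move=> e3; rewrite /grad_h dx_h_cubics// dy_h_cubics. Qed.

Lemma hess_bipE e f : (forall i, supp 3 (e i)) -> (forall i, supp 3 (f i)) ->
  hess_bip Omega Th (cubics e) (cubics f) =
  vbip Omega Th (cubics (coef_dx \o (coef_dx \o e)), cubics (coef_dy \o (coef_dx \o e)))
    (cubics (coef_dx \o (coef_dx \o f)), cubics (coef_dy \o (coef_dx \o f))) +
  vbip Omega Th (cubics (coef_dx \o (coef_dy \o e)), cubics (coef_dy \o (coef_dy \o e)))
    (cubics (coef_dx \o (coef_dy \o f)), cubics (coef_dy \o (coef_dy \o f))).
Proof.
move=> e3 f3; rewrite /hess_bip /grad_bip !(grad_h_cubics e3) !(grad_h_cubics f3)/=.
by rewrite !grad_h_cubics//; first [exact: supp3_dx|exact: supp3_dy].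
Qed.

(** The difference has zero cellwise Hessian, so its gradient is cellwise constant and belongs to G:
    [flat_grad_eq0] kills the gradient, then [flat_eq0] the function. *)
Lemma hess_unique e f (F : broken R N -> R) :
  (forall i, supp 3 (e i)) -> (forall i, supp 3 (f i)) ->
  B3h0 Omega Th (cubics e) -> B3h0 Omega Th (cubics f) ->
  (forall v, B3h0 Omega Th v -> hess_bip Omega Th (cubics e) v = F v) ->
  (forall v, B3h0 Omega Th v -> hess_bip Omega Th (cubics f) v = F v) ->
  cubics e = cubics f.
Proof.
move=> e3 f3 Be Bf He Hf; pose z := coef_sub e f; have z3 := supp_sub e3 f3.
have Bz : B3h0 Omega Th (cubics z) := B3h0_sub e3 f3 Be Bf.
have zz : hess_bip Omega Th (cubics z) (cubics z) = 0.
  have : hess_bip Omega Th (cubics e) (cubics z) - hess_bip Omega Th (cubics f) (cubics z) = 0.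
    by rewrite He// Hf// subrr.
  move=> <-; rewrite !hess_bipE//; rewrite /z !(dx_sub, dy_sub).
  have [ex fx] := (supp3_dx e3, supp3_dx f3); have [ey fy] := (supp3_dy e3, supp3_dy f3).
  have [exx fxx] := (supp3_dx ex, supp3_dx fx); have [exy fxy] := (supp3_dy ex, supp3_dy fx).
  have [eyx fyx] := (supp3_dx ey, supp3_dx fy); have [eyy fyy] := (supp3_dy ey, supp3_dy fy).
  rewrite (vbip_sub exx exy fxx fxy (supp_sub exx fxx) (supp_sub exy fxy)).
  rewrite (vbip_sub eyx eyy fyx fyy (supp_sub eyx fyx) (supp_sub eyy fyy)).
  by ring.
rewrite hess_bipE// in zz.
have vge0 (v : vbroken R N) : 0 <= vbip Omega Th v v by rewrite addr_ge0 ?bip_ge0.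
move/eqP: zz; rewrite paddr_eq0// => /andP[/eqP hx /eqP hy].
have zx := supp3_dx z3; have zy := supp3_dy z3.
have Hx := vbip_eq0 (supp3_dx zx) (supp3_dy zx) hx.
have Hy := vbip_eq0 (supp3_dx zy) (supp3_dy zy) hy.
have G := grad_B3h0 z3 Bz; rewrite grad_h_cubics// in G.
have zx2 i : supp 2 ((coef_dx \o z) i) by exact: supp_dx.
have zy2 i : supp 2 ((coef_dy \o z) i) by exact: supp_dy.
have zx_cst i x y : cubic ((coef_dx \o z) i) x = cubic ((coef_dx \o z) i) y.
  by apply: gradient0_cst (zx i) _ _ => w; [exact: (Hx i w).1|exact: (Hx i w).2].
have zy_cst i x y : cubic ((coef_dy \o z) i) x = cubic ((coef_dy \o z) i) y.
  by apply: gradient0_cst (zy i) _ _ => w; [exact: (Hy i w).1|exact: (Hy i w).2].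
have g := flat_grad_eq0 zx2 zy2 G zx_cst zy_cst.
have [_ vc vz] := B3h0_A3h0 Bz.
have z0 := flat_eq0 z3 vc vz (fun i x => (g i x).1) (fun i x => (g i x).2).
apply/funext => i; apply/funext => x; apply/eqP; rewrite -subr_eq0; apply/eqP.
by have := congr1 (fun w : broken R N => w i x) (cubics_sub e f); rewrite /= => <-; exact: z0.
Qed.

Lemma grad_unique e f (G : vbroken R N -> R) :
  (forall i, supp 3 (e i)) -> (forall i, supp 3 (f i)) ->
  A3h0 Omega Th (cubics e) -> A3h0 Omega Th (cubics f) ->
  (forall v, A3h0 Omega Th v -> vbip Omega Th (grad_h (cubics e)) (grad_h v) = G (grad_h v)) ->
  (forall v, A3h0 Omega Th v -> vbip Omega Th (grad_h (cubics f)) (grad_h v) = G (grad_h v)) ->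
  cubics e = cubics f.
Proof.
move=> e3 f3 Ae Af He Hf; pose z := coef_sub e f; have z3 := supp_sub e3 f3.
have Az : A3h0 Omega Th (cubics z) := A3h0_sub e3 f3 Ae Af.
have zz : vbip Omega Th (grad_h (cubics z)) (grad_h (cubics z)) = 0.
  have : vbip Omega Th (grad_h (cubics e)) (grad_h (cubics z)) -
      vbip Omega Th (grad_h (cubics f)) (grad_h (cubics z)) = 0.
    by rewrite He// Hf// subrr.
  move=> <-; rewrite !grad_h_cubics// /z !(dx_sub, dy_sub).
  have [ex fx] := (supp3_dx e3, supp3_dx f3); have [ey fy] := (supp3_dy e3, supp3_dy f3).
  by rewrite (vbip_sub ex ey fx fy (supp_sub ex fx) (supp_sub ey fy)).
rewrite grad_h_cubics// in zz.
have g := vbip_eq0 (supp3_dx z3) (supp3_dy z3) zz; have [_ vc vz] := Az.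
have z0 := flat_eq0 z3 vc vz (fun i x => (g i x).1) (fun i x => (g i x).2).
apply/funext => i; apply/funext => x; apply/eqP; rewrite -subr_eq0; apply/eqP.
by have := congr1 (fun w : broken R N => w i x) (cubics_sub e f); rewrite /= => <-; exact: z0.
Qed.

End Scheme.

Theorem lemma30 (R : realType) (Omega : set (R * R)) (N : nat)
    (Th : 'I_N -> triangle R) (sigma : R)
    (Omega_polygonal : polygonal_domain Omega)
    (Omega_sc : simply_connected Omega)
    (Th_triangulation : triangulation Omega Th)
    (Th_regular : shape_regular sigma Th)
    (f : R * R -> R) (f_L2 : L2 Omega f)
    (r : broken R N) (phi : vbroken R N) (p ustar u : broken R N)
    (r_A : A3h0 Omega Th r)
    (r_eq : forall s, A3h0 Omega Th s ->
       vbip Omega Th (grad_h r) (grad_h s) = ip Omega f (broken_fun Th s))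
    (phi_G : G2h0 Omega Th phi)
    (p_P : Ph0 Omega Th 1 p)
    (phi_eq : forall psi, G2h0 Omega Th psi ->
       grad_bip Omega Th phi psi + bip Omega Th p (rot_h psi) =
       vbip Omega Th (grad_h r) psi)
    (rot_eq : forall q, Ph0 Omega Th 1 q -> bip Omega Th q (rot_h phi) = 0)
    (ustar_A : A3h0 Omega Th ustar)
    (ustar_eq : forall v, A3h0 Omega Th v ->
       vbip Omega Th (grad_h ustar) (grad_h v) = vbip Omega Th phi (grad_h v))
    (u_B : B3h0 Omega Th u)
    (u_eq : forall v, B3h0 Omega Th v ->
       hess_bip Omega Th u v = ip Omega f (broken_fun Th v)) :
  ustar = u.
Proof.
(* Omega is nonempty, so there is a cell, without which kappa would be arbitrary. *)
have [i0 _] : exists i : 'I_N, True.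
  have [[[x Ox] _ _ _] _] := Omega_polygonal.
  by have [i _] := domain_cell Th_triangulation Ox; exists i.
have [c2s d2s _ _] := phi_G.
have [c [c2 cE]] := Ph_cubics (k := 2) isT c2s.
have [d [d2 dE]] := Ph_cubics (k := 2) isT d2s.
have phiE : phi = (cubics c, cubics d) by rewrite [LHS]surjective_pairing cE dE.
have c3 i : supp 3 (c i) := supp_le (isT : (2 <= 3)%N) (c2 i).
have d3 i : supp 3 (d i) := supp_le (isT : (2 <= 3)%N) (d2 i).
have rotE i x : rot_h phi i x = cubic (coef_dx (d i)) x - cubic (coef_dy (c i)) x.
  by rewrite /rot_h phiE dx_h_cubics// dy_h_cubics.
have rot1 : Ph 1 (rot_h phi).
  move=> i; rewrite (_ : rot_h phi i = fun x => cubic (coef_dx (d i)) x - cubic (coef_dy (c i)) x).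
    by apply: Pk_sub => //; apply/PkP => //; [exists (coef_dx (d i))|exists (coef_dy (c i))] => //;
      [exact: supp_dx|exact: supp_dy].
  by apply/funext => x; rewrite rotE.
have [kappa rotk] := rot_mean_free Omega_polygonal Th_triangulation rot1 rot_eq.
have G := phi_G; rewrite phiE in G.
have k0 : kappa = 0.
  apply: (rot_cst_eq0 Omega_polygonal Th_triangulation c2 d2 G (kappa := kappa)); last by exists i0.
  by move=> i x; rewrite -rotE rotk.
have [|e [e3 Be gE]] := stokes_exact Omega_polygonal Omega_sc Th_triangulation c2 d2 G.
  by move=> i x; rewrite -rotE rotk k0.
have [[u3s _ _] _ _] := u_B; have [g [g3 uE]] := Ph_cubics (k := 3) isT u3s.
have [s3s _ _] := ustar_A; have [h [h3 sE]] := Ph_cubics (k := 3) isT s3s.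
have e_eq v : B3h0 Omega Th v -> hess_bip Omega Th (cubics e) v = ip Omega f (broken_fun Th v).
  move=> Bv; have [[v3s _ _] _ _] := Bv; have [z [z3 vE]] := Ph_cubics (k := 3) isT v3s.
  have Bz := Bv; rewrite vE in Bz.
  have Gv := grad_B3h0 Th_triangulation z3 Bz; rewrite -vE in Gv.
  have rot0 := rot_grad z3; rewrite -vE in rot0.
  (* As v is in A, the first step turns (f, v) into (grad r, grad v); the second, tested with grad
     v, turns this into the Hessian product plus a term in p that vanishes with rot grad v. *)
  rewrite -(r_eq _ (B3h0_A3h0 Bv)) -(phi_eq _ Gv) rot0 /hess_bip gE -phiE.
  rewrite -[LHS]addr0; congr (_ + _); rewrite /bip /ip; apply/esym.
  transitivity (\int[(@lebesgue_measure R \x @lebesgue_measure R)%E]_(x in Omega) (0 : R)).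
    apply: eq_Rintegral => x _; rewrite [X in _ * X]big1 ?mulr0// => i _.
    by rewrite mul0r.
  by rewrite /Rintegral integral0.
have eu : cubics e = u.
  have Bg := u_B; rewrite uE in Bg; have g_eq := u_eq; rewrite uE in g_eq; rewrite uE.
  exact: (hess_unique Omega_polygonal Th_triangulation e3 g3 Be Bg e_eq g_eq).
rewrite -eu sE; have Ah := ustar_A; rewrite sE in Ah.
have h_eq := ustar_eq; rewrite sE in h_eq.
(* As phi is the cellwise gradient of e, the third step is solved by e itself. *)
apply: (@grad_unique _ _ _ _ Omega_polygonal Th_triangulation _ _ (vbip Omega Th phi)
  h3 e3 Ah (B3h0_A3h0 Be) h_eq).
by move=> v Av; rewrite gE -phiE.
Qed.
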